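(* Let $d\ge2$ be an integer. Then there is a constant $C(d)$ depending only on $d$ such that, whenever $n\in\mathbb{N}$, $\mu$ is a log-concave probability measure on $\mathbb{R}^n$ and $f$ is a polynomial of degree $d$ on $\mathbb{R}^n$, for every function $\varphi\in C_b^\infty(\mathbb{R})$ with $\|\varphi\|_\infty\le1$ one has $$\sigma_f^{1/d}\int\varphi'(f)\,d\mu\le C(d)\,\|\varphi'\|_\infty^{1-1/d}.$$
   Context: A Borel probability measure on $\mathbb{R}^n$ is log-concave if it has a density $e^{-V}$ with respect to Lebesgue measure on some affine subspace $L$, where $V\colon L\to(-\infty,+\infty]$ is convex. $\sigma_f^2=\int(f-\int f\,d\mu)^2d\mu$ is the variance of $f$. $C_b^\infty(\mathbb{R})$ is the space of bounded smooth functions with bounded derivatives of all orders; $\|\varphi\|_\infty=\sup_t|\varphi(t)|$. *)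

(* Defs.v *)
From HB Require Import structures.
From mathcomp Require Import all_boot all_order all_algebra.
From mathcomp Require Import all_classical all_reals all_analysis.
From mathcomp Require mpoly.

Set Implicit Arguments.
Unset Strict Implicit.
Unset Printing Implicit Defensive.

Import Order.TTheory GRing.Theory Num.Theory.
Import numFieldNormedType.Exports.
Local Open Scope classical_set_scope.
Local Open Scope ring_scope.

Section Defs.
Variable R : realType.

(* R^k is represented by k.-tuple R, which carries the product (= Borel)
   sigma-algebra of mathcomp-analysis. *)

(* Integral of a nonnegative function against Lebesgue measure on R^k,
   computed as the iterated Lebesgue integral (Tonelli). *)
Fixpoint lebesgue_iint (k : nat) : (k.-tuple R -> \bar R) -> \bar R :=
  match k with
  | 0 => fun h => h [tuple]
  | k'.+1 => fun h =>
      (\int[@lebesgue_measure R]_(x in [set: R])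
         lebesgue_iint (fun y : k'.-tuple R => h [tuple of x :: y]))%E
  end.

Definition affine_map (n k : nat) (a : n.-tuple R) (M : 'M[R]_(n, k))
    (y : k.-tuple R) : n.-tuple R :=
  [tuple tnth a i + \sum_(j < k) M i j * tnth y j | i < n].

Definition tconv (k : nat) (t : R) (x y : k.-tuple R) : k.-tuple R :=
  [tuple t * tnth x i + (1 - t) * tnth y i | i < k].

Definition convex_ext (k : nat) (V : k.-tuple R -> \bar R) : Prop :=
  (forall y, V y != -oo%E) /\
  forall (x y : k.-tuple R) (t : R), 0 < t < 1 ->
    (V (tconv t x y) <= t%:E * V x + (1 - t)%:E * V y)%E.

(* mu is log-concave: it has a density e^{-V} (V convex with values in
   (-oo,+oo]) with respect to Lebesgue measure on some affine subspace
   L = a + M(R^k) (M injective, i.e. of rank k) of R^n. *)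
Definition log_concave (n : nat) (mu : probability (n.-tuple R) R) : Prop :=
  exists (k : nat) (a : n.-tuple R) (M : 'M[R]_(n, k))
         (V : k.-tuple R -> \bar R),
    \rank M = k /\ convex_ext V /\
    forall B : set (n.-tuple R), measurable B ->
      mu B = lebesgue_iint
               (fun y => ((\1_B (affine_map a M y))%:E * expeR (- V y))%E).

Definition poly_fun (n : nat) (p : mpoly.mpoly n R) (x : n.-tuple R) : R :=
  mpoly.meval (fun i => tnth x i) p.

(* total degree of p equals d (this is mpoly's msize p = d.+1, unfolded) *)
Definition poly_deg_eq (n : nat) (p : mpoly.mpoly n R) (d : nat) : Prop :=
  (\max_(m <- mpoly.msupp p) (mpoly.mdeg m).+1)%N = d.+1.

Definition Cb_infty (phi : R -> R) : Prop :=
  forall m : nat,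
    (forall t : R, derivable (derive1n m phi) t 1) /\
    exists K : R, forall t : R, `|derive1n m phi t| <= K.

Definition sup_norm (g : R -> R) : R := sup (range (fun t => `|g t|)).

Definition variance (n : nat) (mu : probability (n.-tuple R) R)
    (f : n.-tuple R -> R) : R :=
  Rintegral mu [set: n.-tuple R]
    (fun x => (f x - Rintegral mu [set: n.-tuple R] f) ^+ 2).

Definition std_dev (n : nat) (mu : probability (n.-tuple R) R)
    (f : n.-tuple R -> R) : R := Num.sqrt (variance mu f).

End Defs.

(* Main.v *)
(** Three classical ideas are combined.  First, Prékopa-Leindler (iterated over the coordinates) turns a
    log-concave density into Borell's inequality mu(A)^t mu(B)^(1-t) <= mu(tA + (1-t)B), and only this inequality
    is used afterwards; in particular a bounded convex set meets a hyperplane either in a null set or in almost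
    all of its mass.

    Second, localization: a convex set carrying a balanced function g(F) can be bisected through many points of a
    coordinate plane into convex pieces that are still balanced and nearly flat in that plane, so that one
    coordinate can be replaced by an affine function of another one.  By induction on the number of coordinates,
    an inequality between averages over D of functions of a polynomial F follows from the case where F is a
    univariate polynomial of an affine function.

    Third, in dimension one, let rho be a log-concave density with maximum w, and q a polynomial.  On each level
    interval of rho, integrating phi'(q) = (phi(q)/q')' + phi(q) q''/q'^2 over the O(d) pieces on which |q'| > e
    gives O(1/e), while Remez' inequality bounds the mass of {|q'| <= e}.  Optimizing e gives the claim for q, and
    the same tools give the reverse Hölder inequality for q.

    To globalize, fix m near the mean of F and cut with g(y) = y - m - th |y - m|, which is balanced for a
    suitable |th| <= 1/2; balanced pieces have standard deviation comparable with the average of |F - m|, hence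
    the average of phi'(F) is at most C M^(1-1/d) times that of (|F - m| + dl)^(-1/d), by convexity of the
    power.  Averaging over m removes the singularity. *)

Require Import Defs.
From HB Require Import structures.
From mathcomp Require Import all_boot all_order all_algebra.
From mathcomp Require Import all_classical all_reals all_analysis.
From mathcomp Require Import measurable_realfun ring lra zify.
From mathcomp Require mpoly.

Set Implicit Arguments.
Unset Strict Implicit.
Unset Printing Implicit Defensive.

Import Order.TTheory GRing.Theory Num.Theory.
Import numFieldNormedType.Exports HBNNSimple.
Local Open Scope classical_set_scope.
Local Open Scope ring_scope.

(** * Prékopa-Leindler and Borell's inequality *)

(** The inequality itself cannot be localized, because the standard deviation is not an average:
    bisection preserves one average, and the pieces of a set of large variance may have arbitrarily
    small variance. The balance with [th] repairs this. It keeps the mean of F on a piece within a /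
    2 of m, where a is the average of |F - m| there, so the mean absolute deviation on the piece is
    at least a / 2. A piece of small variance thus has F close to m, and its large bound a^(-1/d) is
    paid for by the integral of |F - m|^(-1/d) over it, a quantity that adds up over the pieces. For
    an unlucky m the total may be infinite, whence the average over a window of m comparable with
    the deviation of F, where t^(-1/d) is integrable. Two further points shape the statements.
    Replacing a coordinate disturbs the balance slightly, so localization is stated with a
    continuous bound [Psi] of one average by another. And the law of an affine function may have
    atoms, so one-dimensional densities arise by averaging that law over short windows, which
    Borell's inequality keeps log-concave. *)

Lemma young_powR (R : realType) (t x y : R) : 0 < t < 1 -> 0 <= x -> 0 <= y ->
  x `^ t * y `^ (1 - t) <= t * x + (1 - t) * y.
Proof.
move=> /andP[t0 t1] x0 y0.
have t1' : 0 < 1 - t by rewrite subr_gt0.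
have := @conjugate_powR R (x `^ t) (y `^ (1 - t)) t^-1 (1 - t)^-1 (powR_ge0 _ _) (powR_ge0 _ _).
rewrite !invr_gt0 !invrK => /(_ t0 t1'); rewrite subrKC => /(_ erefl).
rewrite -!powRrM !mulfV ?gt_eqF// !powRr1//.
by rewrite (mulrC x) (mulrC y).
Qed.

(** Uniqueness of Lebesgue measure: the pushforward by x -> (x - b) / a, divided by a, gives
    half-open intervals their length. *)
Lemma lebesgue_measure_affine (R : realType) (a b : R) (A : set R) : 0 < a ->
  measurable A ->
  lebesgue_measure ((fun x : R => (x - b) / a) @^-1` A) =
  (a%:E * lebesgue_measure A)%E.
Proof.
move=> a0 mA.
pose f := (fun x : R => (x - b) / a).
have mf : measurable_fun [set: measurableTypeR R] (f : _ -> measurableTypeR R).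
  by apply: measurable_funM => //; apply: measurable_funB => //.
have a'0 : (0 <= a^-1) by rewrite invr_ge0 ltW.
pose nu : {measure set (measurableTypeR R) -> \bar R} :=
  measure_function_pushforward__canonical__measure_function_Measure lebesgue_measure mf.
have : lebesgue_measure A = mscale (NngNum a'0) nu A.
  apply: lebesgue_measure_unique => //= _ [[c d]] _ <-; rewrite /nu.
  rewrite /mscale /= /pushforward.
  have -> : f @^-1` `]c, d]%classic = `](a * c + b), (a * d + b)]%classic.
    apply/seteqP; split => x /=; rewrite !in_itv /= /f ltr_pdivlMr// ler_pdivrMr//.
      by move=> /andP[h1 h2]; apply/andP; split; lra.
    by move=> /andP[h1 h2]; apply/andP; split; lra.
  rewrite !lebesgue_measure_itv/= !lte_fin ltrD2r ltr_pM2l//.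
  case: ifP => _; last by rewrite mule0.
  rewrite -!EFinB -EFinM; congr (_%:E).
  by field; rewrite gt_eqF.
rewrite /mscale /= /pushforward => ->.
by rewrite muleA -EFinM mulfV ?gt_eqF// mul1e.
Qed.

(** The set tA + (1-t)B need not be measurable, hence the measurable subset [C]. Take [a] in A
    almost at its supremum and [b] in B almost at its infimum: the sets tA + (1-t)b and ta + (1-t)B,
    trimmed at the point ta + (1-t)b, lie on its two sides and are disjoint. Trimming costs at most
    [e]. *)
Lemma minkowski_sum1 (R : realType) (t e L : R) (A B : set R) :
  0 < t < 1 -> 0 < e -> measurable A -> measurable B ->
  A `<=` `[-L, L] -> B `<=` `[-L, L] -> A !=set0 -> B !=set0 ->
  exists C : set R, [/\ measurable C,
    forall z, C z -> exists x y, [/\ A x, B y & z = t * x + (1 - t) * y] &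
    (t%:E * lebesgue_measure A + (1 - t)%:E * lebesgue_measure B <=
     lebesgue_measure C + e%:E)%E].
Proof.
move=> /andP[t0 t1] e0 mA mB AL BL A0 B0.
have t1' : 0 < 1 - t by rewrite subr_gt0.
have supA : has_sup A by split=> //; exists L => x /AL /=; rewrite in_itv => /andP[].
have infB : has_inf B by split=> //; exists (-L) => x /BL /=; rewrite in_itv => /andP[].
have e2 : 0 < e / 2 by rewrite divr_gt0.
have [a Aa ha] := sup_adherent e2 supA.
have [b Bb hb] := inf_adherent e2 infB.
pose A1 := A `&` `]-oo, a].
pose B1 := B `&` `]b, +oo[.
have mA1 : measurable A1 by apply: measurableI.
have mB1 : measurable B1 by apply: measurableI.
pose CA := (fun x : R => (x - (1 - t) * b) / t) @^-1` A1.
pose CB := (fun x : R => (x - t * a) / (1 - t)) @^-1` B1.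
have mCA : measurable CA.
  rewrite -[CA]setTI; apply: (_ : measurable_fun setT (fun x : R => (x - (1 - t) * b) / t)) => //.
  by apply: measurable_funM => //; apply: measurable_funB.
have mCB : measurable CB.
  rewrite -[CB]setTI; apply: (_ : measurable_fun setT (fun x : R => (x - t * a) / (1 - t))) => //.
  by apply: measurable_funM => //; apply: measurable_funB.
have leA : (lebesgue_measure A <= lebesgue_measure A1 + (e / 2)%:E)%E.
  apply: (@le_trans _ _ (lebesgue_measure (A1 `|` `]a, a + e / 2[%classic))).
    apply: le_measure; rewrite ?inE//; first exact: measurableU.
    move=> x Ax; have [xa|ax] := leP x a; [left|right] => /=.
      by split=> //=; rewrite in_itv /=.
    rewrite in_itv /= ax /=.
    have : x <= sup A by apply: ub_le_sup => //; case: supA.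
    by move: ha; lra.
  apply: le_trans (measureU2 _ _ _) _ => //.
  apply: leeD2l; rewrite /= lebesgue_measure_itv/= lte_fin ltrDl e2 -EFinB lee_fin; lra.
have leB : (lebesgue_measure B <= lebesgue_measure B1 + (e / 2)%:E)%E.
  apply: (@le_trans _ _ (lebesgue_measure (B1 `|` `]b - e / 2, b]%classic))).
    apply: le_measure; rewrite ?inE//; first exact: measurableU.
    move=> x Bx; have [xb|bx] := leP x b; [right|left] => /=; last first.
      by split=> //=; rewrite in_itv /= bx.
    rewrite in_itv /= xb andbT.
    have : inf B <= x by apply: ge_inf => //; case: infB.
    by move: hb; lra.
  apply: le_trans (measureU2 _ _ _) _ => //.
  apply: leeD2l; rewrite /= lebesgue_measure_itv/= lte_fin ltrBlDr ltrDl e2 -EFinB lee_fin; lra.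
have fA1 : lebesgue_measure A1 \is a fin_num.
  rewrite ge0_fin_numE// (@le_lt_trans _ _ (lebesgue_measure `[-L, L]%classic))//.
    by apply: le_measure; rewrite ?inE// => x [/AL].
  by rewrite lebesgue_measure_itv/=; case: ifP => // _; rewrite -EFinB ltry.
have fB1 : lebesgue_measure B1 \is a fin_num.
  rewrite ge0_fin_numE// (@le_lt_trans _ _ (lebesgue_measure `[-L, L]%classic))//.
    by apply: le_measure; rewrite ?inE// => x [/BL].
  by rewrite lebesgue_measure_itv/=; case: ifP => // _; rewrite -EFinB ltry.
exists (CA `|` CB); split; first exact: measurableU.
- move=> z [[Az _]|[Bz _]].
    by exists ((z - (1 - t) * b) / t), b; split=> //; field; rewrite gt_eqF.
  by exists a, ((z - t * a) / (1 - t)); split=> //; field; rewrite gt_eqF.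
- rewrite measureU//; last first.
    apply/seteqP; split=> // x [[_ /=] + [_ /=]].
    rewrite !in_itv/= andbT ler_pdivrMr// ltr_pdivlMr//.
    by lra.
  rewrite /= !lebesgue_measure_affine//.
  have [x mx] : exists x, lebesgue_measure A1 = x%:E by exists (fine (lebesgue_measure A1)); rewrite fineK.
  have [y my] : exists y, lebesgue_measure B1 = y%:E by exists (fine (lebesgue_measure B1)); rewrite fineK.
  move: leA leB; rewrite mx my => leA leB.
  apply: (@le_trans _ _ (t%:E * (x%:E + (e / 2)%:E) + (1 - t)%:E * (y%:E + (e / 2)%:E))%E).
    by apply: leeD; apply: lee_wpmul2l => //; rewrite lee_fin ltW.
  rewrite -!EFinD lee_fin; nra.
Qed.

(** The integral of a nonnegative function is a supremum over the simple functions below it, so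
    monotonicity holds for arbitrary integrands, such as the inner integrals of [lebesgue_iint],
    whose measurability is not known. *)
Lemma le_integral_nonmeasurable d (T : measurableType d) (R : realType)
    (mu : {measure set T -> \bar R}) (f g : T -> \bar R) :
  (forall x, (0 <= f x)%E) -> (forall x, (f x <= g x)%E) ->
  (\int[mu]_x f x <= \int[mu]_x g x)%E.
Proof.
move=> f0 fg.
have g0 x : (0 <= g x)%E by apply: le_trans (fg x).
rewrite !ge0_integralTE//; apply: le_ereal_sup => _ [h hf <-]; exists h => // x.
by apply: le_trans (fg x).
Qed.

(* For a non-measurable integrand, mathcomp's integral is the lower integral. *)
Lemma lt_integral_nnsfun d (T : measurableType d) (R : realType)
    (mu : {measure set T -> \bar R}) (f : T -> \bar R) (a : R) :
  (forall x, (0 <= f x)%E) -> (a%:E < \int[mu]_x f x)%E ->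
  exists h : {nnsfun T >-> R}, (forall x, ((h x)%:E <= f x)%E) /\
    (a%:E < \int[mu]_x (h x)%:E)%E.
Proof.
move=> f0; rewrite ge0_integralTE// => /ereal_sup_gt[_ [h hf <-]] ah.
by exists h; split=> //; rewrite integralT_nnsfun.
Qed.

(** The levels need not be nested: the number of levels that hold at a point is bounded by the
    largest of them, and this single level then carries the estimate. The value 0 stands for no
    level at all. *)
Lemma max_level (p : pred nat) (N : nat) : exists j : nat,
  (j = 0%N \/ ((1 <= j < N)%N /\ p j)) /\ (\sum_(1 <= i < N) p i <= j)%N.
Proof.
elim: N => [|N [j [hj hs]]]; first by exists 0%N; split; [left|rewrite big_geq].
have [->|N0] := eqVneq N 0%N.
  by exists 0%N; split; [left|rewrite big_geq].
rewrite -lt0n in N0; rewrite big_nat_recr//=.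
have [pN|pN] := boolP (p N).
  exists N; split; first by right; rewrite N0 ltnSn.
  have : (\sum_(1 <= i < N) p i <= \sum_(1 <= i < N) 1)%N by apply: leq_sum => i _; case: (p i).
  rewrite sum_nat_const_nat muln1 => h; rewrite /= addn1; lia.
exists j; split; last by rewrite addn0.
case: hj => [->|[/andP[h1 h2] pj]]; [by left|right]; split=> //.
by rewrite h1 /= (ltn_trans h2).
Qed.

(** Rounds [y] up to the grid of step [c]; the term 1 is level 0, counted unconditionally. The
    minimum is what makes the induction on the number of levels work. *)
Lemma le_sum_levels (R : realType) (c y : R) (N : nat) : 0 <= c -> (0 < N)%N ->
  Num.min y (c * N%:R) <= c * (1 + \sum_(1 <= i < N) (c * i%:R < y)%R%:R).
Proof.
move=> c0; elim: N => [//|N IH _].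
have [->|N0] := eqVneq N 0%N.
  by rewrite big_geq// addr0 !mulr1 ge_min lexx orbT.
rewrite -lt0n in N0; rewrite big_nat_recr//=.
have {IH} := IH N0; set s := \sum_(1 <= i < N) _.
rewrite -natr1 !mulrDr mulr1.
have [cNy|ycN] := ltP (c * N%:R) y; rewrite /= ?mulr1n ?mulr0n ?mulr1 ?mulr0 => h.
  by apply: le_trans (_ : c * N%:R + c <= _); [rewrite ge_min lexx orbT|lra].
by apply: le_trans (_ : y <= _); [rewrite ge_min lexx|lra].
Qed.

Lemma integral_sum_indic d (T : measurableType d) (R : realType)
    (mu : {measure set T -> \bar R}) (S : nat -> set T) (s : seq nat) (c : R) :
  0 <= c -> (forall i, measurable (S i)) ->
  (\int[mu]_x (c * \sum_(i <- s) \1_(S i) x)%:E =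
   c%:E * \sum_(i <- s) mu (S i))%E.
Proof.
move=> c0 mS.
under eq_integral do rewrite EFinM -sumEFin.
rewrite ge0_integralZl//.
- congr (_ * _)%E; rewrite ge0_integral_sum//.
  + by apply: eq_bigr => i _; rewrite integral_indic// setIT.
  + by move=> i; apply/measurable_EFinP.
- by apply: emeasurable_sum => i; apply/measurable_EFinP.
- by move=> x _; apply: sume_ge0 => i _; rewrite lee_fin.
Qed.

Lemma ler_divn_all (R : realType) (x y c : R) :
  (forall N, (0 < N)%N -> x <= y + c / N%:R) -> x <= y.
Proof.
move=> H; rewrite leNgt; apply/negP => yx.
have c0 : 0 < c.
  by have := H 1%N isT; rewrite divr1; lra.
have d0 : 0 < x - y by rewrite subr_gt0.
pose N := (Num.bound (c / (x - y))).+1.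
have := H N isT; rewrite -lerBlDl ler_pdivlMr ?ltr0n// mulrC -ler_pdivlMr//.
apply/negP; rewrite -ltNge.
have h : c / (x - y) < (Num.bound (c / (x - y)))%:R.
  by apply: archi_boundP; rewrite divr_ge0 ?ltW.
by apply: lt_trans h _; rewrite ltr_nat.
Qed.

(** Level 0 is replaced by the whole support interval, which costs 2 L a / N and vanishes in the
    limit. *)
Lemma integral_le_levels (R : realType) (u : R -> R) (L a : R) (N : nat) :
  0 < L -> measurable_fun setT u -> (forall x, 0 <= u x) -> (forall x, u x <= a) ->
  (forall x, 0 < u x -> `[-L, L]%classic x) -> (0 < N)%N ->
  let A i := [set x | a / N%:R * i%:R < u x] in
  (forall i, measurable (A i)) /\
  (\int[@lebesgue_measure R]_x (u x)%:E <= (a / N%:R)%:E *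
     ((2 * L)%:E + \sum_(1 <= i < N) lebesgue_measure (A i)))%E.
Proof.
move=> L0 mu u0 ua uL N0 A.
have mA i : measurable (A i).
  rewrite /A -[X in measurable X]setTI.
  have := measurable_fun_ltr (@measurable_cst _ _ _ _ setT (a / N%:R * i%:R)) mu.
  by move=> /(_ measurableT [set true]) /=; apply.
split=> //.
have a0 : 0 <= a by apply: le_trans (u0 0) (ua 0).
have aN0 : 0 <= a / N%:R by rewrite divr_ge0.
pose S i := if i is 0%N then (`[-L, L]%classic : set R) else A i.
have mS i : measurable (S i) by case: i => [|i] /=.
have -> : ((2 * L)%:E + \sum_(1 <= i < N) lebesgue_measure (A i) =
    \sum_(0 <= i < N) lebesgue_measure (S i))%E.
  rewrite [RHS]big_ltn//; congr (_ + _)%E.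
    rewrite lebesgue_measure_itv/= lte_fin; rewrite ifT; last lra.
    by rewrite -EFinD; congr (_%:E); lra.
  by apply: eq_big_nat => i /andP[i1 _]; case: i i1.
rewrite -integral_sum_indic//; apply: le_integral_nonmeasurable => x.
  by rewrite lee_fin.
rewrite lee_fin; have [ux|] := ltP 0 (u x); last first.
  by move=> h; apply: (le_trans h); rewrite mulr_ge0// sumr_ge0.
have aNN : a / N%:R * N%:R = a by rewrite divfK// pnatr_eq0 -lt0n.
have := @le_sum_levels R (a / N%:R) (u x) N aN0 N0.
rewrite aNN (min_l (ua x)) => /le_trans; apply.
apply: ler_wpM2l => //; rewrite [leRHS]big_ltn//; apply: lerD.
  by rewrite indicE mem_set//; exact: uL.
apply: ler_sum_nat => i /andP[i1 _].
case: i i1 => // i _; rewrite /= indicE.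
by case: ltP => h /=; rewrite ?ler0n// mem_set.
Qed.

(** Both functions are measured relative to their suprema [a] and [b]. The levels i / N of the two
    quotients are then nonempty together, the one-dimensional Brunn-Minkowski inequality applies to
    each pair, and W is at least a^t b^(1-t) i / N on the resulting set. Working with finitely many
    levels keeps the possibly nonmeasurable W out of any layer-cake formula. *)
Lemma prekopa_bounded (R : realType) (t L a b : R) (u v : R -> R) (W : R -> \bar R) :
  0 < t < 1 -> 0 < L -> measurable_fun setT u -> measurable_fun setT v ->
  (forall x, 0 <= u x <= a) -> (forall x, 0 <= v x <= b) ->
  (forall x, 0 < u x -> `[-L, L]%classic x) -> (forall x, 0 < v x -> `[-L, L]%classic x) ->
  0 < a -> 0 < b ->
  (forall c, c < a -> exists x, c < u x) -> (forall c, c < b -> exists x, c < v x) ->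
  (forall x, (0 <= W x)%E) ->
  (forall (x y al be : R), 0 < al -> 0 < be -> al < u x -> be < v y ->
    ((al `^ t * be `^ (1 - t))%:E <= W (t * x + (1 - t) * y)%R)%E) ->
  forall Iu Iv, (Iu%:E <= \int[@lebesgue_measure R]_x (u x)%:E)%E ->
    (Iv%:E <= \int[@lebesgue_measure R]_x (v x)%:E)%E ->
  ((a `^ t * b `^ (1 - t) * (t * (Iu / a) + (1 - t) * (Iv / b)))%:E <=
    \int[@lebesgue_measure R]_x W x)%E.
Proof.
move=> t01 L0 mu mv ub vb uL vL a0 b0 au bv W0 H Iu Iv hIu hIv.
have [W1|] := eqVneq (\int[@lebesgue_measure R]_x W x)%E +oo%E; first by rewrite W1 leey.
move=> Wfin; have : (\int[@lebesgue_measure R]_x W x)%E \is a fin_num.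
  by rewrite ge0_fin_numE ?integral_ge0// lt_neqAle Wfin leey.
move=> {Wfin} /fineK; set w := fine _ => Ew; rewrite -Ew lee_fin.
have [t0 t1] := andP t01.
set ab := a `^ t * b `^ (1 - t).
have ab0 : 0 < ab by rewrite mulr_gt0 ?powR_gt0.
(* The error has a part 2 L from level 0 of each function, and a part 1 from the fewer than N losses
   1 / N in [minkowski_sum1]. *)
apply: (@ler_divn_all R _ _ (ab * (2 * L * (t + (1 - t)) + 1))) => N N0.
have N0' : 0 < N%:R :> R by rewrite ltr0n.
have u0 x : 0 <= u x by case/andP: (ub x).
have v0 x : 0 <= v x by case/andP: (vb x).
have ua x : u x <= a by case/andP: (ub x).
have vb' x : v x <= b by case/andP: (vb x).
have [mA hA] := @integral_le_levels R u L a N L0 mu u0 ua uL N0.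
have [mB hB] := @integral_le_levels R v L b N L0 mv v0 vb' vL N0.
pose A i := [set x | a / N%:R * i%:R < u x].
pose B i := [set x | b / N%:R * i%:R < v x].
have AL i : A i `<=` `[-L, L].
  move=> x Ax; apply: uL; apply: le_lt_trans Ax.
  by rewrite !mulr_ge0// ?invr_ge0 ltW.
have BL i : B i `<=` `[-L, L].
  move=> x Ax; apply: vL; apply: le_lt_trans Ax.
  by rewrite !mulr_ge0// ?invr_ge0 ltW.
have fL : (lebesgue_measure (`[(- L)%R, L%R]%classic : set R) < +oo)%E.
  by rewrite lebesgue_measure_itv/=; case: ifP => // _; rewrite -EFinB ltry.
have fA i : (lebesgue_measure (A i)) \is a fin_num.
  by rewrite ge0_fin_numE//; apply: le_lt_trans fL; apply: le_measure; rewrite ?inE//; exact: mA.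
have fB i : (lebesgue_measure (B i)) \is a fin_num.
  by rewrite ge0_fin_numE//; apply: le_lt_trans fL; apply: le_measure; rewrite ?inE//; exact: mB.
pose al i := fine (lebesgue_measure (A i)).
pose be i := fine (lebesgue_measure (B i)).
have Nlt (c : R) i : 0 < c -> (i < N)%N -> c / N%:R * i%:R < c.
  move=> c0 iN; rewrite -mulrA gtr_pMr// mulrC ltr_pdivrMr// mul1r ltr_nat//.
have /choice[C hC] : forall i, exists C : set R, measurable C /\ ((1 <= i < N)%N ->
    (forall z, C z -> exists x y, [/\ A i x, B i y & z = t * x + (1 - t) * y]) /\
    (t%:E * lebesgue_measure (A i) + (1 - t)%:E * lebesgue_measure (B i) <=
     lebesgue_measure C + (N%:R^-1)%:E)%E).
  move=> i; have [iN|iN] := boolP (1 <= i < N)%N; last by exists set0; split.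
  have [i1 iN'] := andP iN.
  have [C [mC h1 h2]] : exists C : set R, [/\ measurable C,
    forall z, C z -> exists x y, [/\ A i x, B i y & z = t * x + (1 - t) * y] &
    (t%:E * lebesgue_measure (A i) + (1 - t)%:E * lebesgue_measure (B i) <=
     lebesgue_measure C + (N%:R^-1)%:E)%E].
    apply: (@minkowski_sum1 R t N%:R^-1 L) => //.
    - by rewrite invr_gt0.
    - exact: mA.
    - exact: mB.
    - by have [x hx] := au _ (Nlt a i a0 iN'); exists x.
    - by have [x hx] := bv _ (Nlt b i b0 iN'); exists x.
  by exists C; split.
have mC i : measurable (C i) by case: (hC i).
have abN0 : 0 <= ab / N%:R by rewrite divr_ge0// ltW.
have HW x : ((ab / N%:R * \sum_(1 <= i < N) \1_(C i) x)%:E <= W x)%E.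
  have [j [hj hs]] := max_level (fun i => x \in C i) N.
  apply: (@le_trans _ _ (ab / N%:R * j%:R)%:E).
    rewrite lee_fin ler_wpM2l//.
    move: hs; rewrite -(ler_nat R) natr_sum; apply: le_trans.
    by apply: ler_sum_nat => i _; rewrite indicE.
  case: hj => [->|[jN /set_mem Cj]]; first by rewrite mulr0.
  have [_ /(_ jN)[hz _]] := hC j.
  have [x1 [y1 [Ax By ->]]] := hz _ Cj.
  have j0 : 0 < j%:R / N%:R :> R by rewrite divr_gt0// ltr0n; case/andP: jN.
  have -> : ab / N%:R * j%:R = (a * (j%:R / N%:R)) `^ t * (b * (j%:R / N%:R)) `^ (1 - t).
    rewrite -mulrA (mulrC N%:R^-1); move: (j%:R / N%:R) j0 => c c0.
    rewrite !powRM ?(ltW c0) ?(ltW a0) ?(ltW b0)// [RHS]mulrACA -powRD.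
      by rewrite subrKC powRr1 ?(ltW c0).
    by rewrite (gt_eqF c0) implybT.
  apply: H; [exact: mulr_gt0|exact: mulr_gt0| |].
    by rewrite mulrA mulrAC; exact: Ax.
  by rewrite mulrA mulrAC; exact: By.
have HI : ((ab / N%:R)%:E * \sum_(1 <= i < N) lebesgue_measure (C i) <= w%:E)%E.
  rewrite Ew -integral_sum_indic//.
  apply: le_integral_nonmeasurable => // x.
  by rewrite lee_fin mulr_ge0 ?sumr_ge0.
have Hw : ab / N%:R * \sum_(1 <= i < N) (t * al i + (1 - t) * be i - N%:R^-1) <= w.
  rewrite -lee_fin; apply: le_trans HI.
  rewrite EFinM lee_wpmul2l ?lee_fin// -sumEFin.
  rewrite big_seq [leRHS]big_seq; apply: lee_sum => i; rewrite mem_index_iota => iN.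
  have [_ /(_ iN)[_]] := hC i.
  by rewrite -(fineK (fA i)) -(fineK (fB i)) (EFinB _ N%:R^-1) leeBlDr.
have sumE (S : nat -> set R) : (forall i, lebesgue_measure (S i) \is a fin_num) ->
    (\sum_(1 <= i < N) lebesgue_measure (S i) = (\sum_(1 <= i < N) fine (lebesgue_measure (S i)))%:E)%E.
  by move=> h; rewrite -sumEFin; apply: eq_bigr => i _; rewrite fineK.
have hu : Iu / a - 2 * L / N%:R <= (\sum_(1 <= i < N) al i) / N%:R.
  have := le_trans hIu hA; rewrite (sumE A)// -EFinD -EFinM lee_fin.
  rewrite -/(\sum_(1 <= i < N) al i); move: (\sum_(1 <= i < N) al i) => X h.
  rewrite lerBlDr -mulrDl ler_pdivrMr//.
  by rewrite (_ : _ / _ * _ = a / N%:R * (2 * L + X))//; ring.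
have hv : Iv / b - 2 * L / N%:R <= (\sum_(1 <= i < N) be i) / N%:R.
  have := le_trans hIv hB; rewrite (sumE B)// -EFinD -EFinM lee_fin.
  rewrite -/(\sum_(1 <= i < N) be i); move: (\sum_(1 <= i < N) be i) => X h.
  rewrite lerBlDr -mulrDl ler_pdivrMr//.
  by rewrite (_ : _ / _ * _ = b / N%:R * (2 * L + X))//; ring.
have hn : \sum_(1 <= i < N) (N%:R^-1 : R) <= 1.
  by rewrite sumr_const_nat -[X in X <= _]mulr_natl ler_pdivrMr// mul1r ler_nat leq_subr.
move: Hw; rewrite big_split/= sumrN big_split/= -!mulr_sumr.
set X := \sum_(1 <= i < N) al i in hu *.
set Y := \sum_(1 <= i < N) be i in hv *.
set Z := \sum_(1 <= i < N) _ in hn *.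
move=> Hw; rewrite -lerBlDr; apply: le_trans Hw.
rewrite -[X in _ - X]mulrA -[leRHS]mulrA -mulrBr ler_wpM2l ?(ltW ab0)//.
have h1 : t * (Iu / a - 2 * L / N%:R) <= t * (X / N%:R) by rewrite (ler_wpM2l (ltW t0)).
have h2 : (1 - t) * (Iv / b - 2 * L / N%:R) <= (1 - t) * (Y / N%:R).
  by rewrite ler_wpM2l// subr_ge0 ltW.
have h3 : N%:R^-1 * Z <= N%:R^-1 * 1 by rewrite ler_wpM2l// invr_ge0 ltW.
lra.
Qed.

(** A simple function below [U], restricted to a large interval; the strict inequality on the
    integral leaves room for both approximations. Being bounded, it has a finite supremum [a] to
    normalise by. *)
Lemma bounded_support_minorant (R : realType) (U : R -> \bar R) (al : R) :
  (forall x, (0 <= U x)%E) -> 0 < al ->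
  (al%:E < \int[@lebesgue_measure R]_x U x)%E ->
  exists (u : R -> R) (a L : R), [/\ measurable_fun setT u,
    forall x, 0 <= u x <= a, 0 < a /\ forall c, c < a -> exists x, c < u x,
    0 < L /\ forall x, 0 < u x -> `[-L, L]%classic x &
    (forall x, ((u x)%:E <= U x)%E) /\ (al%:E <= \int[@lebesgue_measure R]_x (u x)%:E)%E].
Proof.
move=> U0 al0 hh; have [h [hU hal]] := @lt_integral_nnsfun _ (measurableTypeR R) R lebesgue_measure U al U0 hh.
pose F (n : nat) : set R := `[- n.+1%:R, n.+1%:R]%classic.
have : exists n, (al%:E <= \int[@lebesgue_measure R]_(x in F n) (h x)%:E)%E.
  apply: contrapT => /forallNP Hn.
  have F1 : nondecreasing_seq F.
    move=> m n mn; apply/subsetPset => x; rewrite /F /= !in_itv /= => /andP[h1 h2].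
    have mn' : m.+1%:R <= n.+1%:R :> R by rewrite ler_nat.
    by apply/andP; split; lra.
  have F2 i : measurable (F i : set (measurableTypeR R)) by exact: measurable_itv.
  have F3 i : measurable_fun (F i : set (measurableTypeR R)) (fun x : measurableTypeR R => (h x)%:E).
    by apply/measurable_EFinP; apply: measurable_funS (measurable_funPT h).
  have F4 i (x : measurableTypeR R) : F i x -> (0 <= (h x)%:E)%E by rewrite lee_fin.
  have := @ge0_nondecreasing_set_cvg_integral _ (measurableTypeR R) R F
    (fun x => (h x)%:E) lebesgue_measure F1 F2 F3 F4.
  have -> : \bigcup_i F i = setT.
    apply/seteqP; split => // x _; exists (Num.bound `|x|) => //=.
    rewrite /F /= in_itv /= -ler_norml; apply: ltW.
    by apply: (lt_trans (archi_boundP (normr_ge0 x))); rewrite ltr_nat.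
  move=> H.
  have : (\int[@lebesgue_measure R]_(x in [set: R]) (h x)%:E <= al%:E)%E.
    by apply: cvge_le H; apply: nearW => n; move/negP: (Hn n); rewrite -ltNge => /ltW.
  by rewrite leNgt hal.
move=> [n]; rewrite integral_mkcond => hn.
pose u := (h : R -> R) \_ (F n).
have uE : (fun x => ((EFin \o h) \_ (F n)) x) = (fun x => (u x)%:E).
  by apply/funext => x; rewrite /u !patchE; case: ifP.
move: hn; rewrite uE => hn.
have u0 x : 0 <= u x by rewrite /u patchE; case: ifP.
have uh x : u x <= h x by rewrite /u patchE; case: ifP => // _; exact: (@fun_ge0 _ _ h x).
have [M [_ hM]] := simple_bounded h.
have ubM : ubound (range u) (M + 1).
  move=> _ [x _ <-]; apply: le_trans (uh x) _.
  by apply: le_trans (ler_norm _) _; apply: hM => //; rewrite ltrDl.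
have hs : has_sup (range u) by split; [exists (u 0), 0|exists (M + 1)].
have ua x : u x <= sup (range u) by apply: ub_le_sup; [case: hs|exists x].
have a0 : 0 < sup (range u).
  rewrite ltNge; apply/negP => s0.
  have uz x : u x = 0 by apply/eqP; rewrite eq_le u0 (le_trans (ua x)).
  move: hn; under eq_integral do rewrite uz.
  by rewrite integral0 lee_fin leNgt al0.
exists u, (sup (range u)), n.+1%:R; split.
- apply/(measurable_restrictT h); first by rewrite /F.
  exact: measurable_funS (measurable_funPT h).
- by move=> x; rewrite u0 ua.
- split=> // c /sup_gt[|y [x _ <-]] ; first by exists (u 0), 0.
  by exists x.
- split=> // x; rewrite /u patchE; case: ifP; last by rewrite ltxx.
  by rewrite inE.
- split=> // x; apply: le_trans (hU x); by rewrite lee_fin.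
Qed.

(* The hypothesis has the same shape as the conclusion, so that the inequality
   iterates over the coordinates without any measurability assumption. *)
Lemma prekopa_leindler1 (R : realType) (t : R) (U V W : R -> \bar R) : 0 < t < 1 ->
  (forall x, (0 <= U x)%E) -> (forall x, (0 <= V x)%E) -> (forall x, (0 <= W x)%E) ->
  (forall (x y al be : R), 0 < al -> 0 < be -> (al%:E < U x)%E -> (be%:E < V y)%E ->
    ((al `^ t * be `^ (1 - t))%:E <= W (t * x + (1 - t) * y)%R)%E) ->
  forall al be : R, 0 < al -> 0 < be ->
    (al%:E < \int[@lebesgue_measure R]_x U x)%E ->
    (be%:E < \int[@lebesgue_measure R]_x V x)%E ->
    ((al `^ t * be `^ (1 - t))%:E <= \int[@lebesgue_measure R]_x W x)%E.
Proof.
move=> t01 U0 V0 W0 H al be al0 be0 hal hbe.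
have [u [a [L [mu ub [a0 au] [L0 uL] [uU uI]]]]] := bounded_support_minorant U0 al0 hal.
have [v [b [L' [mv vb [b0 bv] [L'0 vL] [vV vI]]]]] := bounded_support_minorant V0 be0 hbe.
have := @prekopa_bounded R t (Num.max L L') a b u v W t01 _ mu mv ub vb _ _ a0 b0 au bv W0 _ al be uI vI.
move=> /(_ _ _ _ _)/le_trans => K.
apply: le_trans (K _ _ _ _ _ (lexx _)).
(* The weighted arithmetic mean of al / a and be / b dominates the geometric one, which cancels the
   normalisation by the suprema. *)
- have /andP[t0 t1] := t01.
  rewrite lee_fin.
  have := @young_powR R t (al / a) (be / b) t01.
  rewrite !divr_ge0 ?(ltW al0) ?(ltW be0) ?(ltW a0) ?(ltW b0)// => /(_ isT isT) Y.
  have ab0 : 0 < a `^ t * b `^ (1 - t) by rewrite mulr_gt0 ?powR_gt0.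
  apply: le_trans (_ : _ <= a `^ t * b `^ (1 - t) * ((al / a) `^ t * (be / b) `^ (1 - t))) _.
    rewrite mulrACA -!powRM ?divr_ge0 ?(ltW al0) ?(ltW be0) ?(ltW a0) ?(ltW b0)//.
    by rewrite !(mulrC _ (_ / _)) !divfK ?gt_eqF.
  by rewrite ler_wpM2l// ltW.
- by rewrite lt_max L0.
- move=> x /uL/=; rewrite !in_itv /= => /andP[h1 h2].
  have : L <= Num.max L L' /\ L' <= Num.max L L' by rewrite !le_max !lexx orbT.
  by move=> [m1 m2]; apply/andP; split; lra.
- move=> x /vL/=; rewrite !in_itv /= => /andP[h1 h2].
  have : L <= Num.max L L' /\ L' <= Num.max L L' by rewrite !le_max !lexx orbT.
  by move=> [m1 m2]; apply/andP; split; lra.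
- move=> x y al' be' al'0 be'0 h1 h2; apply: H => //.
    by apply: lt_le_trans (uU x); rewrite lte_fin.
  by apply: lt_le_trans (vV y); rewrite lte_fin.
Qed.

Lemma lebesgue_iint_ge0 (R : realType) (k : nat) (h : k.-tuple R -> \bar R) :
  (forall y, (0 <= h y)%E) -> (0 <= lebesgue_iint h)%E.
Proof.
elim: k h => [|k IH] h h0 /=; first exact: h0.
by apply: integral_ge0 => x _; apply: IH.
Qed.

Lemma tconv_cons (R : realType) (k : nat) (t x y : R) (a b : k.-tuple R) :
  tconv t [tuple of x :: a] [tuple of y :: b] =
  [tuple of (t * x + (1 - t) * y) :: tconv t a b].
Proof.
apply: eq_from_tnth => i; rewrite tnth_mktuple.
by case: (unliftP ord0 i) => [j ->|->]; rewrite ?tnthS ?tnth0// tnth_mktuple.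
Qed.

Lemma prekopa_leindler (R : realType) (k : nat) (t : R) (u v w : k.-tuple R -> \bar R) :
  0 < t < 1 ->
  (forall y, (0 <= u y)%E) -> (forall y, (0 <= v y)%E) -> (forall y, (0 <= w y)%E) ->
  (forall x y (al be : R), 0 < al -> 0 < be -> (al%:E < u x)%E -> (be%:E < v y)%E ->
    ((al `^ t * be `^ (1 - t))%:E <= w (tconv t x y))%E) ->
  forall al be : R, 0 < al -> 0 < be ->
    (al%:E < lebesgue_iint u)%E -> (be%:E < lebesgue_iint v)%E ->
    ((al `^ t * be `^ (1 - t))%:E <= lebesgue_iint w)%E.
Proof.
move=> t01; elim: k u v w => [|k IH] u v w u0 v0 w0 H /= al be al0 be0 hal hbe.
  by have := H _ _ _ _ al0 be0 hal hbe; rewrite (tuple0 (tconv _ _ _)).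
apply: (@prekopa_leindler1 R t
  (fun x => lebesgue_iint (fun y : k.-tuple R => u [tuple of x :: y]))
  (fun x => lebesgue_iint (fun y : k.-tuple R => v [tuple of x :: y]))) => //.
- by move=> x; apply: lebesgue_iint_ge0.
- by move=> x; apply: lebesgue_iint_ge0.
- by move=> x; apply: lebesgue_iint_ge0.
move=> x y al' be' al'0 be'0 h1 h2.
apply: (IH _ _ _ _ _ _ _ al' be' al'0 be'0 h1 h2) => // a b al2 be2 al20 be20 h3 h4.
by rewrite -tconv_cons; apply: H.
Qed.

Lemma affine_map_tconv (R : realType) (n k : nat) (a : n.-tuple R) (M : 'M[R]_(n, k))
    (t : R) (x y : k.-tuple R) :
  affine_map a M (tconv t x y) = tconv t (affine_map a M x) (affine_map a M y).
Proof.
apply: eq_from_tnth => i; rewrite !tnth_mktuple.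
under eq_bigr do rewrite tnth_mktuple mulrDr.
rewrite big_split /= !mulrDr !mulr_sumr.
under eq_bigr do rewrite mulrCA.
under [X in _ + (_ + X)]eq_bigr do rewrite mulrCA.
by lra.
Qed.

(** The three-function hypothesis holds for indicators times the density: where a factor vanishes no
    positive level lies below it, and elsewhere it is the convexity of [V]. Everything happens in
    the parameter space of the affine subspace, since [affine_map] commutes with [tconv], so
    degenerate measures are treated like the others. *)
Lemma log_concave_borell (R : realType) (n : nat) (mu : probability (n.-tuple R) R)
    (t : R) (A B C : set (n.-tuple R)) : log_concave mu -> 0 < t < 1 ->
  measurable A -> measurable B -> measurable C ->
  (forall x y, A x -> B y -> C (tconv t x y)) ->
  fine (mu A) `^ t * fine (mu B) `^ (1 - t) <= fine (mu C).
Proof.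
move=> [k [a [M [V [_ [[Vy Vc] hmu]]]]]] t01 mA mB mC ABC.
have [t0 t1] := andP t01.
have key (al be : R) : 0 < al -> 0 < be -> (al%:E < mu A)%E -> (be%:E < mu B)%E ->
    ((al `^ t * be `^ (1 - t))%:E <= mu C)%E.
  rewrite !hmu// => al0 be0.
  have pos (S : set (n.-tuple R)) y : (0 <= (\1_S (affine_map a M y))%:E * expeR (- V y))%E.
    by apply: mule_ge0; [rewrite lee_fin|exact: expeR_ge0].
  apply: prekopa_leindler => // x y {}al {}be {}al0 {}be0.
  rewrite !indicE.
  have [/set_mem Ax|_] := boolP (_ \in A); last by rewrite mul0e lte_fin ltNge (ltW al0).
  have [/set_mem By|_] := boolP (_ \in B); last by move=> _; rewrite mul0e lte_fin ltNge (ltW be0).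
  rewrite !mul1e affine_map_tconv mem_set; last exact: ABC.
  rewrite mul1e.
  have := Vc x y t t01; have := Vy (tconv t x y); have := Vy x; have := Vy y.
  case: (V x) => [vx| |] //; last by rewrite /= lte_fin ltNge (ltW al0).
  case: (V y) => [vy| |] //; last by move=> ? ? ? ? _; rewrite /= lte_fin ltNge (ltW be0).
  case: (V _) => [vz| |] // _ _ _; rewrite -!EFinM -EFinD ?leye_eq// lee_fin => hv.
  rewrite /= !lte_fin lee_fin => h1 h2.
  apply: (@le_trans _ _ (expR (- vx) `^ t * expR (- vy) `^ (1 - t))).
    have t1' : 0 <= 1 - t by rewrite subr_ge0 ltW.
    apply: ler_pM; rewrite ?powR_ge0//.
      by apply: (ge0_ler_powR (ltW t0)); rewrite ?nnegrE ?expR_ge0 ?(ltW h1)// ltW.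
    by apply: (ge0_ler_powR t1'); rewrite ?nnegrE ?expR_ge0 ?(ltW h2)// ltW.
  rewrite /powR !gt_eqF ?expR_gt0// !expRK -expRD ler_expR; lra.
have [A0|A0] := eqVneq (fine (mu A)) 0.
  by rewrite A0 powR0 ?mul0r ?fine_ge0// gt_eqF.
have [B0|B0] := eqVneq (fine (mu B)) 0.
  by rewrite B0 powR0 ?mulr0 ?fine_ge0// gt_eqF// subr_gt0.
have fA : (mu A) \is a fin_num by apply: fin_num_measure.
have fB : (mu B) \is a fin_num by apply: fin_num_measure.
have fC : (mu C) \is a fin_num by apply: fin_num_measure.
have pA : 0 < fine (mu A) by rewrite lt_neqAle eq_sym A0 fine_ge0.
have pB : 0 < fine (mu B) by rewrite lt_neqAle eq_sym B0 fine_ge0.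
(* let al, be increase to the two measures: scale both by s -> 1 *)
rewrite leNgt; apply/negP => hlt.
set a' := fine (mu A) in pA A0 hlt *; set b' := fine (mu B) in pB B0 hlt *.
set c' := fine (mu C) in hlt *.
set p := a' `^ t * b' `^ (1 - t) in hlt *.
have p0 : 0 < p by rewrite mulr_gt0 ?powR_gt0.
have c0 : 0 <= c' by rewrite fine_ge0.
have [s [s0 s1 hs]] : exists s, [/\ 0 < s, s < 1 & c' < s * p].
  move: p c' p0 c0 hlt => p c p0 c0 cp; exists ((c + p) / (2 * p)).
  have p2 : 0 < 2 * p by rewrite mulr_gt0.
  split; rewrite ?divr_gt0// ?ltr_pdivrMr//; [lra|lra|].
  by rewrite mulrAC ltr_pdivlMr//; nra.
have := key (s * a') (s * b').
rewrite !mulr_gt0// -(fineK fA) -(fineK fB) -(fineK fC) !lte_fin -/a' -/b' -/c'.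
rewrite !gtr_pMl// s1 => /(_ isT isT isT isT).
rewrite lee_fin !powRM ?(ltW s0) ?(ltW pA) ?(ltW pB)// mulrACA -powRD; last by rewrite (gt_eqF s0) implybT.
by rewrite subrKC powRr1 ?(ltW s0)// -/p leNgt hs.
Qed.

(** * Bisection of convex sets *)

Section BoundedIntegrals.
Context d (T : measurableType d) (R : realType) (mu : {measure set T -> \bar R}).
Implicit Types (D E : set T) (f g : T -> R).

(** Boundedness on a set of finite mass is a form of integrability that survives products and
    restriction to measurable subsets, as repeated bisection requires. *)
Definition bdint D f := [/\ measurable D, (mu D < +oo)%E, measurable_fun setT f &
  exists B : R, forall x, D x -> `|f x| <= B].

Lemma bdint_integrable D f : bdint D f -> mu.-integrable D (EFin \o f).
Proof.
move=> [mD Dfin mf [B hB]]; apply: measurable_bounded_integrable => //.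
  exact: measurable_funS mf.
by exists B; split; [exact: num_real|move=> x Bx y Dy /=; apply: le_trans (hB y Dy) (ltW Bx)].
Qed.

Lemma bdint_sub D E f : measurable E -> E `<=` D -> bdint D f -> bdint E f.
Proof.
move=> mE ED [mD Dfin mf [B hB]]; split=> //; last by exists B => x /ED/hB.
by apply: le_lt_trans Dfin; apply: le_measure; rewrite ?inE.
Qed.

Lemma bdintD D f g : bdint D f -> bdint D g -> bdint D (fun x => f x + g x).
Proof.
move=> [mD Dfin mf [B hB]] [_ _ mg [B' hB']]; split=> //.
  exact: measurable_funD.
exists (B + B') => x Dx; apply: le_trans (ler_normD _ _) _.
by apply: lerD; [exact: hB|exact: hB'].
Qed.

Lemma bdint_cst D c : measurable D -> (mu D < +oo)%E -> bdint D (fun=> c).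
Proof. by move=> mD Dfin; split=> //; exists `|c|. Qed.

Lemma bdintM D f g : bdint D f -> bdint D g -> bdint D (fun x => f x * g x).
Proof.
move=> [mD Dfin mf [B hB]] [_ _ mg [B' hB']]; split=> //.
  exact: measurable_funM.
exists (B * B') => x Dx; rewrite normrM; apply: ler_pM => //.
  exact: hB.
exact: hB'.
Qed.

Lemma bdintZ D c f : bdint D f -> bdint D (fun x => c * f x).
Proof.
by move=> bf; have [mD Dfin _ _] := bf; apply: bdintM => //; exact: bdint_cst.
Qed.

Lemma bdintB D f g : bdint D f -> bdint D g -> bdint D (fun x => f x - g x).
Proof.
move=> bf bg; have := bdintD bf (bdintZ (-1) bg).
by congr (bdint _ _); apply/funext => x; rewrite mulN1r.
Qed.

Lemma RintB D f g : bdint D f -> bdint D g ->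
  \int[mu]_(x in D) (f x - g x) = \int[mu]_(x in D) f x - \int[mu]_(x in D) g x.
Proof. by move=> bf bg; rewrite RintegralB//; [case: bf|exact: bdint_integrable|exact: bdint_integrable]. Qed.

Lemma RintD D f g : bdint D f -> bdint D g ->
  \int[mu]_(x in D) (f x + g x) = \int[mu]_(x in D) f x + \int[mu]_(x in D) g x.
Proof. by move=> bf bg; rewrite RintegralD//; [case: bf|exact: bdint_integrable|exact: bdint_integrable]. Qed.

Lemma RintZ D c f : bdint D f ->
  \int[mu]_(x in D) (c * f x) = c * \int[mu]_(x in D) f x.
Proof. by move=> bf; rewrite RintegralZl//; [case: bf|exact: bdint_integrable]. Qed.

Lemma le_Rint D f g : bdint D f -> bdint D g -> (forall x, D x -> f x <= g x) ->
  \int[mu]_(x in D) f x <= \int[mu]_(x in D) g x.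
Proof. by move=> bf bg fg; apply: le_Rintegral => //; [case: bf|exact: bdint_integrable|exact: bdint_integrable]. Qed.

Lemma Rint_split D E f : measurable E -> bdint D f ->
  \int[mu]_(x in D) f x = \int[mu]_(x in D `&` E) f x + \int[mu]_(x in D `\` E) f x.
Proof.
move=> mE bf; have mD : measurable D by case: bf.
rewrite -Rintegral_setU//.
- by rewrite setUC setDUK_subproof // || rewrite setUIDK.
- exact: measurableI.
- exact: measurableD.
- by rewrite setUIDK; exact: bdint_integrable.
- by apply/disj_setPRL => x [_ nEx] [_].
Qed.

Lemma le_norm_Rint D f B : bdint D f -> (forall x, D x -> `|f x| <= B) ->
  `|\int[mu]_(x in D) f x| <= B * fine (mu D).
Proof.
move=> bf hB; have [mD Dfin mf _] := bf.
rewrite -Rintegral_cst// ler_norml; apply/andP; split; last first.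
  by apply: le_Rint => //; [exact: bdint_cst|move=> x /hB; apply: le_trans; exact: ler_norm].
rewrite lerNl -mulN1r -RintZ//; apply: le_Rint => //.
- exact: bdintZ.
- exact: bdint_cst.
- by move=> x /hB h; apply: le_trans h; rewrite mulN1r -normrN ler_norm.
Qed.

Lemma Rint_null D f : bdint D f -> mu D = 0%E -> \int[mu]_(x in D) f x = 0.
Proof.
move=> bf D0; have [_ _ _ [B hB]] := bf.
have := le_norm_Rint bf hB; rewrite D0 mulr0 => h.
by apply/eqP; rewrite -normr_eq0 eq_le h normr_ge0.
Qed.

Lemma Rint_ae_sub D E f : bdint D f -> measurable E -> mu (D `\` E) = 0%E ->
  \int[mu]_(x in D) f x = \int[mu]_(x in D `&` E) f x.
Proof.
move=> bf mE DE; rewrite (Rint_split mE bf) (@Rint_null (D `\` E)) ?addr0//.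
have [mD _ _ _] := bf.
by apply: bdint_sub bf; [exact: measurableD|exact: subDsetl].
Qed.

End BoundedIntegrals.

Section Convex.
Context (R : realType) (n : nat) (mu : probability (n.-tuple R) R).
Local Notation T := (n.-tuple R).

Definition borell := forall (t : R) (A B C : set T), 0 < t < 1 ->
  measurable A -> measurable B -> measurable C ->
  (forall x y, A x -> B y -> C (tconv t x y)) ->
  fine (mu A) `^ t * fine (mu B) `^ (1 - t) <= fine (mu C).

Definition convex_set (D : set T) :=
  forall x y t, 0 < t < 1 -> D x -> D y -> D (tconv t x y).

Definition affine_fun (l : T -> R) := measurable_fun setT l /\
  forall x y t, l (tconv t x y) = t * l x + (1 - t) * l y.

Lemma affine_fun_comb (l1 l2 : T -> R) (a b c : R) : affine_fun l1 -> affine_fun l2 ->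
  affine_fun (fun x => a * l1 x + b * l2 x + c).
Proof.
move=> [m1 h1] [m2 h2]; split; last by move=> x y t; rewrite h1 h2; lra.
apply: measurable_funD => //; apply: measurable_funD; exact: measurable_funM.
Qed.

Lemma affine_fun_tnth i : affine_fun (fun x => tnth x i).
Proof.
by split; [exact: measurable_tnth|move=> x y t; rewrite tnth_mktuple].
Qed.

Lemma measurable_set_ge (l : T -> R) : measurable_fun setT l -> measurable [set x | 0 <= l x].
Proof.
move=> ml; have -> : [set x | 0 <= l x] = l @^-1` `[0, +oo[%classic.
  by apply/seteqP; split=> x /=; rewrite in_itv/= andbT.
by rewrite -[X in measurable X]setTI; apply: ml.
Qed.

Lemma measurable_set_gt (l : T -> R) : measurable_fun setT l -> measurable [set x | 0 < l x].
Proof.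
move=> ml; have -> : [set x | 0 < l x] = l @^-1` `]0, +oo[%classic.
  by apply/seteqP; split=> x /=; rewrite in_itv/= andbT.
by rewrite -[X in measurable X]setTI; apply: ml.
Qed.

Lemma measurable_set_eq (l : T -> R) : measurable_fun setT l -> measurable [set x | l x = 0].
Proof.
move=> ml; have -> : [set x | l x = 0] = l @^-1` [set 0] by [].
by rewrite -[X in measurable X]setTI; apply: ml.
Qed.

Lemma convex_setI_ge (D : set T) l : convex_set D -> affine_fun l ->
  convex_set (D `&` [set x | 0 <= l x]).
Proof.
move=> cD [_ hl] x y t t01 [Dx /= lx] [Dy /= ly]; split; first exact: cD.
by have /andP[t0 t1] := t01; rewrite /= hl addr_ge0// mulr_ge0// ?subr_ge0 ltW.
Qed.

Lemma convex_setI_lt (D : set T) l : convex_set D -> affine_fun l ->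
  convex_set (D `\` [set x | 0 <= l x]).
Proof.
move=> cD [_ hl] x y t t01 [Dx /= /negP]; rewrite -ltNge => lx [Dy /= /negP].
rewrite -ltNge => ly; split; first exact: cD.
have /andP[t0 t1] := t01; rewrite /= hl; apply/negP; rewrite -ltNge.
have h1 : t * l x < 0 by rewrite pmulr_rlt0.
have h2 : (1 - t) * l y < 0 by rewrite pmulr_rlt0// subr_gt0.
lra.
Qed.

Lemma convex_setI_eq (D : set T) l : convex_set D -> affine_fun l ->
  convex_set (D `&` [set x | l x = 0]).
Proof.
move=> cD [_ hl] x y t t01 [Dx /= lx] [Dy /= ly]; split; first exact: cD.
by rewrite /= hl lx ly !mulr0 addr0.
Qed.


Lemma mu_lty A : measurable A -> (mu A < +oo)%E.
Proof. by move=> mA; rewrite -ge0_fin_numE// fin_num_measure. Qed.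

Lemma cvg_mu_small (E : nat -> set T) (e : R) : 0 < e ->
  (forall k, measurable (E k)) -> (forall k, E k.+1 `<=` E k) ->
  mu (\bigcap_k E k) = 0%E -> exists k, fine (mu (E k)) < e.
Proof.
move=> e0 mE niE E0.
have mI : measurable (\bigcap_k E k) by apply: bigcapT_measurable.
have niE' : nonincreasing_seq E.
  by apply/nonincreasing_seqP => k; apply/subsetPset; exact: niE.
have : (mu \o E) k @[k --> \oo] --> 0%E.
  by rewrite -E0; exact: (nonincreasing_cvg_mu (mu_lty (mE 0%N)) mE mI niE').
move=> /fine_cvgP[_ /cvgrPdist_lt/(_ e e0)[N _ /(_ N (leqnn N))]] /=.
by rewrite sub0r normrN ger0_norm ?fine_ge0// => h; exists N.
Qed.

(* If both halves had positive mass, interpolating between them would give all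
   the slabs [0 < l <= K / k] a mass bounded below. *)
Lemma line_dichotomy (D : set T) (l : T -> R) (K : R) : borell ->
  measurable D -> convex_set D -> affine_fun l -> (forall x, D x -> `|l x| <= K) ->
  mu (D `&` [set x | l x = 0]) != 0%E -> mu (D `&` [set x | 0 < l x]) = 0%E.
Proof.
move=> bor mD cD [ml hl] lK A0; apply/eqP/negPn/negP => B0.
set A := D `&` _ in A0; set B := D `&` _ in B0.
have mA : measurable A by apply: measurableI => //; exact: measurable_set_eq.
have mB : measurable B by apply: measurableI => //; exact: measurable_set_gt.
have pA : 0 < fine (mu A).
  by rewrite fine_gt0// (mu_lty mA) andbT lt_neqAle eq_sym A0 measure_ge0.
have pB : 0 < fine (mu B).
  by rewrite fine_gt0// (mu_lty mB) andbT lt_neqAle eq_sym B0 measure_ge0.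
pose e := Num.min (fine (mu A)) (fine (mu B)).
have e0 : 0 < e by rewrite lt_min pA pB.
pose E (k : nat) := D `&` ([set x | 0 < l x] `&` [set x | 0 <= K / k.+2%:R - l x]).
have mE k : measurable (E k).
  apply: measurableI => //; apply: measurableI; first exact: measurable_set_gt.
  by apply: (@measurable_set_ge (fun x => K / k.+2%:R - l x)); exact: measurable_funB.
have K0 x : D x -> 0 <= K by move=> /lK; apply: le_trans.
have [k] : exists k, fine (mu (E k)) < e.
  apply: cvg_mu_small => //.
    move=> k x [Dx [/= l0 lk]]; split=> //; split=> //=.
    apply: le_trans lk _; rewrite lerD2r ler_wpM2l ?(K0 x)//.
    by rewrite lef_pV2 ?posrE ?ltr0n// ler_nat.
  rewrite (_ : \bigcap_k _ = set0) ?measure0//.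
  apply/seteqP; split=> // x hx.
  have [Dx [/= l0 _]] := hx 0%N I.
  have : l x <= 0.
    apply: (@ler_divn_all _ _ _ K) => N N0; rewrite add0r.
    have [_ [_ /=]] := hx N I; rewrite subr_ge0 => /le_trans; apply.
    by rewrite ler_wpM2l ?(K0 x)// lef_pV2 ?posrE ?ltr0n// ler_nat; lia.
  by rewrite leNgt l0.
rewrite ltNge => /negP; apply.
pose t : R := k.+2%:R^-1.
have t0 : 0 < t by rewrite invr_gt0.
have t1 : t < 1 by rewrite invf_lt1// ltr1n.
have t01 : 0 < t < 1 by rewrite t0.
apply: le_trans (bor t B A (E k) t01 mB mA (mE k) _).
  have -> : e = e `^ t * e `^ (1 - t).
    by rewrite -powRD ?subrKC ?powRr1 ?(ltW e0)// (gt_eqF e0) implybT.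
  have t1' : 0 <= 1 - t by rewrite subr_ge0 ltW.
  apply: ler_pM; rewrite ?powR_ge0//.
    by apply: (ge0_ler_powR (ltW t0)); rewrite ?nnegrE ?(ltW e0) ?(ltW pB)// ge_min lexx orbT.
  by apply: (ge0_ler_powR t1'); rewrite ?nnegrE ?(ltW e0) ?(ltW pA)// ge_min lexx.
move=> x y [Dx /= lx] [Dy /= ly]; split; first exact: cD.
rewrite /= hl ly mulr0 addr0; split; first by rewrite mulr_gt0.
rewrite /= subr_ge0 mulrC ler_wpM2r ?(ltW t0)//.
by apply: le_trans (lK x Dx); exact: ler_norm.
Qed.

(** The dichotomy applies to [l] and to [- l], so both open sides of the line are null. *)
Lemma line_full (D : set T) (l : T -> R) (K : R) : borell ->
  measurable D -> convex_set D -> affine_fun l -> (forall x, D x -> `|l x| <= K) ->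
  mu (D `&` [set x | l x = 0]) != 0%E -> mu (D `\` [set x | l x = 0]) = 0%E.
Proof.
move=> bor mD cD al lK A0.
have lE : (fun x => -1 * l x + 0 * l x + 0) = (fun x => - l x).
  by apply/funext => x; lra.
have al' : affine_fun (fun x => - l x) by rewrite -lE; exact: affine_fun_comb.
have B1 := line_dichotomy bor mD cD al lK A0.
have B2 : mu (D `&` [set x | 0 < - l x]) = 0%E.
  apply: (@line_dichotomy D (fun x => - l x) K bor mD cD al').
    by move=> x /lK; rewrite normrN.
  apply: contra A0 => /eqP <-; apply/eqP; congr (mu (_ `&` _)).
  by apply/seteqP; split=> x /=; [move=> ->; rewrite oppr0|move=> /eqP; rewrite oppr_eq0 => /eqP].
have [ml _] := al.
have m1 : measurable (D `&` [set x | 0 < l x]).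
  by apply: measurableI => //; exact: measurable_set_gt.
have m2 : measurable (D `&` [set x | 0 < - l x]).
  by apply: measurableI => //; apply: (@measurable_set_gt (fun x => - l x)); exact: measurable_funN.
apply/eqP; rewrite eq_le measure_ge0 andbT.
have -> : D `\` [set x | l x = 0] = (D `&` [set x | 0 < l x]) `|` (D `&` [set x | 0 < - l x]).
  apply/seteqP; split => [x [Dx /= /eqP]|x].
    by rewrite neq_lt => /orP[h|h]; [right|left]; split=> //=; rewrite oppr_gt0.
  by move=> [[Dx /= h]|[Dx /= h]]; split=> //=; lra.
rewrite (_ : 0 = mu (D `&` [set x | (0 < l x)%R]) + mu (D `&` [set x | (0 < - l x)%R]))%E.
  exact: measureU2.
by rewrite B1 B2 adde0.
Qed.

End Convex.

Section Bisect.
Context (R : realType) (n : nat) (mu : probability (n.-tuple R) R).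
Local Notation T := (n.-tuple R).

Lemma affine_fun_comb2 (l1 l2 : T -> R) (a b : R) : affine_fun l1 -> affine_fun l2 ->
  affine_fun (fun x => a * l1 x + b * l2 x).
Proof.
move=> h1 h2; have := affine_fun_comb a b 0 h1 h2.
by congr (affine_fun _); apply/funext => x; rewrite addr0.
Qed.

(** The directions (s, 1 - |s|) turn from (-1, 0) through (0, 1) to (1, 0). Since the line at
    parameter s is null, thin neighbourhoods of it have small mass, and for s' close to s the two
    half-spaces differ only inside such a neighbourhood. *)
Lemma half_space_continuous (D : set T) (l1 l2 psi : T -> R) (K : R) :
  measurable_fun setT l1 -> measurable_fun setT l2 ->
  (forall x, D x -> `|l1 x| <= K /\ `|l2 x| <= K) -> bdint mu D psi ->
  (forall a b, (a != 0) || (b != 0) -> mu (D `&` [set x | a * l1 x + b * l2 x = 0]) = 0%E) ->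
  continuous (fun s : R => \int[mu]_(x in D `&` [set x | 0 <= s * l1 x + (1 - `|s|) * l2 x]) psi x).
Proof.
move=> m1 m2 lK bpsi null.
have [mD _ mpsi [B hB]] := bpsi.
have mL a b : measurable_fun setT (fun x => a * l1 x + b * l2 x).
  by apply: measurable_funD; exact: measurable_funM.
pose E s := D `&` [set x | 0 <= s * l1 x + (1 - `|s|) * l2 x].
have mE s : measurable (E s) by apply: measurableI => //; apply: (measurable_set_ge (mL _ _)).
move=> s; apply/cvgrPdist_le => e e0.
pose B' := `|B| + 1.
have B'0 : 0 < B' by rewrite ltr_wpDl.
have hB' x : D x -> `|psi x| <= B'.
  by move=> /hB/le_trans; apply; rewrite (le_trans (ler_norm _))// lerDl.
pose F k := D `&` [set x | 0 <= k.+1%:R^-1 - `|s * l1 x + (1 - `|s|) * l2 x|].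
have mF k : measurable (F k).
  apply: measurableI => //.
  apply: (@measurable_set_ge _ _ (fun x => k.+1%:R^-1 - `|s * l1 x + (1 - `|s|) * l2 x|)).
  by apply: measurable_funB => //; apply: measurableT_comp => //.
have [k hk] : exists k, fine (mu (F k)) < e / (2 * B').
  apply: cvg_mu_small => //.
  - by rewrite divr_gt0// mulr_gt0.
  - move=> k x [Dx /= h]; split=> //=; apply: le_trans h _.
    by rewrite lerD2r lef_pV2 ?posrE ?ltr0n// ler_nat.
  - rewrite -[RHS](null s (1 - `|s|)); last first.
      by have [->|] := eqVneq s 0; rewrite ?normr0 ?subr0 ?oner_eq0 ?orbT.
    congr (mu _); apply/seteqP; split=> x hx.
      split; first by case: (hx 0%N I).
      apply/eqP; rewrite -normr_eq0 eq_le normr_ge0 andbT.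
      apply: (@ler_divn_all _ _ _ 1) => N N0; rewrite add0r div1r.
      have [_ /=] := hx N.-1 I; rewrite prednK//; lra.
    case: hx => Dx /= h m _; split=> //=; rewrite h normr0 subr0 invr_ge0//.
pose K' := `|K| + 1.
have K'0 : 0 < K' by rewrite ltr_wpDl.
have hK' x : D x -> `|l1 x| <= K' /\ `|l2 x| <= K'.
  move=> /lK[h1 h2]; have : K <= K' by rewrite (le_trans (ler_norm _))// lerDl.
  by move=> h; split; lra.
(* A change of s by [dl] moves the linear form by at most 2 K' dl, which is the width of the strip
   [F k]. *)
pose dl := k.+1%:R^-1 / (2 * K').
have dl0 : 0 < dl by rewrite divr_gt0 ?mulr_gt0// invr_gt0.
have sub s1 s2 : (s1 = s \/ s2 = s) -> `|s1 - s2| <= dl -> E s1 `\` E s2 `<=` F k.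
  move=> hs s12 x [[Dx /= h1] h2]; split=> //=.
  have {}h2 : s2 * l1 x + (1 - `|s2|) * l2 x < 0.
    by rewrite ltNge; apply/negP => h; apply: h2; split.
  have : `|(s1 * l1 x + (1 - `|s1|) * l2 x) - (s2 * l1 x + (1 - `|s2|) * l2 x)| <= k.+1%:R^-1.
    have -> : (s1 * l1 x + (1 - `|s1|) * l2 x) - (s2 * l1 x + (1 - `|s2|) * l2 x) =
       (s1 - s2) * l1 x - (`|s1| - `|s2|) * l2 x by ring.
    apply: le_trans (ler_normB _ _) _; rewrite !normrM.
    have [k1 k2] := hK' _ Dx.
    have h3 : `| `|s1| - `|s2| | <= dl by apply: le_trans s12; exact: ler_dist_dist.
    have h4 : `|s1 - s2| * `|l1 x| <= dl * K' by apply: ler_pM.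
    have h5 : `| `|s1| - `|s2| | * `|l2 x| <= dl * K' by apply: ler_pM.
    have -> : k.+1%:R^-1 = dl * K' + dl * K'.
      by rewrite /dl -mulrDl -mulrDl -mulrA; field; rewrite (gt_eqF K'0) /= nat1r pnatr_eq0.
    lra.
  rewrite ler_norml => /andP[h3 h4]; rewrite subr_ge0 ler_norml.
  have k0 : 0 < k.+1%:R^-1 :> R by rewrite invr_gt0.
  move: (k.+1%:R^-1) k0 h3 h4 => q q0.
  case: hs => <-; move: (s1 * l1 x + _) (s2 * l1 x + _) h1 h2 => u v u0 v0 h3 h4;
    by apply/andP; split; lra.
have small s1 s2 : (s1 = s \/ s2 = s) -> `|s1 - s2| <= dl ->
    `|\int[mu]_(x in E s1 `\` E s2) psi x| <= e / 2.
  move=> hs s12; have hsub := sub _ _ hs s12.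
  have mS : measurable (E s1 `\` E s2) by exact: measurableD.
  have sD : E s1 `\` E s2 `<=` D by move=> x [[]].
  apply: le_trans (le_norm_Rint (bdint_sub mS sD bpsi) (fun x Ex => hB' x (sD x Ex))) _.
  have : fine (mu (E s1 `\` E s2)) <= fine (mu (F k)).
    apply: fine_le; rewrite ?fin_num_measure//.
    by apply: le_measure; rewrite ?inE.
  move=> h; apply: le_trans (_ : B' * (e / (2 * B')) <= _).
    by rewrite ler_wpM2l ?(ltW B'0)// (le_trans h)// ltW.
  by rewrite le_eqVlt; apply/orP; left; apply/eqP; field; rewrite gt_eqF.
near=> s'.
have ss : `|s - s'| <= dl by near: s'; apply: cvgr_dist_le => //; exact: cvg_id.
have bE s1 : bdint mu (E s1) psi by apply: (bdint_sub (mE s1) _ bpsi) => x [].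
rewrite -/(E s) -/(E s') (Rint_split (mE s') (bE s)) (Rint_split (mE s) (bE s')).
rewrite (setIC (E s')).
have := small s s' (or_introl erefl) ss.
have := small s' s (or_intror erefl); rewrite distrC => /(_ ss).
rewrite !ler_norml => /andP[a1 a2] /andP[a3 a4].
by apply/andP; split; lra.
Unshelve. all: by end_near.
Qed.

(** At s = 1 and s = -1 the half-spaces are complementary up to a null set, so the two integrals are
    opposite and the intermediate value theorem gives a zero between them. *)
Lemma bisect (D : set T) (l1 l2 psi : T -> R) (K : R) :
  measurable_fun setT l1 -> measurable_fun setT l2 ->
  (forall x, D x -> `|l1 x| <= K /\ `|l2 x| <= K) -> bdint mu D psi ->
  (forall a b, (a != 0) || (b != 0) -> mu (D `&` [set x | a * l1 x + b * l2 x = 0]) = 0%E) ->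
  \int[mu]_(x in D) psi x = 0 ->
  exists a b, (a != 0) || (b != 0) /\
    \int[mu]_(x in D `&` [set x | 0 <= a * l1 x + b * l2 x]) psi x = 0.
Proof.
move=> m1 m2 lK bpsi null int0.
have cG := half_space_continuous m1 m2 lK bpsi null.
set G := fun s : R => _ in cG.
have [mD _ _ _] := bpsi.
have G1 : G (-1) = - G 1.
  have mA : measurable [set x | 0 <= l1 x] by exact: measurable_set_ge.
  have mA' : measurable [set x | 0 <= - l1 x].
    by apply: (@measurable_set_ge _ _ (fun x => - l1 x)); exact: measurable_funN.
  have -> : G 1 = \int[mu]_(x in D `&` [set x | 0 <= l1 x]) psi x.
    congr Rintegral; congr (_ `&` _); apply/funext => x /=.
    by rewrite normr1 subrr mul0r addr0 mul1r.
  have -> : G (-1) = \int[mu]_(x in D `&` [set x | 0 <= - l1 x]) psi x.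
    congr Rintegral; congr (_ `&` _); apply/funext => x /=.
    by rewrite normrN1 subrr mul0r addr0 mulN1r.
  have bI : bdint mu (D `&` [set x | 0 <= - l1 x]) psi.
    by apply: bdint_sub bpsi => [|x []//]; exact: measurableI.
  rewrite (@Rint_ae_sub _ _ _ _ _ (~` [set x | 0 <= l1 x]) _ bI (measurableC mA)); last first.
    rewrite -[RHS](null 1 0) ?oner_eq0//; congr (mu _); apply/seteqP; split=> x /=.
      by move=> [[Dx h1] /contrapT h2]; split=> //=; lra.
    by move=> [Dx /= h]; split; [split=> //=; lra|apply; lra].
  have -> : D `&` [set x | 0 <= - l1 x] `&` ~` [set x | 0 <= l1 x] = D `\` [set x | 0 <= l1 x].
    apply/seteqP; split=> x /=; first by move=> [[Dx _] h].
    move=> [Dx h]; split=> //; split=> //=.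
    by move: h => /negP; rewrite -ltNge; lra.
  by move: int0; rewrite (Rint_split mA bpsi); lra.
have [|||s _ Gs] := @IVT R G (-1) 1 0 _ _ _.
- lra.
- by apply: continuous_subspaceT => x; exact: cG.
- rewrite G1 ge_min le_max oppr_le0 oppr_ge0.
  by have [h|/ltW h] := leP 0 (G 1); rewrite ?h ?orbT.
exists s, (1 - `|s|); split=> //.
by have [->|] := eqVneq s 0; rewrite ?normr0 ?subr0 ?oner_eq0 ?orbT.
Qed.

(** The point [p] is not interior to the projection of D to the coordinates i and j: a line through
    [p] has the projection on one side. *)
Definition cut_at (D : set T) i j (p : R * R) := exists a b, (a != 0) || (b != 0) /\
  forall x, D x -> 0 <= a * (tnth x i - p.1) + b * (tnth x j - p.2).

Definition in_box (D : set T) (L : R) := forall x, D x -> forall i, `|tnth x i| <= L.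

(** Induction on the points: D is bisected along a line through the first one, both halves remain
    balanced and convex and lie on one side of that line, and the integrals of [phi] add up. *)
Lemma cut_pieces (i j : 'I_n) (L : R) (psi phi : T -> R) (ps : seq (R * R)) (D : set T) :
  borell mu -> measurable D -> convex_set D -> in_box D L -> bdint mu D psi -> bdint mu D phi ->
  (forall D', D' `<=` D -> measurable D' -> convex_set D' ->
    \int[mu]_(x in D') psi x = 0 -> (forall p, p \in ps -> cut_at D' i j p) ->
    \int[mu]_(x in D') phi x <= 0) ->
  \int[mu]_(x in D) psi x = 0 -> \int[mu]_(x in D) phi x <= 0.
Proof.
move=> bor; elim: ps D => [|p ps IH] D mD cD DL bpsi bphi H int0.
  by apply: H.
pose l1 := fun x : T => tnth x i - p.1; pose l2 := fun x : T => tnth x j - p.2.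
have cst0 : affine_fun (fun x : T => 0 * tnth x i).
  by have := affine_fun_comb2 0 0 (affine_fun_tnth R i) (affine_fun_tnth R i); congr (affine_fun _); apply/funext => x; rewrite mul0r addr0.
have al1 : affine_fun l1.
  have := affine_fun_comb 1 0 (- p.1) (affine_fun_tnth R i) (affine_fun_tnth R i).
  by congr (affine_fun _); apply/funext => x; rewrite /l1; lra.
have al2 : affine_fun l2.
  have := affine_fun_comb 1 0 (- p.2) (affine_fun_tnth R j) (affine_fun_tnth R j).
  by congr (affine_fun _); apply/funext => x; rewrite /l2; lra.
pose K := Num.max `|L| 0 + Num.max `|p.1| `|p.2|.
have lK x : D x -> `|l1 x| <= K /\ `|l2 x| <= K.
  move=> Dx; have h1 := DL x Dx i; have h2 := DL x Dx j.
  have h3 : `|L| <= Num.max `|L| 0 by rewrite le_max lexx.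
  have h4 := ler_norm L.
  have h5 : `|p.1| <= Num.max `|p.1| `|p.2| by rewrite le_max lexx.
  have h6 : `|p.2| <= Num.max `|p.1| `|p.2| by rewrite le_max lexx orbT.
  by split; apply: le_trans (ler_normB _ _) _; rewrite /K; apply: lerD => //; lra.
have [null|] := pselect (forall a b, (a != 0) || (b != 0) ->
    mu (D `&` [set x | a * l1 x + b * l2 x = 0]) = 0%E).
  have [a [b [ab0 hab]]] := bisect al1.1 al2.1 lK bpsi null int0.
  have al : affine_fun (fun x => a * l1 x + b * l2 x) by exact: affine_fun_comb2.
  have mE : measurable [set x | 0 <= a * l1 x + b * l2 x] by exact: measurable_set_ge al.1.
  rewrite (Rint_split mE bphi).
  have m1 : measurable (D `&` [set x | 0 <= a * l1 x + b * l2 x]) by exact: measurableI.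
  have m2 : measurable (D `\` [set x | 0 <= a * l1 x + b * l2 x]) by exact: measurableD.
  have s1 : D `&` [set x | 0 <= a * l1 x + b * l2 x] `<=` D by move=> x [].
  have s2 : D `\` [set x | 0 <= a * l1 x + b * l2 x] `<=` D by move=> x [].
  have b1 := bdint_sub m1 s1 bpsi. have b2 := bdint_sub m2 s2 bpsi.
  have c1 := bdint_sub m1 s1 bphi. have c2 := bdint_sub m2 s2 bphi.
  have h1 : \int[mu]_(x in D `&` [set x | 0 <= a * l1 x + b * l2 x]) phi x <= 0.
    apply: (IH _ m1 (convex_setI_ge cD al) _ b1 c1) => //.
      by move=> x /s1; exact: DL.
    move=> D' D'D mD' cD' i0 cut; apply: H => //; first exact: subset_trans s1.
    move=> q; rewrite in_cons => /orP[/eqP ->|]; last exact: cut.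
    by exists a, b; split=> // x /D'D[].
  have h2 : \int[mu]_(x in D `\` [set x | 0 <= a * l1 x + b * l2 x]) phi x <= 0.
    apply: (IH _ m2 (convex_setI_lt cD al) _ b2 c2) => //.
    - by move=> x /s2; exact: DL.
    - move=> D' D'D mD' cD' i0 cut; apply: H => //; first exact: subset_trans s2.
      move=> q; rewrite in_cons => /orP[/eqP ->|]; last exact: cut.
      exists (- a), (- b); split; first by rewrite !oppr_eq0.
      move=> x /D'D[_ /= /negP]; rewrite -ltNge /l1 /l2 => h; lra.
    - by move: int0; rewrite (Rint_split mE bpsi) hab add0r.
  lra.
(* A line of positive mass carries almost all of D, and a subset of a line is already cut at every
   point. *)
move=> /existsNP[a /existsNP[b /not_implyP[ab0 /eqP pos]]].
have al : affine_fun (fun x => a * l1 x + b * l2 x) by exact: affine_fun_comb2.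
have mE : measurable [set x | a * l1 x + b * l2 x = 0] by exact: measurable_set_eq al.1.
have full : mu (D `\` [set x | a * l1 x + b * l2 x = 0]) = 0%E.
  apply: (@line_full _ _ _ D _ ((`|a| + `|b|) * K) bor mD cD al) => // x Dx.
  have [k1 k2] := lK x Dx.
  apply: le_trans (ler_normD _ _) _; rewrite !normrM mulrDl.
  by apply: lerD; apply: ler_wpM2l.
rewrite (Rint_ae_sub bphi mE full); apply: H.
- by move=> x [].
- exact: measurableI.
- exact: convex_setI_eq.
- by rewrite -(Rint_ae_sub bpsi mE full).
move=> q _.
have [h|h] := leP 0 (a * (p.1 - q.1) + b * (p.2 - q.2)).
  by exists a, b; split=> // x [_ /=]; rewrite /l1 /l2 => hx; lra.
exists (- a), (- b); split; first by rewrite !oppr_eq0.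
by move=> x [_ /=]; rewrite /l1 /l2 => hx; lra.
Qed.

End Bisect.

(** * Planar convex sets that are cut at all points of a fine grid *)

Section Flat.
Context (R : realType) (K : R -> R -> Prop) (L e : R).

Definition planar_convex (K : R -> R -> Prop) := forall x y x' y' t, 0 < t < 1 ->
  K x y -> K x' y' -> K (t * x + (1 - t) * x') (t * y + (1 - t) * y').

Definition planar_cut (K : R -> R -> Prop) (p q : R) := exists a b, (a != 0) || (b != 0) /\
  forall x y, K x y -> 0 <= a * (x - p) + b * (y - q).

End Flat.

(** A longer vertical section would have a grid point strictly inside. The cutting line through it
    cannot separate the two ends, so it is vertical; but K has points on both sides of that vertical
    line. *)
Lemma planar_section (R : realType) (K : R -> R -> Prop) (L e x0 y0 x1 y1 y y' : R) (a : int) :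
  0 < e -> (forall x y, K x y -> `|x| <= L /\ `|y| <= L) ->
  (forall a b : int, `|e * a%:~R| <= L -> `|e * b%:~R| <= L -> planar_cut K (e * a%:~R) (e * b%:~R)) ->
  K x0 y0 -> K x1 y1 -> x0 < e * a%:~R < x1 ->
  K (e * a%:~R) y -> K (e * a%:~R) y' -> y' - y <= e.
Proof.
move=> e0 KL cut K0 K1 /andP[h0 h1] Ky Ky'; rewrite leNgt; apply/negP => yy.
pose b := (Num.floor (y / e) + 1)%R.
have b1 : y < e * b%:~R.
  by rewrite mulrC -ltr_pdivrMr// /b; have /andP[_ ] := Num.Theory.floor_itv (y / e).
have b2 : e * b%:~R <= y + e.
  rewrite /b intrD mulrDr mulr1 lerD2r mulrC -ler_pdivlMr//.
  by have /andP[] := Num.Theory.floor_itv (y / e).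
have [ya yb] := KL _ _ Ky; have [_ yb'] := KL _ _ Ky'.
have hb : `|e * b%:~R| <= L.
  by move: yb yb'; rewrite !ler_norml => /andP[? ?] /andP[? ?]; apply/andP; split; lra.
have [u [v [uv H]]] := cut a b ya hb.
have := H _ _ Ky; have := H _ _ Ky'; rewrite subrr mulr0 !add0r => H1 H2.
have v0 : v = 0 by nra.
have := H _ _ K0; have := H _ _ K1; rewrite v0 !mul0r !addr0 => H3 H4.
have u0 : u = 0 by nra.
by move: uv; rewrite u0 v0 eqxx.
Qed.

(** The determinant is x1 - x0 times the vertical distance to the chord. Take the grid column [c]
    just to the right of x and x0. The segments from (x, y) and from (x0, y0) to (x1, y1) cross it
    at heights that differ by at most e, and going back from [c] to x magnifies the gap by 1 / s.
    The width 5 e keeps [c] to the left of x1 and makes this factor at most 4. *)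
Lemma planar_half (R : realType) (K : R -> R -> Prop) (L e x0 y0 x1 y1 x y : R) :
  0 < e -> planar_convex K -> (forall x y, K x y -> `|x| <= L /\ `|y| <= L) ->
  (forall a b : int, `|e * a%:~R| <= L -> `|e * b%:~R| <= L -> planar_cut K (e * a%:~R) (e * b%:~R)) ->
  K x0 y0 -> K x1 y1 -> 5 * e < x1 - x0 -> K x y -> x0 - e <= x -> x <= (x0 + x1) / 2 ->
  `|(y - y0) * (x1 - x0) - (y1 - y0) * (x - x0)| <= 4 * e * (x1 - x0).
Proof.
move=> e0 cK KL cut K0 K1 W Kxy xe xm.
pose m := Num.max x x0.
have m1 : x <= m by rewrite le_max lexx.
have m2 : x0 <= m by rewrite le_max lexx orbT.
have m3 : m = x \/ m = x0 by rewrite /m; case: leP => _; [right|left].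
pose a := (Num.floor (m / e) + 1)%R.
have a1 : m < e * a%:~R.
  by rewrite mulrC -ltr_pdivrMr// /a; have /andP[_ ] := Num.Theory.floor_itv (m / e).
have a2 : e * a%:~R <= m + e.
  rewrite /a intrD mulrDr mulr1 lerD2r mulrC -ler_pdivlMr//.
  by have /andP[] := Num.Theory.floor_itv (m / e).
set c := e * a%:~R in a1 a2.
have cx1 : c < x1 by case: m3 => h; rewrite h in a1 a2 m2; lra.
have d0 : 0 < x1 - x by lra.
have w0 : 0 < x1 - x0 by lra.
pose s := (x1 - c) / (x1 - x).
have s0 : 0 < s by rewrite divr_gt0// subr_gt0.
have s1 : s < 1 by rewrite ltr_pdivrMr// mul1r; lra.
have s4 : 1 <= 4 * s.
  rewrite /s mulrA ler_pdivlMr// mul1r; case: m3 => h; rewrite h in a1 a2 m2; lra.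
have cs : c = s * x + (1 - s) * x1 by rewrite /s; field; rewrite gt_eqF.
pose r := (x1 - c) / (x1 - x0).
have r0 : 0 < r by rewrite divr_gt0// subr_gt0.
have r1 : r < 1 by rewrite ltr_pdivrMr// mul1r; lra.
have cr : c = r * x0 + (1 - r) * x1 by rewrite /r; field; rewrite gt_eqF.
have P1 : K c (s * y + (1 - s) * y1) by rewrite cs; apply: cK; rewrite ?s0.
have P2 : K c (r * y0 + (1 - r) * y1) by rewrite cr; apply: cK; rewrite ?r0.
have c01 : x0 < c < x1 by rewrite cx1 andbT; lra.
have d1 := planar_section e0 KL cut K0 K1 c01 P1 P2.
have d2 := planar_section e0 KL cut K0 K1 c01 P2 P1.
have E : (s * y + (1 - s) * y1 - (r * y0 + (1 - r) * y1)) * (x1 - x0) =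
    s * ((y - y0) * (x1 - x0) - (y1 - y0) * (x - x0)).
  rewrite /s /r; field; rewrite (gt_eqF w0)/= (gt_eqF d0)//.
set De := (y - y0) * _ - _ in E *.
have E1 : s * `|De| <= e * (x1 - x0).
  rewrite -(ger0_norm (ltW s0)) -normrM -E normrM (ger0_norm (ltW w0)).
  by rewrite ler_wpM2r ?(ltW w0)// ler_norml; apply/andP; split; lra.
have : 1 * `|De| <= 4 * s * `|De| by apply: ler_wpM2r.
lra.
Qed.

(** Points x0, x1 within e of the extreme abscissas are joined by a chord. A set of width at most 5
    e + e is a vertical strip; otherwise the left half is close to the chord by [planar_half], and
    the right half by the same lemma after the reflection u -> - u. *)
Lemma planar_flat (R : realType) (K : R -> R -> Prop) (L e : R) :
  0 < e -> planar_convex K -> (forall x y, K x y -> `|x| <= L /\ `|y| <= L) ->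
  (forall a b : int, `|e * a%:~R| <= L -> `|e * b%:~R| <= L -> planar_cut K (e * a%:~R) (e * b%:~R)) ->
  (exists c, forall x y, K x y -> `|x - c| <= 6 * e) \/
  (exists al be, forall x y, K x y -> `|y - (al * x + be)| <= 6 * e).
Proof.
move=> e0 cK KL cut.
pose X := [set x | exists y, K x y].
have [[z Xz]|] := pselect (X !=set0); last first.
  move=> /nonemptyPn X0; left; exists 0 => x y Kxy; have : X x by exists y.
  by rewrite X0.
have hs : has_sup X by split; [exists z|exists L => x [y /KL[h _]]; apply: le_trans h; exact: ler_norm].
have hi : has_inf X.
  by split; [exists z|exists (- L) => x [y /KL[+ _]]; rewrite ler_norml => /andP[]].
have [x1 [y1 K1] h1] := sup_adherent e0 hs.
have [x0 [y0 K0] h0] := inf_adherent e0 hi.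
have lo x y : K x y -> x0 - e <= x.
  move=> Kxy; have : inf X <= x by apply: ge_inf; [case: hi|exists y].
  lra.
have hi' x y : K x y -> x <= x1 + e.
  move=> Kxy; have : x <= sup X by apply: ub_le_sup; [case: hs|exists y].
  lra.
have [W|W] := leP (x1 - x0) (5 * e).
  left; exists x0 => x y Kxy; have := lo _ _ Kxy; have := hi' _ _ Kxy => ? ?.
  by rewrite ler_norml; apply/andP; split; lra.
right; exists ((y1 - y0) / (x1 - x0)), (y0 - (y1 - y0) / (x1 - x0) * x0) => x y Kxy.
have w0 : 0 < x1 - x0 by lra.
have : `|(y - y0) * (x1 - x0) - (y1 - y0) * (x - x0)| <= 4 * e * (x1 - x0).
  have [xm|xm] := leP x ((x0 + x1) / 2).
    by apply: (planar_half e0 cK KL cut K0 K1) => //; exact: lo Kxy.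
  pose K' u v := K (- u) v.
  have := @planar_half R K' L e (- x1) y1 (- x0) y0 (- x) y e0.
  have -> : (y - y1) * (- x0 - - x1) - (y0 - y1) * (- x - - x1) =
    (y - y0) * (x1 - x0) - (y1 - y0) * (x - x0) by ring.
  have -> : - x0 - - x1 = x1 - x0 by ring.
  apply; rewrite /K' ?opprK//.
  - move=> u v u' v' t t01 h h'; have := cK _ _ _ _ _ t01 h h'.
    by congr (K _ _); ring.
  - by move=> u v /KL; rewrite normrN.
  - move=> a b ha hb; have [||u [v [uv H]]] := cut (- a) b.
    + by rewrite mulrNz mulrN normrN.
    + by [].
    exists (- u), v; split; first by rewrite oppr_eq0.
    move=> x' y' /H; rewrite mulrNz; lra.
  - by have := hi' _ _ Kxy; lra.
  - lra.
move=> H; rewrite -(ler_pM2r w0) -[X in _ * X <= _](gtr0_norm w0) -normrM.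
have -> : (y - ((y1 - y0) / (x1 - x0) * x + (y0 - (y1 - y0) / (x1 - x0) * x0))) * (x1 - x0) =
  (y - y0) * (x1 - x0) - (y1 - y0) * (x - x0) by field; rewrite gt_eqF.
by apply: le_trans H _; rewrite ler_wpM2r ?(ltW w0)//; lra.
Qed.

(** * Localization *)

Definition uniform_on_bounded (R : realType) (g : R -> R) := forall B e : R, 0 < e ->
  exists2 dl, 0 < dl & forall x y, `|x| <= B -> `|y| <= B -> `|x - y| <= dl -> `|g x - g y| <= e.

Definition test_fun (R : realType) (g : R -> R) := [/\ measurable_fun setT g,
  uniform_on_bounded g & forall B : R, exists C : R, forall x, `|x| <= B -> `|g x| <= C].

Section Localization.
Context (R : realType) (n : nat).
Local Notation T := (n.-tuple R).

Definition tline (x v : T) (t : R) : T := [tuple tnth x i + t * tnth v i | i < n].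

(* Functions that are polynomials of degree at most d along every line; unlike
   {mpoly R[n]}, this class is trivially stable under affine substitutions. *)
Definition line_poly (d : nat) (F : T -> R) := [/\ measurable_fun setT F,
  forall x v, exists q : {poly R}, (size q <= d.+1)%N /\ forall t, F (tline x v t) = q.[t] &
  forall L : R, exists2 La, 0 <= La & forall x y, (forall i, `|tnth x i| <= L) ->
    (forall i, `|tnth y i| <= L) -> `|F x - F y| <= La * \sum_i `|tnth x i - tnth y i|].

Definition depends_on (F : T -> R) (I : {set 'I_n}) := forall x y : T,
  (forall i, i \in I -> tnth x i = tnth y i) -> F x = F y.

Definition subst_coord (j : 'I_n) (al : R) (i : 'I_n) (be : R) (x : T) : T :=
  [tuple if k == j then al * tnth x i + be else tnth x k | k < n].

Lemma line_poly_subst d F j al i be : line_poly d F -> line_poly d (F \o subst_coord j al i be).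
Proof.
move=> [mF lF cF]; split.
- apply: measurableT_comp => //; apply/measurable_fun_tnthP => k.
  rewrite (_ : _ \o _ = fun x : T => if k == j then al * tnth x i + be else tnth x k); last first.
    by apply/funext => x /=; rewrite tnth_mktuple.
  case: (k == j); last exact: measurable_tnth.
  apply: measurable_funD => //; apply: measurable_funM => //; exact: measurable_tnth.
- move=> x v.
  (* A direction transforms by the linear part of the substitution, whence 0 in place of [be]. *)
  have [q [sq hq]] := lF (subst_coord j al i be x) (subst_coord j al i 0 v).
  exists q; split=> // t; rewrite -hq /=; congr F.
  apply: eq_from_tnth => k; rewrite !tnth_mktuple.
  by case: (k == j); rewrite //; ring.
move=> L; have [La La0 hLa] := cF (`|al| * `|L| + `|be| + `|L|).
exists (La * (1 + `|al|)); first by rewrite mulr_ge0// addr_ge0.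
have bd x : (forall k, `|tnth x k| <= L) ->
    forall k, `|tnth (subst_coord j al i be x) k| <= `|al| * `|L| + `|be| + `|L|.
  move=> hx k; rewrite tnth_mktuple.
  have h0 k' : `|tnth x k'| <= `|L| by apply: le_trans (hx k') (ler_norm _).
  case: (k == j); last by apply: le_trans (h0 k) _; rewrite lerDr addr_ge0// mulr_ge0.
  apply: le_trans (ler_normD _ _) _; rewrite normrM.
  apply: le_trans (_ : `|al| * `|L| + `|be| <= _); last by rewrite lerDl.
  by rewrite lerD2r ler_wpM2l.
move=> x y hx hy; apply: le_trans (hLa _ _ (bd x hx) (bd y hy)) _.
rewrite -mulrA ler_wpM2l//.
apply: le_trans (_ : \sum_k (`|tnth x k - tnth y k| + (k == j)%:R * (`|al| * `|tnth x i - tnth y i|)) <= _).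
  apply: ler_sum => k _; rewrite !tnth_mktuple; case: (k == j); rewrite ?mul1r ?mul0r ?addr0//.
  have -> : al * tnth x i + be - (al * tnth y i + be) = al * (tnth x i - tnth y i) by ring.
  by rewrite normrM lerDr.
rewrite big_split/= -mulr_suml mulrDl mul1r lerD2l.
have -> : \sum_(k < n) ((k == j)%:R : R) = 1.
  by rewrite (bigD1 j)//= eqxx big1 ?addr0// => k /negPf ->.
rewrite mul1r ler_wpM2l// (bigD1 i)//= lerDl sumr_ge0//.
Qed.

Lemma depends_subst F (I : {set 'I_n}) j al i be : i != j -> i \in I -> depends_on F I ->
  depends_on (F \o subst_coord j al i be) (I :\ j).
Proof.
move=> ij iI hF x y hxy; apply: hF => k kI; rewrite !tnth_mktuple.
have [_|kj] := eqVneq k j.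
  by rewrite hxy// !inE ij.
by rewrite hxy// !inE kj.
Qed.

Lemma line_poly_bounded d F (L : R) : line_poly d F -> exists B, forall x : T,
  (forall i, `|tnth x i| <= L) -> `|F x| <= B.
Proof.
move=> [_ _ cF]; have [La La0 hLa] := cF `|L|.
pose z : T := [tuple 0 | i < n].
exists (`|F z| + La * \sum_(i < n) `|L|) => x hx.
have hx' i : `|tnth x i| <= `|L| by apply: le_trans (hx i) (ler_norm _).
have hz i : `|tnth z i| <= `|L| by rewrite tnth_mktuple normr0.
have := hLa _ _ hx' hz => h.
have h2 : La * \sum_i `|tnth x i - tnth z i| <= La * \sum_(i < n) `|L|.
  by rewrite ler_wpM2l//; apply: ler_sum => i _; rewrite tnth_mktuple subr0.
have := ler_normD (F z) (F x - F z); rewrite subrKC; lra.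
Qed.

Context (mu : probability T R).

Definition avg (D : set T) (f : T -> R) := (\int[mu]_(x in D) f x) / fine (mu D).

Lemma test_fun_bdint (g : R -> R) (F : T -> R) (D : set T) (B : R) : test_fun g -> measurable_fun setT F -> measurable D ->
  (forall x, D x -> `|F x| <= B) -> bdint mu D (g \o F).
Proof.
move=> [mg _ bg] mF mD FB; have [C hC] := bg B.
split=> //; first exact: mu_lty.
  exact: measurableT_comp.
by exists C => x /FB /hC.
Qed.

Lemma eq_avg (D : set T) f1 f2 : (forall x, D x -> f1 x = f2 x) -> avg D f1 = avg D f2.
Proof.
by move=> h; rewrite /avg; congr (_ / _); apply: eq_Rintegral => x /set_mem /h.
Qed.

Variables (d : nat) (g h Psi : R -> R).
Hypotheses (bor : borell mu) (tg : test_fun g) (th : test_fun h) (cPsi : continuous Psi).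
Hypothesis needle : forall (D : set T) (X : T -> R) (q : {poly R}) (L B : R),
  measurable D -> convex_set D -> in_box D L -> 0 < fine (mu D) ->
  affine_fun X -> (forall x, D x -> `|X x| <= B) -> (size q <= d.+1)%N ->
  avg D (fun x => h q.[X x]) <= Psi (avg D (fun x => g q.[X x])).

Lemma grid_seq (e L : R) : 0 < e -> exists ps : seq (R * R), forall a b : int,
  `|e * a%:~R| <= L -> `|e * b%:~R| <= L -> (e * a%:~R, e * b%:~R) \in ps.
Proof.
move=> e0; pose N := Num.bound (`|L| / e).
have hN : `|L| / e < N%:R by apply: archi_boundP; rewrite divr_ge0// ltW.
pose r := [seq (k%:Z - N%:Z)%R | k <- iota 0 (2 * N).+1].
have hr a : `|e * a%:~R| <= L -> a \in r.
  rewrite normrM gtr0_norm// -intr_norm mulrC -ler_pdivlMr// => ha.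
  have {}ha : (`|a| < N%:Z)%R.
    rewrite -(ltr_int R); apply: le_lt_trans ha _; apply: le_lt_trans hN.
    by rewrite ler_wpM2r ?invr_ge0 ?(ltW e0)// ler_norm.
  apply/mapP; exists (absz (a + N%:Z)%R); last by lia.
  by rewrite mem_iota; lia.
exists [seq (e * a%:~R, e * b%:~R) | a <- r, b <- r] => a b /hr ha /hr hb.
by apply/allpairsP; exists (a, b).
Qed.

(** With at most one active coordinate, F is determined by its restriction to a coordinate line, and
    the needle hypothesis applies with that coordinate as [X]. *)
Lemma localization_base (F : T -> R) (I : {set 'I_n}) (D : set T) (L : R) : (#|I| <= 1)%N -> depends_on F I ->
  line_poly d F -> measurable D -> convex_set D -> in_box D L -> 0 < fine (mu D) ->
  avg D (h \o F) <= Psi (avg D (g \o F)).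
Proof.
move=> cI dF [_ lF _] mD cD DL D0.
have [I0|[i iI]] := set_0Vmem I.
  pose z : T := [tuple 0 | i < n].
  have FE x : F x = (F z)%:P.[0] by rewrite hornerC; apply: dF => i; rewrite I0 inE.
  rewrite (@eq_avg D (h \o F) (fun=> h (F z)%:P.[0])); last by move=> x _ /=; rewrite FE.
  rewrite (@eq_avg D (g \o F) (fun=> g (F z)%:P.[0])); last by move=> x _ /=; rewrite FE.
  apply: (@needle D (fun=> 0) (F z)%:P L 0) => //.
  - by split=> [|x y t]; [exact: measurable_cst|rewrite !mulr0 addr0].
  - by move=> x _; rewrite normr0.
  - by rewrite (leq_trans (size_polyC_leq1 _)).
have Ii : I = [set i]%SET by apply/esym/eqP; rewrite eqEcard finset.sub1set iI cards1.
pose z : T := [tuple 0 | k < n]; pose v : T := [tuple (k == i)%:R | k < n].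
have [q [sq hq]] := lF z v.
have FE x : F x = q.[tnth x i].
  rewrite -hq; apply: dF => k; rewrite Ii inE => /eqP ->.
  by rewrite !tnth_mktuple eqxx mulr1 add0r.
rewrite (@eq_avg D (h \o F) (fun x => h q.[tnth x i])); last by move=> x _ /=; rewrite FE.
rewrite (@eq_avg D (g \o F) (fun x => g q.[tnth x i])); last by move=> x _ /=; rewrite FE.
by apply: (@needle D _ q L L) => //; [exact: affine_fun_tnth|move=> x /DL].
Qed.

(** In a vertical strip the coordinate i is nearly constant; it is then replaced by an affine
    function of slope 0 of the coordinate j, so the two cases have one form. *)
Lemma thin_piece (I : {set 'I_n}) (i j : 'I_n) (D : set T) (L e : R) (ps : seq (R * R)) :
  0 < e -> i != j -> i \in I -> j \in I -> convex_set D -> in_box D L ->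
  (forall a b : int, `|e * a%:~R| <= L -> `|e * b%:~R| <= L -> (e * a%:~R, e * b%:~R) \in ps) ->
  (forall p, p \in ps -> cut_at D i j p) ->
  exists i' j' al be, [/\ i' != j', i' \in I, j' \in I &
    forall x, D x -> `|tnth x j' - (al * tnth x i' + be)| <= 6 * e].
Proof.
move=> e0 ij iI jI cD DL hps cut.
pose K u v := exists2 x, D x & tnth x i = u /\ tnth x j = v.
have cK : planar_convex K.
  move=> u v u' v' t t01 [x Dx [<- <-]] [y Dy [<- <-]].
  by exists (tconv t x y); [exact: cD|rewrite !tnth_mktuple].
have KL u v : K u v -> `|u| <= L /\ `|v| <= L.
  by move=> [x /DL Lx [<- <-]].
have cutK (a b : int) : `|e * a%:~R| <= L -> `|e * b%:~R| <= L -> planar_cut K (e * a%:~R) (e * b%:~R).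
  move=> ha hb; have [u [v [uv H]]] := cut _ (hps a b ha hb).
  by exists u, v; split=> // _ _ [x Dx [<- <-]]; exact: H.
have [[c hc]|[al [be hab]]] := planar_flat e0 cK KL cutK.
  exists j, i, 0, c; split=> //; first by rewrite eq_sym.
  by move=> x Dx; rewrite mul0r add0r; apply: (hc _ (tnth x j)); exists x.
by exists i, j, al, be; split=> // x Dx; apply: hab; exists x.
Qed.

(** Each piece keeps the average of g(F) exactly, and on it one coordinate is replaced by an affine
    function of another. F moves by at most [dl] there, so the average of g moves by at most [e2];
    continuity of [Psi] and of h turn this into the slack [e1]. A conclusion restricted to exactly
    balanced averages would not survive this perturbation, and the induction on the number of
    coordinates would fail. *)
Theorem localization_le (F : T -> R) (I : {set 'I_n}) (D : set T) (L : R) : depends_on F I ->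
  line_poly d F -> measurable D -> convex_set D -> in_box D L -> 0 < fine (mu D) ->
  avg D (h \o F) <= Psi (avg D (g \o F)).
Proof.
have [m] := ubnP #|I|; elim: m I F D => // m IH I F D cI dF lF mD cD DL D0.
have [I1|] := leqP #|I| 1; first exact: localization_base I1 dF lF mD cD DL D0.
move=> /card_gt1P[i [j [iI jI ij]]].
set ga := avg D (g \o F).
apply/ler_addgt0Pr => e1 e10.
pose eta := e1 / 2; have eta0 : 0 < eta by rewrite divr_gt0.
have [e2 e20 hPsi] : exists2 e2, 0 < e2 & forall s, `|s - ga| <= e2 -> Psi s <= Psi ga + eta.
  have /cvgrPdist_le/(_ eta eta0) := @cPsi ga.
  move=> /nbhs_ballP[r r0 hr]; exists (r / 2); first by rewrite divr_gt0.
  move=> s hs; have := hr s; rewrite /= distrC.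
  have sr : ball ga r s.
    rewrite /ball /= distrC; apply: le_lt_trans hs _.
    by rewrite ltr_pdivrMr// mulrDr mulr1 ltrDl.
  by move=> /(_ sr); rewrite ler_norml => /andP[_]; lra.
have [mF _ cF] := lF.
have [B hB] := line_poly_bounded (`|L| + 1) lF.
have DL' x : D x -> forall k, `|tnth x k| <= `|L| + 1.
  by move=> /DL Lx k; apply: le_trans (Lx k) _; rewrite (le_trans (ler_norm _))// lerDl.
have [dl1 dl10 hg] := let: And3 _ ug _ := tg in ug B e2 e20.
have [dl2 dl20 hh] := let: And3 _ uh _ := th in uh B eta eta0.
have [La La0 hLa] := cF (`|L| + 1).
pose dl := Num.min dl1 dl2.
have dl0 : 0 < dl by rewrite lt_min dl10.
(* The piece has thickness 6 e: the first bound keeps the substituted points in the box enlarged by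
   1, the second keeps the change of F below [dl]. *)
pose e := Num.min (6^-1) (dl / (6 * (La + 1))).
have La1 : 0 < La + 1 by rewrite ltr_wpDl.
have e0 : 0 < e by rewrite lt_min invr_gt0 ltr0n divr_gt0// mulr_gt0.
have e6 : 6 * e <= 1 by rewrite mulrC -ler_pdivlMr// mul1r ge_min lexx.
have eLa : La * (6 * e) <= dl.
  have : e <= dl / (6 * (La + 1)) by rewrite ge_min lexx orbT.
  rewrite ler_pdivlMr ?mulr_gt0// => H; apply: le_trans H.
  by nra.
have [ps hps] := grid_seq L e0.
have bgF D' : measurable D' -> D' `<=` D -> bdint mu D' (g \o F).
  by move=> mD' D'D; apply: (test_fun_bdint tg mF mD' (B := B)) => x /D'D/DL'/hB.
have bhF D' : measurable D' -> D' `<=` D -> bdint mu D' (h \o F).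
  by move=> mD' D'D; apply: (test_fun_bdint th mF mD' (B := B)) => x /D'D/DL'/hB.
have bc D' c : measurable D' -> bdint mu D' (fun=> c).
  by move=> mD'; apply: bdint_cst => //; exact: mu_lty.
pose psi x := (g \o F) x - ga; pose phi x := (h \o F) x - (Psi ga + e1).
have subdiv D' f c : measurable D' -> bdint mu D' f ->
    \int[mu]_(x in D') (f x - c) = \int[mu]_(x in D') f x - c * fine (mu D').
  by move=> mD' bf; rewrite RintB//; [rewrite Rintegral_cst|exact: bc].
have : \int[mu]_(x in D) phi x <= 0.
  apply: (@cut_pieces _ _ mu i j L psi phi ps D) => //.
  - by apply: bdintB; [exact: bgF|exact: bc].
  - by apply: bdintB; [exact: bhF|exact: bc].
  - move=> D' D'D mD' cD' int0 cut.
    have D'L : in_box D' L by move=> x /D'D/DL.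
    have [D'0|D'0] := eqVneq (mu D') 0%E.
      by rewrite Rint_null//; apply: bdintB; [exact: bhF|exact: bc].
    have pD' : 0 < fine (mu D').
      by rewrite fine_gt0// (mu_lty mu mD') andbT lt_neqAle eq_sym D'0 measure_ge0.
    have [i' [j' [al [be [ij' iI' jI' thin]]]]] := thin_piece e0 ij iI jI cD' D'L hps cut.
    pose F' := F \o subst_coord j' al i' be.
    have lF' : line_poly d F' by exact: line_poly_subst.
    have dF' : depends_on F' (I :\ j') by exact: depends_subst.
    have cI' : (#|I :\ j'| < m)%N.
      by move: cI; rewrite (cardsD1 j' I) jI' add1n ltnS.
    have := IH _ _ _ cI' dF' lF' mD' cD' D'L pD'.
    have sub_box x : D' x -> forall k, `|tnth (subst_coord j' al i' be x) k| <= `|L| + 1.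
      move=> D'x k; rewrite tnth_mktuple; have [_|_] := eqVneq k j'; last exact: DL' (D'D _ D'x) _.
      have h1 := thin x D'x; have h2 := D'L x D'x j'; have h3 := ler_norm L.
      have := ler_normB (tnth x j') (tnth x j' - (al * tnth x i' + be)).
      rewrite opprB subrKC; lra.
    have FF' x : D' x -> `|F x - F' x| <= dl.
      move=> D'x; apply: le_trans (hLa _ _ (DL' _ (D'D _ D'x)) (sub_box x D'x)) _.
      apply: le_trans eLa; rewrite ler_wpM2l//.
      rewrite (bigD1 j')//= tnth_mktuple eqxx big1 ?addr0; first exact: thin.
      by move=> k /negPf kj; rewrite tnth_mktuple kj subrr normr0.
    have bF x : D' x -> `|F x| <= B by move=> /D'D/DL'/hB.
    have bF' x : D' x -> `|F' x| <= B by move=> D'x; apply: hB; exact: sub_box.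
    have mF' : measurable_fun setT F' by case: lF'.
    have bgF' : bdint mu D' (g \o F') by exact: test_fun_bdint bF'.
    have bhF' : bdint mu D' (h \o F') by exact: test_fun_bdint bF'.
    have bgF1 := bgF D' mD' D'D; have bhF1 := bhF D' mD' D'D.
    have gd : `|avg D' (g \o F') - ga| <= e2.
      have := subdiv D' _ ga mD' bgF1; rewrite -/psi int0 => /esym/eqP; rewrite subr_eq0 => /eqP E.
      have -> : avg D' (g \o F') - ga = (\int[mu]_(x in D') ((g \o F') x - (g \o F) x)) / fine (mu D').
        by rewrite RintB// E /avg mulrBl mulfK ?gt_eqF.
      rewrite normrM [X in _ * X]ger0_norm ?invr_ge0 ?(ltW pD')// ler_pdivrMr//.
      apply: le_norm_Rint; first exact: bdintB.
      move=> x D'x; rewrite distrC; apply: hg; [exact: bF|exact: bF'|].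
      by apply: le_trans (FF' x D'x) _; rewrite ge_min lexx.
    have hd : \int[mu]_(x in D') (h \o F) x - \int[mu]_(x in D') (h \o F') x <= eta * fine (mu D').
      rewrite -RintB//; apply: le_trans (ler_norm _) _; apply: le_norm_Rint; first exact: bdintB.
      move=> x D'x; apply: hh; [exact: bF|exact: bF'|].
      by apply: le_trans (FF' x D'x) _; rewrite ge_min lexx orbT.
    move=> /le_trans/(_ (hPsi _ gd)); rewrite /avg ler_pdivrMr// => H.
    rewrite /phi subdiv//; rewrite /eta in H hd; move: H hd.
    set a1 := \int[mu]_(x in D') (h \o F') x; set a2 := \int[mu]_(x in D') (h \o F) x.
    move=> H hd; nra.
  - rewrite /psi subdiv//; last exact: bgF.
    by rewrite /ga /avg divfK ?subrr// gt_eqF.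
rewrite /phi subdiv//; last exact: bhF.
by rewrite subr_le0 -ler_pdivrMr.
Qed.

End Localization.

(** * Remez' inequality and oscillation of univariate polynomials *)

(** Divided differences: (Q - Q(x)) / (X - x) has lower degree and is at most 2 e / de at the other
    nodes. Each step multiplies the bound by 2 l / de and adds e, and l >= de absorbs both into the
    factor 3 l / de. *)
Lemma newton_bound (R : realType) (k : nat) (Q : {poly R}) (xs : seq R) (de l e y : R) :
  0 < de <= l -> 0 <= e -> (size Q <= k.+1)%N -> size xs = k.+1 ->
  pairwise (fun a b => de <= `|a - b|) xs -> (forall x, x \in xs -> `|Q.[x]| <= e) ->
  (forall x, x \in xs -> `|y - x| <= l) -> `|Q.[y]| <= (3 * l / de) ^+ k * e.
Proof.
move=> /andP[de0 del]; have l0 : 0 < l by apply: lt_le_trans del.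
elim: k Q xs e => [|k IH] Q [//|x xs] e e0 sQ /= => [[sxs]|[sxs]] /andP[hx hxs] Qe yl.
  by rewrite expr0 mul1r; have := Qe x (mem_head _ _); rewrite (size1_polyC sQ) !hornerC.
have rQ : root (Q - Q.[x]%:P) x by rewrite /root !hornerE subrr.
have /factor_theorem[Q1 EQ] := rQ.
have sQ1 : (size Q1 <= k.+1)%N.
  have [->|Q10] := eqVneq Q1 0; first by rewrite size_poly0.
  have : (size (Q - Q.[x]%:P)%R <= k.+2)%N.
    rewrite (leq_trans (size_polyD _ _))// geq_max sQ size_polyN.
    by rewrite (leq_trans (size_polyC_leq1 _)).
  by rewrite EQ size_Mmonic ?monicXsubC// size_XsubC addn2 /= ltnS.
have QE z : Q.[z] = Q.[x] + Q1.[z] * (z - x).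
  by have := congr1 (horner^~ z) EQ; rewrite !hornerE => <-; rewrite subrKC.
have Q1e z : z \in xs -> `|Q1.[z]| <= 2 * e / de.
  move=> zxs; have dzx : de <= `|z - x| by rewrite distrC; exact: (allP hx).
  have nz : 0 < `|z - x| by apply: lt_le_trans dzx.
  rewrite ler_pdivlMr//; apply: le_trans (_ : `|Q1.[z]| * `|z - x| <= _).
    by rewrite ler_wpM2l.
  rewrite -normrM -[X in `|X|](addrK Q.[x]) (addrC _ Q.[x]) -QE.
  apply: le_trans (ler_normB _ _) _.
  have h1 := Qe z (mem_behead (s := x :: xs) zxs); have h2 := Qe x (mem_head _ _).
  lra.
have e1 : 0 <= 2 * e / de by rewrite divr_ge0 ?mulr_ge0// ltW.
have := IH Q1 xs (2 * e / de) e1 sQ1 sxs hxs Q1e (fun z h => yl z (mem_behead (s := x :: xs) h)).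
set r := l / de.
have r1 : 1 <= r by rewrite ler_pdivlMr// mul1r.
rewrite -mulrA -/r => H.
have r3 : 1 <= (3 * r) ^+ k by apply: exprn_ege1; lra.
set p := (3 * r) ^+ k in H r3 *.
rewrite QE; apply: le_trans (ler_normD _ _) _.
have h1 := Qe x (mem_head _ _); have h2 := yl x (mem_head _ _).
have h3 : `|Q1.[y] * (y - x)| <= p * (2 * e / de) * l.
  by rewrite normrM; apply: ler_pM.
have E : p * (2 * e / de) * l = 2 * p * r * e by rewrite /r; field; rewrite gt_eqF.
rewrite exprS -/p; have : e <= p * r * e.
  by rewrite ler_peMl//; nra.
rewrite E in h3; nra.
Qed.

(** Greedy choice: intervals of radius de around m points have total length e m / (k + 2), less than
    the measure of E, so a further point remains. *)
Lemma separated_points (R : realType) (E : set R) (e : R) (k m : nat) :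
  measurable E -> 0 < e -> (e%:E <= lebesgue_measure E)%E -> (m <= k.+1)%N ->
  exists xs : seq R, [/\ size xs = m, pairwise (fun a b => e / (2 * k.+2%:R) <= `|a - b|) xs &
    forall x, x \in xs -> E x].
Proof.
move=> mE e0 eE; set de := e / _.
have de0 : 0 < de by rewrite divr_gt0.
elim: m => [|m IH] mk; first by exists [::].
have [xs [sxs pxs Exs]] := IH (ltnW mk).
have [x Ex hx] : exists2 x, E x & forall z, z \in xs -> de <= `|x - z|.
  apply: contrapT => H.
  have cov : forall x, E x -> exists2 z, z \in xs & `|x - z| < de.
    move=> x Ex; apply: contrapT => H1; apply: H; exists x => // z zxs.
    by rewrite leNgt; apply/negP => h; apply: H1; exists z.
  pose F (s : seq R) := \big[setU/set0]_(z <- s) (`]z - de, z + de[%classic : set R).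
  have mF s : measurable (F s) by apply: bigsetU_measurable.
  have hF s : (lebesgue_measure (F s) <= (2 * de * (size s)%:R)%:E)%E.
    elim: s => [|z s IHs]; first by rewrite /F big_nil measure0 mulr0.
    rewrite /F big_cons; apply: le_trans (measureU2 _ _ _) _ => //; first exact: mF.
    have -> : 2 * de * (size (z :: s))%:R = 2 * de + 2 * de * (size s)%:R.
      by rewrite (_ : (size (z :: s))%:R = (size s)%:R + 1 :> R) ?natr1//; ring.
    rewrite /= EFinD; apply: leeD; last exact: IHs.
    rewrite lebesgue_measure_itv/= lte_fin ifT; last lra.
    by rewrite -EFinD lee_fin; lra.
  have : (lebesgue_measure E <= lebesgue_measure (F xs))%E.
    apply: le_measure; rewrite ?inE//; first exact: mF.
    move=> x /cov[z zxs xz]; rewrite /F -bigcup_seq; exists z => //=.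
    by rewrite in_itv /=; move: xz; rewrite ltr_norml => /andP[? ?]; apply/andP; split; lra.
  move=> /(le_trans eE)/le_trans/(_ (hF xs)); rewrite lee_fin sxs leNgt => /negP; apply.
  have -> : 2 * de * m%:R = e * (m%:R / k.+2%:R).
    have k0 : k.+2%:R != 0 :> R by rewrite pnatr_eq0.
    by rewrite /de; move: (k.+2%:R) k0 => q q0; field.
  rewrite gtr_pMr// ltr_pdivrMr// mul1r ltr_nat; lia.
exists (x :: xs); split; rewrite /= ?sxs// ?pxs ?andbT.
  by apply/allP => z /hx.
by move=> z; rewrite in_cons => /orP[/eqP ->|/Exs].
Qed.

(** Interpolation at k + 1 points of E with mutual distance at least e / (2 (k + 2)); the factor 3
    of [newton_bound] times 2 (k + 2) gives 6 (k + 2). *)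
Lemma remez (R : realType) (k : nat) (Q : {poly R}) (E : set R) (a b e t y : R) :
  (size Q <= k.+1)%N -> measurable E -> E `<=` `[a, b] -> 0 < e ->
  (e%:E <= lebesgue_measure E)%E -> (forall x, E x -> `|Q.[x]| <= t) -> a <= y <= b ->
  `|Q.[y]| <= (6 * k.+2%:R * (b - a) / e) ^+ k * t.
Proof.
move=> sQ mE Eab e0 eE Qt yab.
have [xs [sxs pxs Exs]] := separated_points mE e0 eE (leqnn k.+1).
have [x xxs] : exists x, x \in xs by case: xs sxs {pxs Exs} => [//|x xs _]; exists x; rewrite mem_head.
have t0 : 0 <= t by apply: le_trans (Qt x (Exs x xxs)).
have ab : e <= b - a.
  rewrite -lee_fin; apply: le_trans eE _.
  apply: le_trans (_ : (lebesgue_measure (`[a, b]%classic : set R) <= _)%E).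
    by apply: le_measure; rewrite ?inE.
  have ab : a <= b by have /andP[] := yab; apply: le_trans.
  rewrite lebesgue_measure_itv/= lte_fin; case: ltP => [_|h]; first by rewrite -EFinD.
  by rewrite lee_fin subr_ge0.
have := @newton_bound R k Q xs (e / (2 * k.+2%:R)) (b - a) t y _ t0 sQ sxs pxs.
have -> : 3 * (b - a) / (e / (2 * k.+2%:R)) = 6 * k.+2%:R * (b - a) / e.
  by field; rewrite gt_eqF//= -natr1 natr1 pnatr_eq0.
apply.
- rewrite divr_gt0//=; apply: le_trans ab; rewrite ler_pdivrMr ?mulr_gt0//.
  by rewrite ler_peMr ?(ltW e0)//; have : 1 <= k.+2%:R :> R by [rewrite ler1n]; lra.
- by move=> z /Exs; exact: Qt.
- move=> z /Exs/Eab /=; rewrite in_itv /= => /andP[? ?]; have /andP[? ?] := yab.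
  by rewrite ler_norml; apply/andP; split; lra.
Qed.

Definition zero_free (R : realType) (p : {poly R}) (a b : R) :=
  p = 0 \/ forall x, a < x < b -> p.[x] != 0.

(** A root r of p is factored out. An interval free of zeros of the quotient splits at r into at
    most two intervals free of zeros of p, so the bound doubles with each root. The count is crude,
    but only its dependence on the degree matters. *)
Lemma split_at_roots (R : realType) (Phi : R -> R -> R) (A B : R) (m : nat) (p : {poly R}) (K : R) :
  (size p <= m)%N -> 0 <= K ->
  (forall a b c, A <= a -> a <= b -> b <= c -> c <= B -> Phi a c <= Phi a b + Phi b c) ->
  (forall a b, A <= a -> a <= b -> b <= B -> zero_free p a b -> Phi a b <= K) ->
  forall a b, A <= a -> a <= b -> b <= B -> Phi a b <= 2 ^+ m * K.
Proof.
move=> + + sub; elim: m p K => [|m IH] p K sp K0 H a b Aa ab bB.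
  rewrite expr0 mul1r; apply: H => //; left.
  by apply/eqP; rewrite -size_poly_leq0.
have [z|nz] := pselect (zero_free p a b).
  apply: le_trans (H a b Aa ab bB z) _.
  by rewrite ler_peMl// exprn_ege1// ler1n.
have [p0 [r [rab r0]]] : p != 0 /\ exists r, a < r < b /\ p.[r] = 0.
  split; first by apply/eqP => p0; apply: nz; left.
  apply: contrapT => Hr; apply: nz; right => x xab; apply/eqP => px; apply: Hr.
  by exists x.
have /factor_theorem[p1 Ep] : root p r by apply/eqP.
have p10 : p1 != 0 by apply: contraNneq p0 => p10; rewrite Ep p10 mul0r.
have sp1 : (size p1 <= m)%N by move: sp; rewrite Ep size_Mmonic ?monicXsubC// size_XsubC addn2.
rewrite exprS (mulrC 2) -mulrA.
apply: (IH p1 (2 * K) sp1) => //; first by rewrite mulr_ge0.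
move=> a' b' Aa' ab' bB' [/eqP|z1]; first by rewrite (negPf p10).
have zf c d : a' <= c -> d <= b' -> (d <= r \/ r <= c) -> zero_free p c d.
  move=> ac db hr; right=> x /andP[cx xd]; rewrite Ep hornerM hornerXsubC mulf_neq0//.
    by apply: z1; rewrite (le_lt_trans ac cx) (lt_le_trans xd db).
  by rewrite subr_eq0; case: hr => h; [rewrite lt_eqF// (lt_le_trans xd)|rewrite gt_eqF// (le_lt_trans h)].
have [ra|ar] := leP r a'.
  by apply: le_trans (H _ _ Aa' ab' bB' (zf _ _ (lexx _) (lexx _) (or_intror ra))) _; lra.
have [br|rb] := leP b' r.
  by apply: le_trans (H _ _ Aa' ab' bB' (zf _ _ (lexx _) (lexx _) (or_introl br))) _; lra.
apply: le_trans (sub a' r b' Aa' (ltW ar) (ltW rb) bB') _.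
have h1 := H a' r Aa' (ltW ar) (le_trans (ltW rb) bB') (zf a' r (lexx _) (ltW rb) (or_introl (lexx _))).
have h2 := H r b' (le_trans Aa' (ltW ar)) (ltW rb) bB' (zf r b' (ltW ar) (lexx _) (or_intror (lexx _))).
lra.
Qed.

Lemma zero_free_sign (R : realType) (p : {poly R}) (a b : R) : a <= b -> zero_free p a b ->
  (forall x, a <= x <= b -> 0 <= p.[x]) \/ (forall x, a <= x <= b -> p.[x] <= 0).
Proof.
move=> ab [->|zf]; first by left=> x _; rewrite horner0.
apply: contrapT => /not_orP[/existsNP[x /not_implyP[xab /negP px]] /existsNP[y /not_implyP[yab /negP py]]].
rewrite -ltNge in px; rewrite -ltNge in py.
have key u v : a <= u -> u <= v -> v <= b -> p.[u] * p.[v] < 0 -> False.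
  move=> au uv vb h.
  have uv' : u < v.
    by rewrite lt_neqAle uv andbT; apply/eqP => E; move: h; rewrite E -expr2 ltNge sqr_ge0.
  have cp : {within `[u, v], continuous (horner p)}.
    by apply: continuous_subspaceT; exact: continuous_horner.
  have := @IVT R (horner p) u v 0 uv cp.
  have -> : Num.min p.[u] p.[v] <= 0 <= Num.max p.[u] p.[v].
    rewrite ge_min le_max; have [pu|pu] := leP p.[u] 0; have [pv|pv] := leP p.[v] 0 => //=.
    - by move: h; rewrite ltNge mulr_le0.
    - by rewrite (ltW pv) orbT.
    - by rewrite (ltW pu).
    - by move: h; rewrite ltNge mulr_ge0// ltW.
  move=> /(_ isT)[c]; rewrite in_itv /= => /andP[uc cv] pc.
  have cu : c != u by apply/eqP => E; move: h; rewrite -E pc mul0r ltxx.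
  have cv' : c != v by apply/eqP => E; move: h; rewrite -E pc mulr0 ltxx.
  have uc' : u < c by rewrite lt_neqAle eq_sym cu.
  have cv2 : c < v by rewrite lt_neqAle cv'.
  have := zf c; rewrite (le_lt_trans au uc') (lt_le_trans cv2 vb) pc eqxx.
  by move=> /(_ isT).
have /andP[ax xb] := xab; have /andP[ay yb] := yab.
have h : p.[x] * p.[y] < 0 by rewrite nmulr_rlt0.
have [xy|yx] := leP x y; first exact: (key x y).
by apply: (key y x) => //; [exact: ltW|rewrite mulrC].
Qed.

Lemma Rint_FTC (R : realType) (F f : R -> R) (a b : R) : a <= b ->
  (forall x, a <= x <= b -> is_derive x 1 F (f x)) ->
  (forall x, a <= x <= b -> {for x, continuous f}) ->
  \int[@lebesgue_measure R]_(x in `[a, b]) f x = F b - F a.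
Proof.
move=> ab dF cf.
have [->|ab'] := eqVneq a b; first by rewrite set_itv1 Rintegral_set1 subrr.
have {ab'} ab' : a < b by rewrite lt_neqAle ab'.
have cF x : a <= x <= b -> {for x, continuous F}.
  by move=> /dF h; apply: differentiable_continuous; apply/derivable1_diffP; case: h.
rewrite /Rintegral (@continuous_FTC2 _ f F)//.
- by apply: continuous_in_subspaceT => x /set_mem /=; rewrite in_itv /=; exact: cf.
- split.
  + by move=> x; rewrite in_itv /= => /andP[ax xb]; have [] := dF x _; rewrite ?(ltW ax) ?(ltW xb).
  + by apply: cvg_at_right_filter; apply: cF; rewrite lexx.
  + by apply: cvg_at_left_filter; apply: cF; rewrite lexx andbT.
- move=> x; rewrite in_itv /= => /andP[ax xb]; rewrite derive1E.
  by have [] := dF x _; rewrite ?(ltW ax) ?(ltW xb).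
Qed.

Lemma measurable_comp_continuous (R : realType) (f : R -> R) : continuous f ->
  measurable_fun [set: R] f.
Proof. exact: continuous_measurable_fun. Qed.

Lemma lebesgue_itv_lty (R : realType) (a b : R) :
  (lebesgue_measure (`[a, b]%classic : set R) < +oo)%E.
Proof. by rewrite lebesgue_measure_itv/=; case: ifP => // _; rewrite -EFinB ltry. Qed.

Lemma fine_lebesgue_itv (R : realType) (a b : R) : a <= b ->
  fine (lebesgue_measure (`[a, b]%classic : set R)) = b - a.
Proof.
move=> ab; rewrite lebesgue_measure_itv/= lte_fin; case: ltP => //= h.
by rewrite (le_anti (_ : a <= b <= a)) ?subrr// ab.
Qed.

Lemma Rint_concat (R : realType) (f : R -> R) (a b c A B : R) :
  bdint (@lebesgue_measure R) `[A, B]%classic f -> A <= a -> a <= b -> b <= c -> c <= B ->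
  \int[@lebesgue_measure R]_(x in `[a, c]) f x =
  \int[@lebesgue_measure R]_(x in `[a, b]) f x + \int[@lebesgue_measure R]_(x in `[b, c]) f x.
Proof.
move=> bf Aa ab bc cB.
have bac : bdint (@lebesgue_measure R) `[a, c]%classic f.
  apply: bdint_sub bf => // x /=; rewrite !in_itv /= => /andP[? ?]; apply/andP; split; lra.
have -> := @Rint_split _ (measurableTypeR R) R (@lebesgue_measure R) `[a, c]%classic
  `[a, b]%classic f (measurable_itv _) bac; congr (_ + _).
  congr Rintegral; apply/seteqP; split=> x /=; first by case.
  rewrite !in_itv /= => /andP[? ?]; split; apply/andP; split=> //; lra.
have -> : `[a, c]%classic `\` `[a, b]%classic = (`]b, c]%classic : set R).
  apply/seteqP; split=> x /=; rewrite !in_itv /=.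
    by move=> [/andP[h1 h2] /negP]; rewrite h1 /= -ltNge => ->.
  by move=> /andP[h1 h2]; split; [apply/andP; split=> //; lra|apply/negP; rewrite negb_and -!ltNge h1 orbT].
apply: Rintegral_itv_obnd_cbnd; apply: bdint_integrable; apply: bdint_sub bac => // x /=.
by rewrite !in_itv /= => /andP[? ?]; apply/andP; split; lra.
Qed.

Lemma Rint_indic d (T : measurableType d) (R : realType) (mu : {measure set T -> \bar R})
    (D E : set T) (f : T -> R) :
  \int[mu]_(x in D `&` E) f x = \int[mu]_(x in D) (f x * \1_E x).
Proof.
rewrite Rintegral_mkcondr; apply: eq_Rintegral => x _; rewrite patchE indicE.
by case: ifP; rewrite ?mulr1 ?mulr0.
Qed.

(** The subtracted indicator makes pieces with |q'| <= e harmless. On the others phi'(q) is compared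
    with the derivative of (phi(q) - s) / q', where s = 1 or -1 is chosen so that (phi(q) - s) q''
    <= 0: the extra term of the integration by parts then has the favourable sign, and two boundary
    terms of size 2 / e remain. The exponent 3 d + 1 adds the bounds for the sizes of q'^2 - e^2 and
    of q''. *)
Lemma oscillation_bound (R : realType) (phi dphi : R -> R) (M e : R) (d : nat) (q : {poly R}) :
  (forall t : R, is_derive t 1 phi (dphi t)) -> continuous dphi ->
  (forall t, `|phi t| <= 1) -> (forall t, `|dphi t| <= M) -> 0 < e -> (size q <= d.+1)%N ->
  forall a b, a <= b ->
  \int[@lebesgue_measure R]_(x in `[a, b])
    (dphi q.[x] - M * \1_[set x | `|q^`().[x]| <= e] x) <= 2 ^+ (3 * d).+1 * (4 / e).
Proof.
move=> dphiE cdphi phi1 dphiM e0 sq A B AB.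
have M0 : 0 <= M by apply: le_trans (dphiM 0).
set E := [set x : R | `|q^`().[x]| <= e]; set psi := fun x => dphi q.[x] - M * \1_E x.
have mh (p : {poly R}) : measurable_fun [set: R] (horner p).
  by apply: measurable_comp_continuous; exact: continuous_horner.
have mE : measurable E.
  have -> : E = (fun x => `|q^`().[x]|) @^-1` `]-oo, e]%classic.
    by apply/seteqP; split=> x /=; rewrite in_itv.
  by rewrite -[X in measurable X]setTI; apply: (measurableT_comp _ (mh _)).
have mdq : measurable_fun [set: R] (fun x => dphi q.[x]).
  apply: (measurableT_comp _ (mh q)); exact: measurable_comp_continuous.
have mpsi : measurable_fun [set: R] psi.
  by apply: measurable_funB => //; apply: measurable_funM => //; exact: measurable_indic.
have bpsi a b : bdint (@lebesgue_measure R) `[a, b]%classic psi.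
  split=> //; first exact: lebesgue_itv_lty.
  exists (M + M) => x _; rewrite /psi; apply: le_trans (ler_normB _ _) _; apply: lerD => //.
  rewrite normrM (ger0_norm M0) ler_piMr// indicE; case: (_ \in _); rewrite ?normr1 ?normr0//.
pose Phi a b := \int[@lebesgue_measure R]_(x in `[a, b]) psi x.
have sub A' B' a b c : A' <= a -> a <= b -> b <= c -> c <= B' -> Phi a c <= Phi a b + Phi b c.
  by move=> *; rewrite /Phi (@Rint_concat _ _ a b c A' B').
have e4 : 0 <= 4 / e by rewrite divr_ge0// ltW.
pose p2 := q^`() * q^`() - (e ^+ 2)%:P.
have sdq (p : {poly R}) : (size p^`() <= (size p).-1)%N.
  by rewrite -[X in (_ <= X.-1)%N]/(size p); apply: size_poly.
have s1 : (size q^`() <= d)%N by apply: leq_trans (sdq _) _; lia.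
have s2 : (size (q^`()^`()) <= d)%N by apply: leq_trans (sdq _) _; lia.
have s3 : (size p2 <= (2 * d).+1)%N.
  rewrite /p2 (leq_trans (size_polyD _ _))// geq_max size_polyN; apply/andP; split.
    by apply: leq_trans (size_polyMleq _ _) _; lia.
  by apply: leq_trans (size_polyC_leq1 _) _.
have -> : (3 * d).+1 = ((2 * d).+1 + d)%N by lia.
rewrite exprD -mulrA.
apply: (split_at_roots (Phi := Phi) s3 _ (sub A B)) => //; first by rewrite mulr_ge0// exprn_ge0.
move=> a b Aa ab bB zf2.
apply: (split_at_roots (Phi := Phi) s2 e4 (sub a b)) => // a' b' aa' ab' bb' zf1.
have hp2 x : p2.[x] = q^`().[x] * q^`().[x] - e ^+ 2 by rewrite /p2 !hornerE.
have [pos|neg] := zero_free_sign ab zf2; last first.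
  have : Phi a' b' <= \int[@lebesgue_measure R]_(x in `[a', b']) 0.
    apply: le_Rint => //; first by apply: bdint_cst => //; exact: lebesgue_itv_lty.
    move=> x /=; rewrite in_itv /= => /andP[ax xb].
    have := neg x; rewrite hp2 (le_trans aa' ax) (le_trans xb bb') => /(_ isT) h.
    have xE : E x.
      rewrite /E /= -(ger0_norm (ltW e0)) -(@ler_pXn2r _ 2)// ?nnegrE//.
      by rewrite !real_normK ?num_real// expr2; move: h; rewrite subr_le0.
    by rewrite /psi indicE mem_set// mulr1 subr_le0 (le_trans (ler_norm _)).
  by rewrite Rintegral_cst// mul0r => /le_trans; apply.
have dq0 x : a' <= x <= b' -> e <= `|q^`().[x]|.
  move=> /andP[ax xb]; have := pos x; rewrite hp2 (le_trans aa' ax) (le_trans xb bb') => /(_ isT).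
  rewrite subr_ge0 => h; rewrite -(ger0_norm (ltW e0)) -(@ler_pXn2r _ 2)// ?nnegrE//.
  by rewrite !real_normK ?num_real// expr2.
have dqn x : a' <= x <= b' -> q^`().[x] != 0.
  by move=> /dq0 h; rewrite -normr_gt0; apply: lt_le_trans h.
have bdq : bdint (@lebesgue_measure R) `[a', b']%classic (fun x => dphi q.[x]).
  by split=> //; [exact: lebesgue_itv_lty|exists M].
have step1 : Phi a' b' <= \int[@lebesgue_measure R]_(x in `[a', b']) dphi q.[x].
  by apply: le_Rint => // x _; rewrite /psi gerBl mulr_ge0.
apply: le_trans step1 _.
have [s [s1' hs]] : exists s : R, `|s| <= 1 /\ forall x, a' <= x <= b' ->
    (phi q.[x] - s) * (q^`()^`()).[x] <= 0.
  have pb t : - 1 <= phi t <= 1 by rewrite -ler_norml.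
  have [h|h] := zero_free_sign ab' zf1.
    exists 1; split; first by rewrite normr1.
    by move=> x /h h'; have /andP[] := pb q.[x] => *; nra.
  exists (-1); split; first by rewrite normrN1.
  by move=> x /h h'; have /andP[] := pb q.[x] => *; nra.
pose F x := (phi q.[x] - s) * (q^`().[x])^-1.
pose f x := dphi q.[x] - (phi q.[x] - s) * (q^`()^`()).[x] * ((q^`().[x]) ^+ 2)^-1.
have dF x : a' <= x <= b' -> is_derive x 1 F (f x).
  move=> xab; have nz := dqn x xab.
  have h1 : is_derive x 1 (fun x => phi q.[x]) (dphi q.[x] * q^`().[x]).
    exact: is_derive1_comp.
  have h2 : is_derive x 1 (fun x => (q^`().[x])^-1) (- ((q^`().[x]) ^- 2) *: (q^`()^`()).[x]).
    by apply: is_deriveV.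
  apply: is_derive_eq.
  rewrite /f /= subr0 /GRing.scale /=.
  by field.
have cF x : a' <= x <= b' -> {for x, continuous f}.
  move=> xab; have nz := dqn x xab.
  have ch (p : {poly R}) : {for x, continuous (horner p)} by exact: continuous_horner.
  have cphi : {for x, continuous (fun x => phi q.[x])}.
    apply: continuous_comp; first exact: ch.
    by apply: differentiable_continuous; apply/derivable1_diffP; case: (dphiE q.[x]).
  apply: continuousB.
    by apply: continuous_comp; [exact: ch|exact: cdphi].
  apply: continuousM; last first.
    apply: continuousV; first by rewrite expf_neq0.
    rewrite (_ : (fun x => q^`().[x] ^+ 2) = horner (q^`() * q^`())); first exact: ch.
    by apply/funext => z; rewrite hornerM expr2.
  apply: continuousM; last exact: ch.
  by apply: continuousB => //; exact: cst_continuous.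
apply: le_trans (_ : \int[@lebesgue_measure R]_(x in `[a', b']) f x <= _).
  apply: le_Rintegral => //; first exact: bdint_integrable.
    apply: continuous_compact_integrable; first exact: segment_compact.
    by apply: continuous_in_subspaceT => x /set_mem /=; rewrite in_itv /=; exact: cF.
  move=> x /=; rewrite in_itv /= => xab; rewrite /f lerBrDr gerDl.
  by rewrite mulr_le0_ge0// ?hs// invr_ge0 sqr_ge0.
rewrite (Rint_FTC ab' dF cF).
have bF x : a' <= x <= b' -> `|F x| <= 2 / e.
  move=> xab; rewrite /F normrM normfV; apply: ler_pM => //.
    by apply: le_trans (ler_normB _ _) _; have := phi1 q.[x]; lra.
  by rewrite lef_pV2 ?posrE// ?dq0// (lt_le_trans e0)// dq0.
have := bF a'; have := bF b'; rewrite !lexx ab' /= => /(_ isT) + /(_ isT).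
rewrite !ler_norml => /andP[? ?] /andP[? ?]; lra.
Qed.

(** Layer cake formula for a signed [psi], with a Riemann sum over the levels instead of Fubini. The
    step function [r] is within w / N of rho on both sides, which is what a signed integrand
    needs. *)
Lemma layer_cake_le d (T : measurableType d) (R : realType) (mu : {measure set T -> \bar R})
    (D : set T) (rho psi : T -> R) (w K : R) : bdint mu D psi -> measurable_fun setT rho ->
  0 < w -> (forall x, 0 <= rho x <= w) ->
  (forall s, 0 <= s < w -> \int[mu]_(x in D `&` [set x | s < rho x]) psi x <= K) ->
  \int[mu]_(x in D) (psi x * rho x) <= w * K.
Proof.
move=> bpsi mrho w0 rhow hK; have [mD Dfin mpsi [B hB]] := bpsi.
apply: (@ler_divn_all _ _ _ (`|B| * w * fine (mu D))) => N N0.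
have N0' : 0 < N%:R :> R by rewrite ltr0n.
pose c := w / N%:R; have c0 : 0 < c by rewrite divr_gt0.
pose S j := [set x | c * j%:R < rho x].
have mS j : measurable (S j).
  have -> : S j = rho @^-1` `]c * j%:R, +oo[%classic.
    by apply/seteqP; split=> x /=; rewrite in_itv/= andbT.
  by rewrite -[X in measurable X]setTI; apply: mrho.
pose r x := c * \sum_(0 <= j < N) \1_(S j) x.
have hr x : rho x <= r x <= rho x + c.
  have /andP[r0 rw] := rhow x.
  have E : r x = c * \sum_(0 <= j < N) (c * j%:R < rho x)%R%:R.
    congr (_ * _); apply: eq_bigr => j _; rewrite indicE; congr (_%:R).
    by congr nat_of_bool; apply/idP/idP; [move/set_mem|move=> h; apply/mem_set].
  have [rx0|rx0] := eqVneq (rho x) 0.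
    rewrite E rx0 big1 ?mulr0 ?lexx ?add0r ?(ltW c0)// => j _.
    by rewrite ltNge mulr_ge0// ltW.
  have rpos : 0 < rho x by rewrite lt_neqAle eq_sym rx0.
  rewrite E big_ltn// mulr0 rpos; apply/andP; split.
    have := @le_sum_levels R c (rho x) N (ltW c0) N0.
    by rewrite {1}/c divfK ?gt_eqF// (min_l rw).
  have [j [hj hs]] := max_level (fun j => c * j%:R < rho x) N.
  rewrite mulrDr mulr1 addrC lerD2r.
  apply: le_trans (_ : c * j%:R <= _).
    by rewrite ler_wpM2l ?(ltW c0)//; move: hs; rewrite -(ler_nat R) natr_sum.
  by case: hj => [->|[_ /ltW]]//; rewrite mulr0.
have bS j : bdint mu D (\1_(S j) : T -> R).
  split=> //.
  by exists 1 => x _; rewrite indicE; case: (_ \in _); rewrite ?normr1 ?normr0.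
have hsum m : bdint mu D (fun x => psi x * \sum_(0 <= j < m) \1_(S j) x) /\
    \int[mu]_(x in D) (psi x * \sum_(0 <= j < m) \1_(S j) x) =
    \sum_(0 <= j < m) \int[mu]_(x in D `&` S j) psi x.
  elim: m => [|m [IH1 IH2]].
    have E : (fun x => psi x * \sum_(0 <= j < 0) \1_(S j) x) = fun=> 0.
      by apply/funext => x; rewrite big_geq// mulr0.
    by rewrite E [RHS]big_geq// Rintegral_cst// mul0r; split=> //; exact: bdint_cst.
  have E : (fun x => psi x * \sum_(0 <= j < m.+1) \1_(S j) x) =
      fun x => psi x * \sum_(0 <= j < m) \1_(S j) x + psi x * \1_(S m) x.
    by apply/funext => x; rewrite big_nat_recr//= mulrDr.
  have b2 : bdint mu D (fun x => psi x * \1_(S m) x) by exact: bdintM.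
  rewrite E; split; first exact: bdintD.
  by rewrite RintD// IH2 [RHS]big_nat_recr//= Rint_indic.
have [b1 I1] := hsum N.
have Er : (fun x => psi x * r x) = fun x => c * (psi x * \sum_(0 <= j < N) \1_(S j) x).
  by apply/funext => x; rewrite /r mulrCA.
have br : bdint mu D (fun x => psi x * r x) by rewrite Er; exact: bdintZ.
have brho : bdint mu D (fun x => psi x * rho x).
  apply: bdintM => //; split=> //; exists w => x _.
  by have /andP[h1 h2] := rhow x; rewrite ger0_norm.
have U : \int[mu]_(x in D) (psi x * r x) <= w * K.
  rewrite Er RintZ// I1.
  apply: le_trans (_ : c * \sum_(0 <= j < N) K <= _); last first.
    rewrite sumr_const_nat subn0 -mulr_natr mulrA mulrAC mulrC mulrA /c.
    by rewrite -mulrA divfK ?gt_eqF// mulrC.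
  rewrite ler_wpM2l ?(ltW c0)//; apply: ler_sum_nat => j /andP[_ jN]; apply: hK.
  rewrite mulr_ge0 ?(ltW c0)//= /c -mulrA gtr_pMr// mulrC ltr_pdivrMr// mul1r ltr_nat//.
have := @le_norm_Rint _ _ _ mu D (fun x => psi x * rho x - psi x * r x) (`|B| * c) (bdintB brho br).
rewrite RintB// => /(_ _)/le_trans; move=> H.
have : `|\int[mu]_(x in D) (psi x * rho x) - \int[mu]_(x in D) (psi x * r x)| <= `|B| * c * fine (mu D).
  apply: H (lexx _) => x Dx; rewrite -mulrBr normrM; apply: ler_pM => //.
    by apply: le_trans (hB x Dx) (ler_norm _).
  by have /andP[? ?] := hr x; rewrite ler_norml; apply/andP; split; lra.
have -> : `|B| * c * fine (mu D) = `|B| * w * fine (mu D) / N%:R by rewrite /c; ring.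
by rewrite ler_norml => /andP[_ ?]; lra.
Qed.

(** * Polynomials under a one-dimensional log-concave density *)

(** The rate ln 2 / 5 is the decay rate in [dens_tail]; the constant depends on the exponent only,
    and so does everything built on it. *)
Lemma pow_le_expR (R : realType) (m : nat) : exists2 K : R, 0 < K & forall v : R, 0 <= v ->
  (1 + v) ^+ m <= K * expR (ln 2 / 5 * v).
Proof.
have ln2 : 0 < ln (2 : R) by apply: ln_gt0; rewrite ltr1n.
have ln2' : ln (2 : R) <= 1.
  rewrite (_ : 2 = 1 + 1 :> R); last by lra.
  by apply: le_ln1Dx; lra.
pose c : R := ln 2 / 5; have c0 : 0 < c by rewrite divr_gt0.
have c1 : c <= 1 by rewrite /c; lra.
have m0 : 0 < m.+1%:R :> R by rewrite ltr0n.
exists ((m.+1%:R / c) ^+ m); first by rewrite exprn_gt0// divr_gt0.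
move=> v v0.
have h : 1 + v <= m.+1%:R / c * expR (c * v / m.+1%:R).
  have h1 : 1 + c * v / m.+1%:R <= expR (c * v / m.+1%:R) by apply: expR_ge1Dx.
  apply: le_trans (_ : m.+1%:R / c * (1 + c * v / m.+1%:R) <= _).
    rewrite mulrDr mulr1.
    have -> : m.+1%:R / c * (c * v / m.+1%:R) = v.
      by move: (m.+1%:R) m0 => q q0; field; rewrite (gt_eqF q0) (gt_eqF c0).
    rewrite lerD2r ler_pdivlMr// mul1r (le_trans c1)// ler1n//.
  by rewrite ler_wpM2l// divr_ge0// ltW.
apply: le_trans (_ : (m.+1%:R / c * expR (c * v / m.+1%:R)) ^+ m <= _).
  by rewrite lerXn2r ?nnegrE ?addr_ge0// mulr_ge0 ?expR_ge0// divr_ge0// ltW.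
have p0 : 0 <= (m.+1%:R / c) ^+ m by rewrite exprn_ge0// divr_ge0 ?(ltW m0) ?(ltW c0).
rewrite exprMn (ler_wpM2l p0)//.
rewrite -expRM_natl ler_expR -/c mulrA ler_pdivrMr// mulrC.
have cv0 : 0 <= c * v by exact: mulr_ge0 (ltW c0) v0.
by rewrite (ler_wpM2l cv0)// ler_nat.
Qed.

Lemma bdint_continuous (R : realType) (f : R -> R) (a b : R) : continuous f ->
  bdint (@lebesgue_measure R) `[a, b]%classic f.
Proof.
move=> cf; split=> //.
- exact: lebesgue_itv_lty.
- exact: measurable_comp_continuous.
have [M [_ hM]] : bounded_set (f @` `[a, b]%classic).
  apply: compact_bounded; apply: continuous_compact; last exact: segment_compact.
  by apply: continuous_subspaceT => x; exact: cf.
exists (`|M| + 1) => x xab; apply: hM; last by exists x.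
by rewrite (le_lt_trans (ler_norm _))// ltrDl.
Qed.

Lemma exists_seq_max (R : realType) (f : R -> R) (x0 : R) (s : seq R) :
  exists2 x1, x1 \in x0 :: s & forall x, x \in x0 :: s -> f x <= f x1.
Proof.
elim: s x0 => [|y s IH] x0.
  by exists x0; rewrite ?mem_head// => x; rewrite inE => /eqP ->.
have [x1 x1s h] := IH y.
have [le|le] := leP (f x1) (f x0).
  exists x0; first exact: mem_head.
  move=> x; rewrite in_cons => /orP[/eqP ->//|/h]; move/le_trans; exact.
exists x1; first by rewrite in_cons x1s orbT.
by move=> x; rewrite in_cons => /orP[/eqP ->|/h//]; exact: ltW.
Qed.

(** The natural length scale of a density with maximum w is 1 / w. The nodes are k + 1 equally
    spaced points within that distance of [xs], and [x1] is the node where |Q| is largest. *)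
Lemma poly_growth (R : realType) (Q : {poly R}) (k : nat) (w xs : R) : 0 < w ->
  (size Q <= k.+1)%N -> exists2 x1, `|x1 - xs| <= w^-1 &
  forall x, `|Q.[x]| <= (3 * k.+1%:R) ^+ k * `|Q.[x1]| * (1 + w * `|x - xs|) ^+ k.
Proof.
move=> w0 sQ; pose c := (k.+1%:R * w)^-1.
have k0 : 0 < k.+1%:R :> R by rewrite ltr0n.
have c0 : 0 < c by rewrite invr_gt0 mulr_gt0.
pose nodes := [seq xs + c * i%:R | i <- iota 0 k.+1].
have [x1 x1n hx1] := exists_seq_max (fun x => `|Q.[x]|) (xs + c * 0%:R) [seq xs + c * i%:R | i <- iota 1 k].
have near z : z \in nodes -> `|z - xs| <= w^-1.
  move=> /mapP[i]; rewrite mem_iota add0n => /andP[_ ik] ->.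
  rewrite addrAC subrr add0r ger0_norm ?mulr_ge0// ?(ltW c0)//.
  rewrite /c invfM -mulrA ler_pdivrMl// mulrC ler_wpM2r ?invr_ge0 ?(ltW w0)//.
  by rewrite ler_nat ltnW.
exists x1; first exact: near.
move=> x.
have sn : size nodes = k.+1 by rewrite size_map size_iota.
have pw : pairwise (fun a b => c <= `|a - b|) nodes.
  rewrite pairwise_map.
  have := iota_ltn_sorted 0 k.+1; rewrite sorted_pairwise; last exact: ltn_trans.
  apply: sub_pairwise => i j /= ij; rewrite distrC.
  have -> : xs + c * j%:R - (xs + c * i%:R) = c * (j%:R - i%:R) by ring.
  rewrite normrM (gtr0_norm c0) ler_peMr ?(ltW c0)//.
  by rewrite -natrB ?(ltnW ij)// ger0_norm// ler1n subn_gt0.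
have wi : 0 < w^-1 by rewrite invr_gt0.
have cl : 0 < c <= `|x - xs| + w^-1.
  rewrite c0 /= (@le_trans _ _ w^-1)//; last by rewrite lerDr.
  by rewrite lef_pV2 ?posrE ?mulr_gt0// ler_peMl ?(ltW w0)// ler1n.
have := @newton_bound R k Q nodes c (`|x - xs| + w^-1) `|Q.[x1]| x cl (normr_ge0 _) sQ sn pw.
have -> : 3 * (`|x - xs| + w^-1) / c = 3 * k.+1%:R * (1 + w * `|x - xs|).
  by rewrite /c; move: (k.+1%:R) k0 => q q0; field; rewrite (gt_eqF q0) (gt_eqF w0).
move=> H; apply: le_trans (H _ _) _; last by rewrite exprMn mulrAC.
  by move=> z zn; exact: hx1.
move=> z /near h; apply: le_trans (ler_distD xs _ _) _.
by rewrite lerD2l distrC.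
Qed.

Section LogConcaveDensity.
Context (R : realType) (rho : R -> R) (L w xs : R).
Local Notation leb := (@lebesgue_measure R).
Hypotheses (w0 : 0 < w) (mrho : measurable_fun [set: R] rho)
  (rhow : forall x, 0 <= rho x <= w) (rhoxs : w / 2 <= rho xs)
  (rhoL : forall x, 0 < rho x -> - L <= x <= L)
  (rhoc : forall x y t, 0 < t < 1 -> rho x `^ t * rho y `^ (1 - t) <= rho (t * x + (1 - t) * y))
  (rho1 : \int[leb]_(x in `[- L, L]) rho x = 1).

(** Expectation under [rho]. Its upper bound [w] need not be attained, so [xs] is only a point where
    half of it is reached. *)
Definition dens (f : R -> R) := \int[leb]_(x in `[- L, L]) (f x * rho x).

Lemma dens_xs : - L <= xs <= L.
Proof. by apply: rhoL; apply: lt_le_trans rhoxs; rewrite divr_gt0. Qed.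

Lemma bdint_rho : bdint leb `[- L, L]%classic rho.
Proof.
split=> //; first exact: lebesgue_itv_lty.
by exists w => x _; have /andP[h1 h2] := rhow x; rewrite ger0_norm.
Qed.

Lemma bdint_dens f : bdint leb `[- L, L]%classic f -> bdint leb `[- L, L]%classic (fun x => f x * rho x).
Proof. by move=> bf; apply: bdintM bf bdint_rho. Qed.

Lemma le_dens f g : bdint leb `[- L, L]%classic f -> bdint leb `[- L, L]%classic g ->
  (forall x, - L <= x <= L -> f x <= g x) -> dens f <= dens g.
Proof.
move=> bf bg fg; apply: le_Rint; [exact: bdint_dens|exact: bdint_dens|].
move=> x /=; rewrite in_itv /= => /fg h; have /andP[r0 _] := rhow x.
exact: ler_wpM2r.
Qed.

Lemma densZ c f : bdint leb `[- L, L]%classic f -> dens (fun x => c * f x) = c * dens f.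
Proof.
move=> bf; rewrite /dens -RintZ; last exact: bdint_dens.
by apply: eq_Rintegral => x _; rewrite mulrA.
Qed.

Lemma densD f g : bdint leb `[- L, L]%classic f -> bdint leb `[- L, L]%classic g ->
  dens (fun x => f x + g x) = dens f + dens g.
Proof.
move=> bf bg; rewrite /dens -RintD; [|exact: bdint_dens|exact: bdint_dens].
by apply: eq_Rintegral => x _; rewrite mulrDl.
Qed.

Lemma dens_cst c : dens (fun=> c) = c.
Proof. by rewrite /dens RintZ ?rho1 ?mulr1//; exact: bdint_rho. Qed.

Lemma measurable_level s : measurable [set x | s < rho x].
Proof.
have -> : [set x | s < rho x] = rho @^-1` `]s, +oo[%classic.
  by apply/seteqP; split=> x /=; rewrite in_itv/= andbT.
by rewrite -[X in measurable X]setTI; apply: mrho.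
Qed.

(** Log-concave functions are quasi-concave: a weighted geometric mean of two values is at least
    their minimum. *)
Lemma level_interval s x y z : 0 <= s -> s < rho x -> s < rho y -> x <= z <= y -> s < rho z.
Proof.
move=> s0 sx sy /andP[xz zy].
have [->//|xz'] := eqVneq z x; have [->//|zy'] := eqVneq z y.
have xz2 : x < z by rewrite lt_neqAle eq_sym xz'.
have zy2 : z < y by rewrite lt_neqAle zy'.
have xy : 0 < y - x by lra.
pose t := (y - z) / (y - x).
have t0 : 0 < t by rewrite divr_gt0// subr_gt0.
have t1 : t < 1 by rewrite ltr_pdivrMr// mul1r; lra.
have -> : z = t * x + (1 - t) * y by rewrite /t; field; rewrite gt_eqF.
apply: lt_le_trans (rhoc x y (_ : 0 < t < 1)); last by rewrite t0.
pose m := Num.min (rho x) (rho y).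
have sm : s < m by rewrite lt_min sx.
have m0 : 0 < m by apply: le_lt_trans sm.
apply: (lt_le_trans sm).
have -> : m = m `^ t * m `^ (1 - t).
  by rewrite -powRD ?subrKC ?powRr1 ?(ltW m0)// (gt_eqF m0) implybT.
have t1' : 0 <= 1 - t by rewrite subr_ge0 ltW.
have /andP[rx _] := rhow x; have /andP[ry _] := rhow y.
apply: ler_pM; rewrite ?powR_ge0//.
  by apply: (ge0_ler_powR (ltW t0)); rewrite ?nnegrE ?(ltW m0)// ge_min lexx.
by apply: (ge0_ler_powR t1'); rewrite ?nnegrE ?(ltW m0)// ge_min lexx orbT.
Qed.

(** A level set is an interval, and it differs from the closed interval between its infimum and
    supremum by at most two points. *)
Lemma level_itv s : 0 <= s -> (exists x, s < rho x) -> exists a b, [/\ - L <= a, a <= b, b <= L,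
  forall x, s < rho x -> a <= x <= b &
  forall f, bdint leb `[- L, L]%classic f ->
    \int[leb]_(x in `[- L, L] `&` [set x | s < rho x]) f x = \int[leb]_(x in `[a, b]) f x].
Proof.
move=> s0 [x0 hx0]; pose I := [set x | s < rho x].
have IL x : I x -> - L <= x <= L by move=> /(le_lt_trans s0)/rhoL.
have hs : has_sup I by split; [exists x0|exists L => x /IL /andP[]].
have hi : has_inf I by split; [exists x0|exists (- L) => x /IL /andP[]].
have aI x : I x -> inf I <= x <= sup I.
  by move=> Ix; rewrite ge_inf ?ub_le_sup//; [case: hs|case: hi].
have [la lb] := andP (aI _ hx0).
have aL : - L <= inf I by apply: lb_le_inf; [exists x0|move=> x /IL /andP[]].
have bL : sup I <= L by apply: ge_sup; [exists x0|move=> x /IL /andP[]].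
exists (inf I), (sup I); split=> //; first exact: le_trans lb.
move=> f bf.
have bI : bdint leb `[inf I, sup I]%classic f.
  by apply: bdint_sub bf => // x /=; rewrite !in_itv /= => /andP[? ?]; apply/andP; split; lra.
have := @Rint_ae_sub _ (measurableTypeR R) R leb `[inf I, sup I]%classic I f bI (measurable_level s).
have -> : `[- L, L]%classic `&` I = `[inf I, sup I]%classic `&` I.
  by apply/seteqP; split=> x [_ Ix]; split=> //=; rewrite in_itv /=; [exact: aI|exact: IL].
move=> -> //.
apply/eqP; rewrite eq_le measure_ge0 andbT.
apply: (@le_trans _ _ (leb ([set inf I] `|` [set sup I]))).
  apply: le_measure; rewrite ?inE.
  - by apply: measurableD => //; exact: measurable_level.
  - by apply: measurableU.
  move=> x [/=]; rewrite in_itv /= => /andP[ax xb] nIx.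
  have [->|xa] := eqVneq x (inf I); [by left|have [->|xb'] := eqVneq x (sup I); [by right|]].
  exfalso; apply: nIx.
  have ax' : inf I < x by rewrite lt_neqAle eq_sym xa.
  have xb2 : x < sup I by rewrite lt_neqAle xb'.
  have [u Iu ux] := inf_lt hi.1 ax'; have [v Iv xv] := sup_gt hs.1 xb2.
  by apply: (level_interval s0 Iu Iv); rewrite (ltW ux) (ltW xv).
apply: le_trans (measureU2 _ _ _) _ => //.
by rewrite /= !lebesgue_measure_set1 adde0.
Qed.

Lemma level_mass s a b : 0 < s -> - L <= a -> a <= b -> b <= L ->
  (forall x, a <= x <= b -> s <= rho x) -> s * (b - a) <= 1.
Proof.
move=> s0 aL ab bL h; rewrite -rho1.
have sub : `[a, b]%classic `<=` (`[- L, L]%classic : set R).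
  by move=> x /=; rewrite !in_itv /= => /andP[? ?]; apply/andP; split; lra.
have brho := bdint_rho.
have bab : bdint leb `[a, b]%classic rho by apply: bdint_sub brho.
apply: le_trans (_ : \int[leb]_(x in `[a, b]) rho x <= _).
  rewrite -(fine_lebesgue_itv ab) -Rintegral_cst//; apply: le_Rint => //.
    by apply: bdint_cst => //; exact: lebesgue_itv_lty.
rewrite (@Rint_split _ (measurableTypeR R) R leb `[- L, L]%classic `[a, b]%classic rho (measurable_itv _) brho).
have -> : `[- L, L]%classic `&` `[a, b]%classic = (`[a, b]%classic : set R).
  by apply/seteqP; split=> x; [case|move=> h'; split=> //; exact: sub].
rewrite lerDl; apply: Rintegral_ge0 => x _; by have /andP[] := rhow x.
Qed.

(** The density is cut off at w / 2. All levels that remain contain [xs], so E is only tested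
    against intervals around [xs]; and rho <= 2 min(rho, w / 2) costs the factor 2. *)
Lemma dens_set_le E al be : measurable E -> 0 <= al -> 0 <= be ->
  (forall a b, - L <= a -> b <= L -> a <= xs <= b ->
    fine (leb (E `&` `[a, b]%classic)) <= al * (b - a) + be) ->
  dens (\1_E) <= 2 * al + w * be.
Proof.
move=> mE al0 be0 hE.
pose r x := Num.min (rho x) (w / 2).
have w2 : 0 < w / 2 by rewrite divr_gt0.
have mr : measurable_fun [set: R] r by apply: measurable_minr.
have rw x : 0 <= r x <= w / 2.
  by have /andP[h1 _] := rhow x; rewrite le_min h1 (ltW w2) ge_min lexx orbT.
have b1 : bdint leb `[- L, L]%classic (\1_E : R -> R).
  split=> //; first exact: lebesgue_itv_lty.
  by exists 1 => x _; rewrite indicE; case: (_ \in _); rewrite ?normr1 ?normr0.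
have bc c : bdint leb `[- L, L]%classic (fun=> c).
  by apply: bdint_cst => //; exact: lebesgue_itv_lty.
have br : bdint leb `[- L, L]%classic r.
  split=> //; first exact: lebesgue_itv_lty.
  by exists (w / 2) => x _; have /andP[h1 h2] := rw x; rewrite ger0_norm.
have bpsi : bdint leb `[- L, L]%classic (fun x => \1_E x - al) by exact: bdintB.
have key : \int[leb]_(x in `[- L, L]) ((\1_E x - al) * r x) <= w / 2 * be.
  apply: (layer_cake_le bpsi mr w2 rw) => s /andP[s0 sw].
  have -> : [set x | s < r x] = [set x | s < rho x].
    by apply/seteqP; split=> x /=; rewrite lt_min sw andbT.
  have sxs : s < rho xs by apply: lt_le_trans rhoxs.
  have [a [b [aL ab bL hab ->//]]] := level_itv s0 (ex_intro _ xs sxs).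
  have sub : `[a, b]%classic `<=` (`[- L, L]%classic : set R).
    by move=> x /=; rewrite !in_itv /= => /andP[? ?]; apply/andP; split; lra.
  have bab f : bdint leb `[- L, L]%classic f -> bdint leb `[a, b]%classic f.
    by move=> bf; apply: bdint_sub bf.
  rewrite RintB; [|exact: bab|exact: bab].
  rewrite Rintegral_cst// fine_lebesgue_itv//.
  have -> : \int[leb]_(x in `[a, b]) \1_E x = fine (leb (E `&` `[a, b]%classic)).
    by rewrite /Rintegral integral_indic.
  have := hE a b aL bL (hab xs sxs); lra.
have bEr : bdint leb `[- L, L]%classic (fun x => \1_E x * r x) by exact: bdintM.
have step : \int[leb]_(x in `[- L, L]) (\1_E x * r x) <= al + w / 2 * be.
  have e1 : \int[leb]_(x in `[- L, L]) r x <= 1.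
    rewrite -rho1; apply: le_Rint => //; first exact: bdint_rho.
    by move=> x _; rewrite ge_min lexx.
  have : \int[leb]_(x in `[- L, L]) ((\1_E x - al) * r x) =
      \int[leb]_(x in `[- L, L]) (\1_E x * r x) - al * \int[leb]_(x in `[- L, L]) r x.
    rewrite -RintZ// -RintB//; last exact: bdintZ.
    by apply: eq_Rintegral => x _; rewrite mulrBl.
  move=> E1; rewrite E1 in key.
  have : al * \int[leb]_(x in `[- L, L]) r x <= al * 1 by exact: ler_wpM2l.
  lra.
have -> : 2 * al + w * be = 2 * (al + w / 2 * be) by field.
apply: le_trans (_ : 2 * \int[leb]_(x in `[- L, L]) (\1_E x * r x) <= _); last by rewrite ler_wpM2l.
rewrite -RintZ//; apply: le_Rint; [exact: bdint_dens|exact: bdintZ|].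
move=> x _; rewrite indicE; case: (x \in E); rewrite ?mul0r ?mulr0// !mul1r /r.
have /andP[h1 h2] := rhow x.
by rewrite minEle; case: ifP => _; lra.
Qed.

(** On an interval around [xs], enlarged by at most 1 / w to contain [x1], Remez' inequality
    evaluated at [x1] forces the small set to have length at most 6 (k + 2) tau (b - a + 1 / w).
    With [al] = 6 (k + 2) tau, [dens_set_le] then gives 2 al + al. *)
Lemma dens_small_ball (k : nat) (Q : {poly R}) (x1 tau : R) : (0 < k)%N -> (size Q <= k.+1)%N ->
  `|x1 - xs| <= w^-1 -> 0 < `|Q.[x1]| -> 0 < tau ->
  dens (\1_[set x | `|Q.[x]| <= tau ^+ k * `|Q.[x1]|]) <= 18 * k.+2%:R * tau.
Proof.
move=> k0 sQ x1s S0 tau0; set E := [set x | _].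
have mE : measurable E.
  have -> : E = (fun x => `|Q.[x]|) @^-1` `]-oo, (tau ^+ k * `|Q.[x1]|)]%classic.
    by apply/seteqP; split=> x /=; rewrite in_itv.
  rewrite -[X in measurable X]setTI; apply: (measurableT_comp _ _) => //.
  by apply: measurable_comp_continuous; exact: continuous_horner.
pose al := 6 * k.+2%:R * tau.
have al0 : 0 <= al by rewrite !mulr_ge0// ltW.
have -> : 18 * k.+2%:R * tau = 2 * al + w * (al / w).
  by rewrite /al; move: (k.+2%:R) => q; field; rewrite gt_eqF.
apply: dens_set_le => //; first by rewrite divr_ge0// ltW.
move=> a b aL bL /andP[axs xsb].
set e := fine _.
have mEI : measurable (E `&` `[a, b]%classic) by exact: measurableI.
have fE : leb (E `&` `[a, b]%classic) \is a fin_num.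
  rewrite ge0_fin_numE//; apply: le_lt_trans (lebesgue_itv_lty a b).
  by apply: le_measure; rewrite ?inE.
have [e0|e0] := leP e 0.
  apply: le_trans e0 _; rewrite addr_ge0 ?divr_ge0 ?(ltW w0)// mulr_ge0//; lra.
pose a' := Num.min a x1; pose b' := Num.max b x1.
have a'a : a' <= a by rewrite ge_min lexx.
have a'x : a' <= x1 by rewrite ge_min lexx orbT.
have bb' : b <= b' by rewrite le_max lexx.
have xb' : x1 <= b' by rewrite le_max lexx orbT.
have len : b' - a' <= b - a + w^-1.
  move: x1s; rewrite ler_norml => /andP[h1 h2]; have wi : 0 < w^-1 by rewrite invr_gt0.
  rewrite /a' /b' minEle maxEle; do 2! case: ifP => ?; lra.
have F1 : E `&` `[a, b]%classic `<=` `[a', b']%classic.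
  by move=> x [_ /=]; rewrite !in_itv /= => /andP[? ?]; apply/andP; split; lra.
have F2 : (e%:E <= leb (E `&` `[a, b]%classic))%E by rewrite fineK.
have F3 x : (E `&` `[a, b]%classic) x -> `|Q.[x]| <= tau ^+ k * `|Q.[x1]| by case.
have F4 : a' <= x1 <= b' by rewrite a'x.
have := remez sQ mEI F1 e0 F2 F3 F4.
rewrite mulrA -exprMn ler_pMl// => H.
have {}H : 1 <= 6 * k.+2%:R * (b' - a') / e * tau.
  rewrite leNgt; apply/negP => h; move: H; apply/negP; rewrite -ltNge.
  rewrite exprn_ilt1 -?lt0n//.
  by rewrite mulr_ge0 ?divr_ge0 ?mulr_ge0 ?(ltW tau0) ?(ltW e0)//; lra.
rewrite mulrAC ler_pdivlMr// mul1r in H.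
apply: (le_trans H).
have -> : al * (b - a) + al / w = al * (b - a + w^-1) by ring.
by rewrite mulrAC -/al ler_wpM2l.
Qed.

(** At distance 5 / w from [xs] the density is at most w / 4, for otherwise the segment in between
    would have mass at least 5 / 4. So it has halved there, and log-concavity continues the halving
    at that rate. Nearer to [xs] the bound w suffices, as 2 w times 1 / 2 is w. *)
Lemma dens_tail x : rho x <= 2 * w * expR (- (ln 2 / 5) * (w * `|x - xs|)).
Proof.
have ln2 : 0 < ln (2 : R) by apply: ln_gt0; rewrite ltr1n.
have /andP[rx0 rxw] := rhow x.
set u := w * `|x - xs|.
have u0 : 0 <= u by rewrite mulr_ge0// ltW.
have [u5|u5] := leP u 5.
  apply: (le_trans rxw); rewrite mulrC mulrA ler_peMl ?(ltW w0)//.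
  rewrite -ler_pdivrMr// mul1r -{1}[2]lnK ?posrE// -expRN ler_expR.
  by rewrite mulNr lerN2 -mulrA ger_pMr// mulrC ler_pdivrMr// mul1r.
have [r0|r0] := eqVneq (rho x) 0; first by rewrite r0 !mulr_ge0 ?expR_ge0// ltW.
have {}rx0 : 0 < rho x by rewrite lt_neqAle eq_sym r0.
pose t := 5 / u; have u0' : 0 < u by lra.
have t0 : 0 < t by rewrite divr_gt0.
have t1 : t < 1 by rewrite ltr_pdivrMr// mul1r.
have t01 : 0 < t < 1 by rewrite t0.
pose y := t * x + (1 - t) * xs.
have yx : y - xs = t * (x - xs) by rewrite /y; ring.
have ny : `|y - xs| = 5 / w.
  rewrite yx normrM gtr0_norm// /t /u; field.
  rewrite (gt_eqF w0)/=; apply/eqP => h; move: u0'; rewrite /u h mulr0 ltxx//.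
have rxs0 : 0 < rho xs by apply: lt_le_trans rhoxs; rewrite divr_gt0.
have ry : rho y <= w / 4.
  rewrite leNgt; apply/negP => h.
  have w4 : 0 < w / 4 by rewrite divr_gt0.
  have h2 : w / 4 < rho xs by apply: lt_le_trans rhoxs; lra.
  have yL := rhoL (lt_trans w4 h); have xsL := dens_xs.
  have [yxs|xsy] := leP y xs.
    have : w / 4 * (xs - y) <= 1.
      apply: level_mass => //; [by case/andP: yL|by case/andP: xsL|].
      by move=> z zz; apply/ltW/(level_interval (ltW w4) h h2).
    have -> : xs - y = 5 / w by rewrite -ny ler0_norm; lra.
    have -> : w / 4 * (5 / w) = 5 / 4 by field; rewrite gt_eqF.
    by move=> ?; lra.
  have : w / 4 * (y - xs) <= 1.
    apply: level_mass => //; [by case/andP: xsL|exact: ltW|by case/andP: yL|].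
    by move=> z zz; apply/ltW/(level_interval (ltW w4) h2 h).
  have -> : y - xs = 5 / w by rewrite -ny gtr0_norm; lra.
  have -> : w / 4 * (5 / w) = 5 / 4 by field; rewrite gt_eqF.
  by move=> ?; lra.
have ry2 : rho y <= rho xs / 2.
  by apply: (le_trans ry); have := rhoxs; lra.
have := le_trans (rhoc x xs t01) ry2.
have lnpos : 0 < rho x `^ t * rho xs `^ (1 - t) by rewrite mulr_gt0// powR_gt0.
move=> h; have : ln (rho x `^ t * rho xs `^ (1 - t)) <= ln (rho xs / 2).
  by rewrite ler_ln ?posrE// divr_gt0.
rewrite lnM ?posrE ?powR_gt0// !ln_powR ln_div ?posrE// => H.
have H2 : ln (rho x) - ln (rho xs) <= - (ln 2 / 5) * u.
  have : t * (ln (rho x) - ln (rho xs)) <= - ln 2 by lra.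
  rewrite mulrC -ler_pdivlMr// => /le_trans; apply.
  by rewrite le_eqVlt; apply/orP; left; apply/eqP; rewrite /t; field; rewrite gt_eqF.
have -> : rho x = rho xs * expR (ln (rho x) - ln (rho xs)).
  by rewrite expRD expRN !lnK ?posrE// mulrC divfK// gt_eqF.
apply: ler_pM; rewrite ?expR_ge0 ?ler_expR// ?(ltW rxs0)//.
by have /andP[_ ] := rhow xs; lra.
Qed.

(** The two extra powers in the hypothesis pay for the weight 1 + v^2, which leaves the integral of
    a Cauchy density, computed with the arctangent and at most pi / w. *)
Lemma dens_moment (j : nat) (K : R) :
  (forall v : R, 0 <= v -> (1 + v) ^+ j.+2 <= K * expR (ln 2 / 5 * v)) ->
  dens (fun x => (1 + w * `|x - xs|) ^+ j) <= 2 * K * pi.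
Proof.
move=> hK.
have K0 : 0 <= K.
  by have := hK 0 (lexx _); rewrite addr0 expr1n mulr0 expR0 mulr1; lra.
pose a x := atan (w * (x - xs)) / w.
pose da x := (1 + (w * (x - xs)) ^+ 2)^-1.
have sq x : 0 < 1 + (w * (x - xs)) ^+ 2 by rewrite ltr_pwDl// sqr_ge0.
have dE (x : R) : is_derive x (1 : R) a (da x).
  have h0 : is_derive x 1 (fun x => w * (x - xs)) (w * 1).
    by apply: is_derive_eq; rewrite /GRing.scale /=; ring.
  have h1 : is_derive (w * (x - xs)) 1 atan (1 + (w * (x - xs)) ^+ 2)^-1.
    by apply: DeriveDef; [exact: derivable_atan|rewrite -derive1E derive1_atan].
  have h2 : is_derive x 1 (fun x => atan (w * (x - xs))) ((1 + (w * (x - xs)) ^+ 2)^-1 * (w * 1)).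
    exact: (@is_derive1_comp R atan (fun x => w * (x - xs))).
  apply: is_derive_eq; rewrite /da /GRing.scale /=.
  by field; rewrite (gt_eqF w0) (gt_eqF (sq x)).
have cda : continuous da.
  move=> x; apply: (@continuousV R R (fun x => 1 + (w * (x - xs)) ^+ 2) x); first by rewrite gt_eqF.
  apply: continuousD; first exact: cst_continuous.
  have -> : (fun x => (w * (x - xs)) ^+ 2) = (fun x => (w * (x - xs)) * (w * (x - xs))).
    by apply/funext => z; rewrite expr2.
  have c1 : {for x, continuous (fun x => w * (x - xs))}.
    apply: continuousM; first exact: cst_continuous.
    by apply: continuousB; [exact: cvg_id|exact: cst_continuous].
  exact: continuousM.
have LL : - L <= L by have /andP[] := dens_xs; apply: le_trans.
have I1 : \int[leb]_(x in `[- L, L]) da x <= pi / w.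
  rewrite (@Rint_FTC R a da (- L) L LL (fun x _ => dE x) (fun x _ => cda x)).
  rewrite /a -mulrBl ler_pM2r ?invr_gt0//.
  have := atan_ltpi2 (w * (L - xs)); have := atan_gtNpi2 (w * (- L - xs)); lra.
have cpow : continuous (fun x => (1 + w * `|x - xs|) ^+ j).
  move=> x; apply: (continuous_comp (f := fun x => 1 + w * `|x - xs|) (g := fun y => y ^+ j)).
    apply: continuousD; first exact: cst_continuous.
    apply: continuousM; first exact: cst_continuous.
    apply: (continuous_comp (f := fun x => x - xs) (g := fun y => `|y|)).
      by apply: continuousB; [exact: cvg_id|exact: cst_continuous].
    exact: norm_continuous.
  exact: exprn_continuous.
have bda : bdint leb `[- L, L]%classic da by exact: bdint_continuous.
apply: le_trans (_ : 2 * w * K * \int[leb]_(x in `[- L, L]) da x <= _); last first.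
  have wK : 0 <= 2 * w * K by rewrite !mulr_ge0// ltW.
  apply: le_trans (ler_wpM2l wK I1) _.
  by rewrite le_eqVlt; apply/orP; left; apply/eqP; field; rewrite gt_eqF.
rewrite -RintZ//; apply: le_Rint; [by apply: bdint_dens; exact: bdint_continuous|exact: bdintZ|].
move=> x _; set v := w * `|x - xs|.
have v0 : 0 <= v by rewrite mulr_ge0// ltW.
have E : (w * (x - xs)) ^+ 2 = v ^+ 2.
  by rewrite /v exprMn [RHS]exprMn real_normK ?num_real.
rewrite /da E ler_pdivlMr; last by rewrite ltr_pwDl// sqr_ge0.
have h1 := dens_tail x; rewrite -/v in h1.
have h2 : (1 + v) ^+ j * rho x * (1 + v ^+ 2) <= (1 + v) ^+ j.+2 * rho x.
  have -> : (1 + v) ^+ j.+2 = (1 + v) ^+ j * (1 + v) ^+ 2 by rewrite -exprD addn2.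
  rewrite mulrAC; apply: ler_wpM2r; first by have /andP[] := rhow x.
  apply: ler_wpM2l; first by rewrite exprn_ge0// addr_ge0.
  rewrite !expr2; nra.
apply: le_trans h2 _.
have e0 : 0 < expR (- (ln 2 / 5) * v) by exact: expR_gt0.
have h3 : (1 + v) ^+ j.+2 * expR (- (ln 2 / 5) * v) <= K.
  rewrite mulNr expRN ler_pdivrMr ?expR_gt0//; exact: hK.
apply: le_trans (_ : (1 + v) ^+ j.+2 * (2 * w * expR (- (ln 2 / 5) * v)) <= _).
  by rewrite ler_wpM2l// exprn_ge0// addr_ge0.
rewrite mulrCA; apply: ler_wpM2l => //; first by rewrite mulr_ge0// ltW.
Qed.

Lemma bdint_horner (q : {poly R}) : bdint leb `[- L, L]%classic (horner q).
Proof. by apply: bdint_continuous; exact: continuous_horner. Qed.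

Lemma bdint_norm f : bdint leb `[- L, L]%classic f -> bdint leb `[- L, L]%classic (fun x => `|f x|).
Proof.
move=> [mD Df mf [B hB]]; split=> //; first exact: measurableT_comp.
by exists B => x /hB; rewrite normr_id.
Qed.

Lemma bdint_growth j : bdint leb `[- L, L]%classic (fun x => (1 + w * `|x - xs|) ^+ j).
Proof.
apply: bdint_continuous => x.
apply: (continuous_comp (f := fun x => 1 + w * `|x - xs|) (g := fun y => y ^+ j)).
  apply: continuousD; first exact: cst_continuous.
  apply: continuousM; first exact: cst_continuous.
  apply: (continuous_comp (f := fun x => x - xs) (g := fun y => `|y|)).
    by apply: continuousB; [exact: cvg_id|exact: cst_continuous].
  exact: norm_continuous.
exact: exprn_continuous.
Qed.

(** Both norms are compared with S = |q(x1)|. Growth and moments bound the second moment by a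
    multiple of S^2. For t = 1 / (36 (d + 2)) the set where |q| <= t^d S has mass at most 1/2, so
    the first moment is at least t^d S / 2. *)
Lemma dens_reverse_holder (d : nat) (q : {poly R}) (K : R) : (0 < d)%N -> (size q <= d.+1)%N ->
  (forall v : R, 0 <= v -> (1 + v) ^+ (2 * d).+2 <= K * expR (ln 2 / 5 * v)) ->
  dens (fun x => q.[x] ^+ 2) <=
  ((3 * d.+1%:R) ^+ d) ^+ 2 * (2 * K * pi) * (2 * (36 * d.+2%:R) ^+ d) ^+ 2 *
  (dens (fun x => `|q.[x]|)) ^+ 2.
Proof.
move=> d0 sq hK; have [x1 x1s gr] := poly_growth xs w0 sq.
set G := (3 * d.+1%:R) ^+ d in gr *; set S := `|q.[x1]| in gr.
have G0 : 0 <= G by rewrite exprn_ge0.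
have bq := bdint_horner q.
have bq2 : bdint leb `[- L, L]%classic (fun x => q.[x] ^+ 2).
  by have := bdintM bq bq; congr (bdint _ _); apply/funext => x; rewrite expr2.
have bg := bdint_growth (2 * d).
have hq2 : dens (fun x => q.[x] ^+ 2) <= G ^+ 2 * S ^+ 2 * (2 * K * pi).
  apply: le_trans (_ : dens (fun x => (G ^+ 2 * S ^+ 2) * (1 + w * `|x - xs|) ^+ (2 * d)) <= _).
    apply: le_dens => //; first exact: bdintZ.
    move=> x _; rewrite -(real_normK (num_real q.[x])) mulnC exprM -!exprMn lerXn2r ?nnegrE//.
    by rewrite !mulr_ge0 ?exprn_ge0 ?addr_ge0 ?mulr_ge0 ?(ltW w0) /S.
  rewrite densZ//; apply: ler_wpM2l; last exact: dens_moment.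
  by rewrite mulr_ge0 ?sqr_ge0.
pose t : R := (36 * d.+2%:R)^-1.
have t0 : 0 < t by rewrite invr_gt0 mulr_gt0// ltr0n.
have [S0|S0] := eqVneq S 0.
  apply: (le_trans hq2); rewrite S0 expr0n mulr0 mul0r.
  have K0 : 0 <= K.
    by have := hK 0 (lexx _); rewrite addr0 expr1n mulr0 expR0 mulr1; lra.
  apply: mulr_ge0; last exact: sqr_ge0.
  apply: mulr_ge0; last exact: sqr_ge0.
  apply: mulr_ge0; first exact: sqr_ge0.
  by rewrite !mulr_ge0 ?pi_ge0.
have Sp : 0 < S by rewrite lt_neqAle eq_sym S0 normr_ge0.
have sb := dens_small_ball d0 sq x1s Sp t0; rewrite -/S in sb.
set E := [set x | _] in sb.
have {}sb : dens \1_E <= 2^-1.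
  apply: (le_trans sb); rewrite /t; have : 0 < d.+2%:R :> R by rewrite ltr0n.
  by move: (d.+2%:R) => c c0; rewrite le_eqVlt; apply/orP; left; apply/eqP; field; rewrite gt_eqF.
have mE : measurable E.
  have -> : E = (fun x => `|q.[x]|) @^-1` `]-oo, (t ^+ d * S)]%classic.
    by apply/seteqP; split=> x /=; rewrite in_itv.
  rewrite -[X in measurable X]setTI; apply: (measurableT_comp _ _) => //.
  by apply: measurable_comp_continuous; exact: continuous_horner.
have bE : bdint leb `[- L, L]%classic (\1_E : R -> R).
  split=> //; first exact: lebesgue_itv_lty.
  by exists 1 => x _; rewrite indicE; case: (_ \in _); rewrite ?normr1 ?normr0.
have bc c : bdint leb `[- L, L]%classic (fun=> c).
  by apply: bdint_cst => //; exact: lebesgue_itv_lty.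
have bE1 : bdint leb `[- L, L]%classic (fun x => 1 + -1 * \1_E x).
  by apply: bdintD => //; exact: bdintZ.
have low : t ^+ d * S * 2^-1 <= dens (fun x => `|q.[x]|).
  apply: le_trans (_ : dens (fun x => (t ^+ d * S) * (1 + -1 * \1_E x)) <= _).
    rewrite densZ// densD//; last exact: bdintZ.
    rewrite dens_cst densZ// ler_wpM2l ?mulr_ge0 ?exprn_ge0 ?(ltW t0) ?(ltW Sp)//.
    lra.
  apply: le_dens => //; [exact: bdintZ|exact: bdint_norm|].
  move=> x _; rewrite indicE; have [xE|/negP xE] := boolP (x \in E).
    by rewrite mulr1 subrr mulr0.
  rewrite mulr0 addr0 mulr1 leNgt; apply/negP => h; apply: xE.
  by apply/mem_set; rewrite /E /= ltW.
have tE : (36 * d.+2%:R) ^+ d = (t ^+ d)^-1 :> R by rewrite /t exprVn invrK.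
apply: (le_trans hq2); rewrite tE.
have td : 0 < t ^+ d by rewrite exprn_gt0.
have : S <= 2 * (t ^+ d)^-1 * dens (fun x => `|q.[x]|).
  by rewrite -ler_pdivrMl ?mulr_gt0 ?invr_gt0//; apply: le_trans low; rewrite invfM invrK; lra.
have K0 : 0 <= K.
  by have := hK 0 (lexx _); rewrite addr0 expr1n mulr0 expR0 mulr1; lra.
move=> h; have h2 : S ^+ 2 <= (2 * (t ^+ d)^-1 * dens (fun x => `|q.[x]|)) ^+ 2.
  by rewrite lerXn2r ?nnegrE ?(ltW Sp)// (le_trans (ltW Sp)).
rewrite exprMn in h2.
have c0 : 0 <= G ^+ 2 * (2 * K * pi) by rewrite mulr_ge0 ?sqr_ge0// !mulr_ge0 ?pi_ge0.
by rewrite mulrAC -[leRHS]mulrA; apply: ler_wpM2l c0 _ _ h2.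
Qed.

Lemma dens_sqr_shift (q : {poly R}) (c : R) :
  dens (fun x => q.[x] ^+ 2) - (dens (horner q)) ^+ 2 <= dens (fun x => (q.[x] - c) ^+ 2).
Proof.
have bq := bdint_horner q.
have bq2 : bdint leb `[- L, L]%classic (fun x => q.[x] ^+ 2).
  by have := bdintM bq bq; congr (bdint _ _); apply/funext => x; rewrite expr2.
have bc a : bdint leb `[- L, L]%classic (fun=> a).
  by apply: bdint_cst => //; exact: lebesgue_itv_lty.
have -> : (fun x => (q.[x] - c) ^+ 2) = (fun x => q.[x] ^+ 2 + (-2 * c * q.[x] + c ^+ 2)).
  by apply/funext => x; ring.
rewrite densD//; last by apply: bdintD => //; exact: bdintZ.
rewrite densD//; last exact: bdintZ.
rewrite densZ// dens_cst; have := sqr_ge0 (dens (horner q) - c); rewrite sqrrB; lra.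
Qed.

(** The variance is at most the second moment about q(xs), and the mean value theorem turns the
    growth of q' into that of q - q(xs). *)
Lemma dens_variance_le (k : nat) (q : {poly R}) (K x1 : R) :
  (forall x, `|q^`().[x]| <= (3 * k.+1%:R) ^+ k * `|q^`().[x1]| * (1 + w * `|x - xs|) ^+ k) ->
  (forall v : R, 0 <= v -> (1 + v) ^+ (2 * k.+1).+2 <= K * expR (ln 2 / 5 * v)) ->
  dens (fun x => q.[x] ^+ 2) - (dens (horner q)) ^+ 2 <=
  ((3 * k.+1%:R) ^+ k * `|q^`().[x1]| / w) ^+ 2 * (2 * K * pi).
Proof.
move=> gr hK; apply: le_trans (dens_sqr_shift q q.[xs]) _.
set G := (3 * k.+1%:R) ^+ k * _ in gr *.
have G0 : 0 <= G by rewrite mulr_ge0// exprn_ge0.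
have bd x : `|q.[x] - q.[xs]| <= G / w * (1 + w * `|x - xs|) ^+ k.+1.
  have [c hc E] : exists2 c, `|c - xs| <= `|x - xs| & q.[x] - q.[xs] = q^`().[c] * (x - xs).
    have der (y : R) : is_derive y (1 : R) (horner q) q^`().[y] by exact: is_derive_poly.
    have cont u v : {within `[u, v], continuous (horner q)}.
      by apply: continuous_subspaceT; exact: continuous_horner.
    have [xxs|xxs] := leP xs x.
      have [c + E] := @MVT_segment R (horner q) (fun y => q^`().[y]) xs x xxs (fun y _ => der y) (cont _ _).
      rewrite in_itv /= => /andP[c1 c2]; exists c => //.
      by rewrite !ger0_norm ?subr_ge0// lerD2r.
    have [c + E] := @MVT_segment R (horner q) (fun y => q^`().[y]) x xs (ltW xxs) (fun y _ => der y) (cont _ _).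
    rewrite in_itv /= => /andP[c1 c2]; exists c; last by rewrite -opprB E -mulrN opprB.
    by rewrite distrC (distrC x) !ger0_norm ?subr_ge0// ?(ltW xxs)// lerD2l lerN2.
  rewrite E normrM.
  have v0 : 0 <= w * `|x - xs| by rewrite mulr_ge0// ltW.
  have h1 : `|q^`().[c]| <= G * (1 + w * `|x - xs|) ^+ k.
    apply: le_trans (gr c) _; rewrite ler_wpM2l// lerXn2r ?nnegrE ?addr_ge0// ?mulr_ge0 ?(ltW w0)//.
    by rewrite lerD2l ler_wpM2l// ltW.
  apply: le_trans (ler_wpM2r (normr_ge0 _) h1) _.
  have -> : G / w * (1 + w * `|x - xs|) ^+ k.+1 =
      G * (1 + w * `|x - xs|) ^+ k * ((1 + w * `|x - xs|) / w) by rewrite exprS; ring.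
  rewrite ler_wpM2l ?mulr_ge0 ?exprn_ge0 ?addr_ge0//.
  by rewrite ler_pdivlMr// mulrC lerDr.
have bq := bdint_horner q.
have bd2 : bdint leb `[- L, L]%classic (fun x => (q.[x] - q.[xs]) ^+ 2).
  have b1 : bdint leb `[- L, L]%classic (fun x => q.[x] - q.[xs]).
    by apply: bdintB => //; apply: bdint_cst => //; exact: lebesgue_itv_lty.
  by have := bdintM b1 b1; congr (bdint _ _); apply/funext => x; rewrite expr2.
have bg := bdint_growth (2 * k.+1).
apply: le_trans (_ : dens (fun x => (G / w) ^+ 2 * (1 + w * `|x - xs|) ^+ (2 * k.+1)) <= _).
  apply: le_dens => //; first exact: bdintZ.
  move=> x _; rewrite -(real_normK (num_real (q.[x] - _))) mulnC exprM -exprMn.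
  apply: lerXn2r; rewrite ?nnegrE//.
  by rewrite mulr_ge0 ?divr_ge0 ?(ltW w0)// exprn_ge0// addr_ge0// mulr_ge0// ltW.
rewrite densZ//; apply: ler_wpM2l; [exact: sqr_ge0|exact: dens_moment].
Qed.

(** The bound of [oscillation_bound] is the same on every level interval, so the layer cake formula
    applies to the truncated integrand and contributes the factor w. *)
Lemma dens_oscillation (phi dphi : R -> R) (M e : R) (d : nat) (q : {poly R}) :
  (forall t : R, is_derive t 1 phi (dphi t)) -> continuous dphi ->
  (forall t, `|phi t| <= 1) -> (forall t, `|dphi t| <= M) -> 0 < e -> (size q <= d.+1)%N ->
  dens (fun x => dphi q.[x]) <=
  M * dens (\1_[set x | `|q^`().[x]| <= e]) + w * (2 ^+ (3 * d).+1 * (4 / e)).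
Proof.
move=> dphiE cdphi phi1 dphiM e0 sq.
set E := [set x : R | `|q^`().[x]| <= e].
have mE : measurable E.
  have -> : E = (fun x => `|q^`().[x]|) @^-1` `]-oo, e]%classic.
    by apply/seteqP; split=> x /=; rewrite in_itv.
  rewrite -[X in measurable X]setTI; apply: (measurableT_comp _ _) => //.
  by apply: measurable_comp_continuous; exact: continuous_horner.
have bE : bdint leb `[- L, L]%classic (\1_E : R -> R).
  split=> //; first exact: lebesgue_itv_lty.
  by exists 1 => x _; rewrite indicE; case: (_ \in _); rewrite ?normr1 ?normr0.
have bdq : bdint leb `[- L, L]%classic (fun x => dphi q.[x]).
  split=> //; first exact: lebesgue_itv_lty.
    apply: (measurableT_comp (f := dphi) (g := horner q)); apply: measurable_comp_continuous => //.
    exact: continuous_horner.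
  by exists M.
have bpsi : bdint leb `[- L, L]%classic (fun x => dphi q.[x] - M * \1_E x).
  by apply: bdintB => //; exact: bdintZ.
have K0 : 0 <= 2 ^+ (3 * d).+1 * (4 / e) by rewrite mulr_ge0 ?exprn_ge0// divr_ge0// ltW.
have key : dens (fun x => dphi q.[x] - M * \1_E x) <= w * (2 ^+ (3 * d).+1 * (4 / e)).
  apply: (layer_cake_le bpsi mrho w0 rhow) => s /andP[s0 sw].
  have [[x hx]|nex] := pselect (exists x, s < rho x).
    have [a [b [aL ab bL hab ->//]]] := level_itv s0 (ex_intro _ x hx).
    exact: (oscillation_bound dphiE cdphi phi1 dphiM e0 sq ab).
  rewrite (_ : _ `&` _ = set0) ?Rintegral_set0//.
  by apply/seteqP; split=> // x [_ /= h]; apply: nex; exists x.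
have E1 : dens (fun x => dphi q.[x] - M * \1_E x) = dens (fun x => dphi q.[x]) - M * dens (\1_E).
  have -> : (fun x => dphi q.[x] - M * \1_E x) = (fun x => dphi q.[x] + (- M) * \1_E x).
    by apply/funext => x; rewrite mulNr.
  by rewrite densD ?densZ ?mulNr//; exact: bdintZ.
by rewrite E1 in key; lra.
Qed.

(** The threshold for |q'| is e = tau^k S with S = |q'(x1)|. The set below it has mass of order tau,
    since q' has degree k; the oscillation term is of order w / (tau^k S); and the variance bound
    says that s w / S is bounded by a constant, so the unknown w and S cancel. The inequality is
    multiplied out by tau^k s, which keeps it meaningful when s = 0. *)
Lemma dens_smoothness (phi dphi : R -> R) (M tau K s : R) (k : nat) (q : {poly R}) : (0 < k)%N ->
  (forall t : R, is_derive t 1 phi (dphi t)) -> continuous dphi ->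
  (forall t, `|phi t| <= 1) -> (forall t, `|dphi t| <= M) -> (size q <= k.+2)%N -> 0 < tau ->
  (forall v : R, 0 <= v -> (1 + v) ^+ (2 * k.+1).+2 <= K * expR (ln 2 / 5 * v)) ->
  s = Num.sqrt (dens (fun x => q.[x] ^+ 2) - (dens (horner q)) ^+ 2) ->
  dens (fun x => dphi q.[x]) * tau ^+ k * s <=
  (18 * k.+2%:R) * (M * tau ^+ k.+1 * s) +
  2 ^+ (3 * k.+1).+1 * 4 * ((3 * k.+1%:R) ^+ k * Num.sqrt (2 * K * pi)).
Proof.
move=> k0 dphiE cdphi phi1 dphiM sq tau0 hK sE.
have K0 : 0 <= K.
  by have := hK 0 (lexx _); rewrite addr0 expr1n mulr0 expR0 mulr1; lra.
have M0 : 0 <= M by apply: le_trans (dphiM 0).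
have sdq : (size q^`() <= k.+1)%N.
  have : (size q^`() <= (size q).-1)%N by apply: size_poly.
  by lia.
have [x1 x1s gr] := poly_growth xs w0 sdq.
have V := dens_variance_le gr hK.
set G := (3 * k.+1%:R) ^+ k in gr V *; set S := `|q^`().[x1]| in gr V.
have G0 : 0 <= G by rewrite exprn_ge0.
set H := Num.sqrt (2 * K * pi).
have s0 : 0 <= s by rewrite sE sqrtr_ge0.
have sS : s <= G * S / w * H.
  have GS : 0 <= G * S / w by apply: divr_ge0; [exact: mulr_ge0 G0 (normr_ge0 _)|exact: ltW].
  rewrite sE /H -(ger0_norm GS) -sqrtr_sqr -sqrtrM ?sqr_ge0//.
  exact: ler_wsqrtr.
have rhs0 : 0 <= 18 * k.+2%:R * (M * tau ^+ k.+1 * s).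
  by rewrite !mulr_ge0// exprn_ge0// ltW.
have rhs1 : 0 <= 2 ^+ (3 * k.+1).+1 * 4 * (G * H).
  have H0 : 0 <= H by exact: sqrtr_ge0.
  by apply: mulr_ge0 (mulr_ge0 G0 H0); apply: mulr_ge0 => //; exact: exprn_ge0.
have [S0|S0] := eqVneq S 0.
  have -> : s = 0 by apply/eqP; rewrite eq_le s0 andbT (le_trans sS)// S0 mulr0 !mul0r.
  by rewrite !mulr0 add0r.
have Sp : 0 < S by rewrite lt_neqAle eq_sym S0 normr_ge0.
pose e := tau ^+ k * S.
have e0 : 0 < e by rewrite mulr_gt0// exprn_gt0.
have sq' : (size q <= k.+1.+1)%N by [].
have I1 := dens_oscillation dphiE cdphi phi1 dphiM e0 sq'.
have sb := dens_small_ball k0 sdq x1s Sp tau0; rewrite -/S -/e in sb.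
set I := dens (fun x => dphi q.[x]) in I1 *; set B := dens _ in I1 sb.
have tk : 0 < tau ^+ k by rewrite exprn_gt0.
have I2 : I <= M * (18 * k.+2%:R * tau) + w * (2 ^+ (3 * k.+1).+1 * (4 / e)).
  by apply: (le_trans I1); rewrite lerD2r ler_wpM2l.
have ts : 0 <= tau ^+ k * s by rewrite mulr_ge0// ltW.
rewrite -mulrA; apply: le_trans (ler_wpM2r ts I2) _.
rewrite mulrDl; apply: lerD.
  by rewrite exprS le_eqVlt; apply/orP; left; apply/eqP; ring.
set P := 2 ^+ (3 * k.+1).+1.
have P0 : 0 <= P by rewrite exprn_ge0.
have -> : w * (P * (4 / e)) * (tau ^+ k * s) = P * 4 * (w / S * s).
  rewrite /e; move: (tau ^+ k) tk => tt tt0; field.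
  by rewrite (gt_eqF Sp) (gt_eqF tt0).
apply: ler_wpM2l; first exact: mulr_ge0 P0 (ler0n _ 4).
apply: le_trans (ler_wpM2l _ sS) _; first by rewrite divr_ge0 ?(ltW w0)// ltW.
rewrite le_eqVlt; apply/orP; left; apply/eqP.
by field; rewrite (gt_eqF w0) (gt_eqF Sp).
Qed.

End LogConcaveDensity.

(** * Laws of affine functions *)

Section Smearing.
Context (R : realType) (n : nat) (mu : probability (n.-tuple R) R).
Local Notation T := (n.-tuple R).
Local Notation leb := (@lebesgue_measure R).
Variables (D : set T) (X : T -> R) (B r : R).
Hypotheses (bor : borell mu) (mD : measurable D) (cD : convex_set D) (D0 : 0 < fine (mu D))
  (aX : affine_fun X) (XB : forall x, D x -> `|X x| <= B) (r0 : 0 < r) (r1 : r <= 1).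

Definition slab (s : R) := D `&` [set x | s <= X x <= s + r].
(* The law of X under mu restricted to D, convolved with the uniform law on [-r, 0]. *)
Definition smear (s : R) := fine (mu (slab s)) / (r * fine (mu D)).

Let graph := [set z : T * R | D z.1 /\ z.2 <= X z.1 <= z.2 + r].

Lemma measurable_slab_graph : measurable graph.
Proof.
have [mX _] := aX.
have mX1 : measurable_fun [set: T * R] (fun z => X z.1).
  by apply: (measurableT_comp mX); exact: measurable_fst.
have mset (f : T * R -> R) : measurable_fun setT f -> measurable [set z | 0 <= f z].
  move=> mf; have -> : [set z | 0 <= f z] = f @^-1` `[0, +oo[%classic.
    by apply/seteqP; split=> z /=; rewrite in_itv/= andbT.
  by rewrite -[X in measurable X]setTI; apply: mf.
have -> : graph = (fst @^-1` D) `&` ([set z | 0 <= X z.1 - z.2] `&` [set z | 0 <= z.2 + r - X z.1]).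
  apply/seteqP; split=> [z [Dz /andP[h1 h2]]|z [Dz [h1 h2]]].
    by split=> //; split; rewrite /= subr_ge0.
  by split=> //; apply/andP; split; [move: h1|move: h2]; rewrite /= subr_ge0.
apply: measurableI; first by rewrite -[X in measurable X]setTI; exact: measurable_fst.
apply: measurableI; apply: mset.
  by apply: measurable_funB => //; exact: measurable_snd.
apply: measurable_funB => //; apply: measurable_funD => //; exact: measurable_snd.
Qed.

Lemma slab_ysection s : ysection graph s = slab s.
Proof. by apply/seteqP; split=> x; rewrite /ysection /= inE. Qed.

Lemma measurable_slab s : measurable (slab s).
Proof. by rewrite -slab_ysection; apply: measurable_ysection; exact: measurable_slab_graph. Qed.

(** The slabs are the sections of one measurable subset of the product, so their mass is measurable
    in the parameter. *)
Lemma measurable_slab_mass : measurable_fun [set: R] (fun s => fine (mu (slab s))).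
Proof.
have -> : (fun s => fine (mu (slab s))) = fine \o (mu \o ysection graph).
  by apply/funext => s /=; rewrite slab_ysection.
apply: measurableT_comp => //.
exact: (@measurable_fun_ysection _ _ T (measurableTypeR R) R mu graph measurable_slab_graph).
Qed.

Lemma rD0 : 0 < r * fine (mu D). Proof. exact: mulr_gt0. Qed.

Lemma measurable_smear : measurable_fun [set: R] smear.
Proof. by apply: measurable_funM => //; exact: measurable_slab_mass. Qed.

Lemma smear_ge0 s : 0 <= smear s.
Proof. by rewrite divr_ge0 ?fine_ge0// ltW// rD0. Qed.

Lemma smear_le s : smear s <= r^-1.
Proof.
rewrite ler_pdivrMr ?rD0// mulrA mulVf ?gt_eqF// mul1r.
have h := measurable_slab s.
apply: fine_le; rewrite ?fin_num_measure//.
by apply: le_measure; rewrite ?inE//; exact: subIsetl.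
Qed.

Lemma smear_support s : 0 < smear s -> - (B + 1) <= s <= B + 1.
Proof.
rewrite /smear => h.
have [[x [Dx /= /andP[h1 h2]]]|nex] := pselect (exists x, slab s x).
  have h5 := r1; have := XB Dx; rewrite ler_norml => /andP[h3 h4]; apply/andP; split; lra.
have E : slab s = set0 by apply/seteqP; split=> // x sx; apply: nex; exists x.
by move: h; rewrite E measure0 mul0r ltxx.
Qed.

(** Convex combinations of points of two slabs lie in the slab at the combined parameter, so this is
    Borell's inequality; the normalising factor cancels because the exponents add up to 1. *)
Lemma smear_log_concave x y t : 0 < t < 1 ->
  smear x `^ t * smear y `^ (1 - t) <= smear (t * x + (1 - t) * y).
Proof.
move=> t01; have /andP[t0 t1] := t01.
have [mX hX] := aX.
have c0 : 0 <= (r * fine (mu D))^-1 by rewrite invr_ge0 ltW// rD0.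
rewrite /smear !powRM ?fine_ge0// mulrACA.
have -> : ((r * fine (mu D))^-1) `^ t * ((r * fine (mu D))^-1) `^ (1 - t) = (r * fine (mu D))^-1.
  rewrite -powRD; last by apply/implyP => _; rewrite invr_neq0// gt_eqF// rD0.
  by rewrite subrKC powRr1.
rewrite ler_wpM2r//.
apply: bor => //; try exact: measurable_slab.
move=> a b [Da /= /andP[a1 a2]] [Db /= /andP[b1 b2]]; split; first exact: cD.
rewrite /= hX; apply/andP; split.
  apply: lerD; apply: ler_wpM2l => //; [exact: ltW|lra].
have -> : t * x + (1 - t) * y + r = t * (x + r) + (1 - t) * (y + r) by ring.
apply: lerD; apply: ler_wpM2l => //; [exact: ltW|lra].
Qed.

Lemma itv_shift_sub x : D x -> `[X x - r, X x]%classic `<=` `[- (B + 1), B + 1]%classic.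
Proof.
move=> Dx s /=; rewrite !in_itv/= => /andP[h1 h2].
have h5 := r1; have := XB Dx; rewrite ler_norml => /andP[h3 h4]; apply/andP; split; lra.
Qed.

(** Exchanging integrals, the integral of psi(s) times the mass of the slab at s becomes the
    integral over D of psi integrated over [X - r, X], and the inner integral is within r e of r
    psi(X). *)
Lemma smear_tonelli (psi : R -> R) (C e : R) : measurable_fun [set: R] psi ->
  (forall s, 0 <= psi s) -> (forall s, `|s| <= B + 1 -> psi s <= C) ->
  (forall s t, `|s| <= B + 1 -> `|t| <= B + 1 -> `|s - t| <= r -> `|psi s - psi t| <= e) ->
  `|\int[leb]_(s in `[- (B + 1), B + 1]) (psi s * smear s) - avg mu D (psi \o X)| <= e.
Proof.
move=> mpsi psi0 psiC psie.
have [mX _] := aX.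
set I := `[- (B + 1), B + 1]%classic.
have IE s : I s -> `|s| <= B + 1 by rewrite /I /= in_itv/= ler_norml.
pose f (z : T * R) : \bar R := (psi z.2 * \1_graph z)%:E.
have f0 z : (0 <= f z)%E by rewrite lee_fin mulr_ge0.
have mf : measurable_fun setT f.
  apply/measurable_EFinP; apply: measurable_funM.
    by apply: (measurableT_comp mpsi); exact: measurable_snd.
  by apply: measurable_indic; exact: measurable_slab_graph.
have bpsi (A : set R) : measurable A -> A `<=` I -> bdint leb A psi.
  move=> mA AI; apply: (@bdint_sub _ (measurableTypeR R) R leb I) => //.
  split=> //; [exact: measurable_itv|exact: lebesgue_itv_lty|].
  by exists C => s /IE hs; rewrite ger0_norm// psiC.
pose j x := \int[leb]_(s in `[X x - r, X x]) psi s.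
have FE x : (\int[leb]_s f (x, s) = if x \in D then (j x)%:E else 0)%E.
  case: ifPn => [/set_mem Dx|nDx].
    have bj := bpsi _ (measurable_itv _) (itv_shift_sub Dx).
    rewrite /j /Rintegral fineK; last first.
      by apply: integrable_fin_num => //; exact: (bdint_integrable bj).
    rewrite [RHS]integral_mkcond; apply: eq_integral => s _; rewrite /f patchE indicE.
    have -> : ((x, s) \in graph) = (s \in `[X x - r, X x]%classic).
      apply/idP/idP; rewrite !inE /= in_itv/=.
        by move=> [_ /= /andP[h1 h2]]; apply/andP; split; lra.
      by move=> /andP[h1 h2]; split=> //=; apply/andP; split; lra.
    by case: ifP => _; rewrite ?mulr1// mulr0.
  rewrite integral0_eq// => s _; rewrite /f indicE memNset ?mulr0//.
  by move=> [/= Dx _]; move/negP: nDx; apply; exact: mem_set.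
have GE s : (\int[mu]_x f (x, s) = (psi s * fine (mu (slab s)))%:E)%E.
  have -> : (fun x => f (x, s)) = (fun x => (psi s)%:E * (\1_(slab s) x)%:E)%E.
    apply/funext => x; rewrite /f EFinM /=; congr (_ * _%:E)%E.
  rewrite ge0_integralZl ?lee_fin//; last first.
    by apply/measurable_EFinP; apply: measurable_indic; exact: measurable_slab.
  rewrite integral_indic ?setIT//; last exact: measurable_slab.
  by rewrite EFinM fineK// fin_num_measure//; exact: measurable_slab.
have := @fubini_tonelli _ _ T (measurableTypeR R) R mu leb f mf f0.
have mF := @measurable_fun_fubini_tonelli_F _ _ T (measurableTypeR R) R leb f mf f0.
under eq_integral do rewrite FE.
under [RHS]eq_integral do rewrite GE.
(* Tonelli's theorem provides the measurability of this version; it agrees with [j] on D. *)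
pose jf x := fine (\int[leb]_s f (x, s))%E.
have mjf : measurable_fun setT jf by apply: measurableT_comp.
have jfE x : D x -> jf x = j x by move=> Dx; rewrite /jf FE mem_set.
have -> : (\int[mu]_x (if x \in D then (j x)%:E else 0) = \int[mu]_(x in D) (jf x)%:E)%E.
  rewrite [RHS]integral_mkcond; apply: eq_integral => x _; rewrite patchE.
  by case: ifPn => // /set_mem Dx; rewrite jfE.
have -> : (\int[leb]_s (psi s * fine (mu (slab s)))%:E = \int[leb]_(s in I) (psi s * fine (mu (slab s)))%:E)%E.
  rewrite [RHS]integral_mkcond; apply: eq_integral => s _; rewrite patchE.
  case: ifPn => // sI; have [s0|s0] := leP (smear s) 0.
    have -> : fine (mu (slab s)) = 0; last by rewrite mulr0.
    apply/eqP; rewrite eq_le fine_ge0// andbT.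
    by move: s0; rewrite /smear ler_pdivrMr ?mul0r// rD0.
  by move: sI; rewrite mem_set// /I /= in_itv/=; exact: smear_support.
move=> /(congr1 fine); rewrite -/(Rintegral _ _ _) -/(Rintegral _ _ _) => E.
have muD1 : (mu D < +oo)%E by exact: mu_lty.
have le1 x : D x -> `|jf x - r * psi (X x)| <= r * e.
  move=> Dx; rewrite jfE// /j.
  have bj := bpsi _ (measurable_itv _) (itv_shift_sub Dx); have r0' := r0.
  have lI : fine (leb `[X x - r, X x]%classic) = r.
    rewrite fine_lebesgue_itv; [ring|lra].
  have blty : (leb `[(X x - r)%R, X x]%classic < +oo)%E by exact: lebesgue_itv_lty.
  have -> : r * psi (X x) = \int[leb]_(s in `[X x - r, X x]) (psi (X x)).
    by rewrite Rintegral_cst// lI mulrC.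
  rewrite -(@RintB _ (measurableTypeR R) R leb)//; last exact: bdint_cst.
  rewrite -[X in _ <= X * _]lI mulrC.
  apply: (@le_norm_Rint _ (measurableTypeR R) R leb).
    by apply: bdintB => //; exact: bdint_cst.
  move=> s sI; have := itv_shift_sub Dx sI; move: sI.
  rewrite /= !in_itv/= => /andP[h1 h2] h3.
  apply: psie; [by rewrite ler_norml| |].
    by apply: le_trans (XB Dx) _; rewrite lerDl.
  rewrite ler_norml; apply/andP; split; lra.
have XC x : D x -> `|psi (X x)| <= C.
  by move=> Dx; rewrite ger0_norm// psiC// (le_trans (XB Dx))// lerDl.
have bX : bdint mu D (psi \o X) by split=> //; [exact: measurableT_comp|exists C].
have bX' : bdint mu D (fun x => r * psi (X x)) by exact: bdintZ bX.
have bj : bdint mu D jf.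
  split=> //; exists (r * e + r * C) => x Dx.
  have h1 := le1 x Dx; have h2 := XC x Dx.
  have := ler_normD (jf x - r * psi (X x)) (r * psi (X x)); rewrite subrK normrM (gtr0_norm r0).
  have := ler_wpM2l (ltW r0) h2; lra.
have bd : bdint mu D (fun x => jf x - r * psi (X x)) by exact: bdintB.
have := le_norm_Rint bd le1; rewrite RintB// E RintZ//.
have -> : \int[leb]_(s in I) (psi s * fine (mu (slab s))) =
    r * fine (mu D) * \int[leb]_(s in I) (psi s * smear s).
  rewrite -RintZ; last first.
    apply: (@bdintM _ (measurableTypeR R) R leb); first by apply: bpsi; [exact: measurable_itv|].
    split=> //; [exact: measurable_itv|exact: lebesgue_itv_lty|exact: measurable_smear|].
    by exists r^-1 => s _; rewrite ger0_norm ?smear_ge0// smear_le.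
  apply: eq_Rintegral => s _; rewrite /smear mulrCA; congr (_ * _).
  by rewrite mulrC divfK// gt_eqF// rD0.
rewrite /avg; set Y := \int[leb]_(s in I) _; set Z := \int[mu]_(x in D) _.
have -> : r * fine (mu D) * Y - r * Z = (r * fine (mu D)) * (Y - Z / fine (mu D)).
  by field; rewrite gt_eqF.
rewrite normrM (gtr0_norm rD0) -[r * e * _]mulrA (mulrC e) mulrA.
by rewrite ler_pM2l// rD0.
Qed.

Lemma smear_mass1 : \int[leb]_(s in `[- (B + 1), B + 1]) smear s = 1.
Proof.
have := @smear_tonelli (fun=> 1) 1 0 (@measurable_cst _ _ _ _ _ _).
have -> : (fun s => 1 * smear s) = smear by apply/funext => s; rewrite mul1r.
have -> : avg mu D ((fun=> 1) \o X) = 1.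
  rewrite /avg (_ : (fun=> 1) \o X = fun=> 1)//.
  by rewrite Rintegral_cst//= ?mul1r ?divff ?gt_eqF//; exact: mu_lty.
have h (s t : R) : `|s| <= B + 1 -> `|t| <= B + 1 -> `|s - t| <= r -> `|1 - 1 : R| <= 0.
  by move=> *; rewrite subrr normr0.
move=> /(_ (fun=> ler01) (fun _ _ => lexx _) h).
by rewrite normr_le0 subr_eq0 => /eqP.
Qed.

Lemma bdint_smear : bdint leb `[- (B + 1), B + 1]%classic smear.
Proof.
split; [exact: measurable_itv|exact: lebesgue_itv_lty|exact: measurable_smear|].
by exists r^-1 => s _; rewrite ger0_norm ?smear_ge0// smear_le.
Qed.

(** Adding C makes [psi] nonnegative on the interval, and the maximum with 0 does so elsewhere. The
    constant drops out on both sides because the smeared law has mass exactly 1. *)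
Lemma smear_approx (psi : R -> R) (C e : R) : measurable_fun [set: R] psi ->
  (forall s, `|s| <= B + 1 -> `|psi s| <= C) ->
  (forall s t, `|s| <= B + 1 -> `|t| <= B + 1 -> `|s - t| <= r -> `|psi s - psi t| <= e) ->
  `|\int[leb]_(s in `[- (B + 1), B + 1]) (psi s * smear s) - avg mu D (psi \o X)| <= e.
Proof.
move=> mpsi psiC psie; have [mX _] := aX.
set I := `[- (B + 1), B + 1]%classic.
have IE s : I s -> `|s| <= B + 1 by rewrite /I /= in_itv/= ler_norml.
pose psi1 s := Num.max (psi s + C) 0.
have psi1E s : `|s| <= B + 1 -> psi1 s = psi s + C.
  by move=> /psiC; rewrite ler_norml => /andP[h _]; apply/max_idPl; lra.
have mpsi1 : measurable_fun [set: R] psi1.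
  by apply: measurable_maxr => //; exact: measurable_funD.
have h1 s : 0 <= psi1 s by rewrite le_max lexx orbT.
have h2 s : `|s| <= B + 1 -> psi1 s <= C + C.
  by move=> hs; rewrite psi1E// lerD2r; apply: le_trans (psiC s hs); exact: ler_norm.
have h3 s t : `|s| <= B + 1 -> `|t| <= B + 1 -> `|s - t| <= r -> `|psi1 s - psi1 t| <= e.
  by move=> hs ht hst; rewrite !psi1E// opprD addrACA subrr addr0 psie.
have := smear_tonelli mpsi1 h1 h2 h3.
have bpsi : bdint leb I psi.
  split; [exact: measurable_itv|exact: lebesgue_itv_lty|by []|].
  by exists C => s /IE; exact: psiC.
have bs := bdint_smear.
have bps : bdint leb I (fun s => psi s * smear s) by exact: (@bdintM _ (measurableTypeR R) R leb).
have bCs : bdint leb I (fun s => C * smear s) by exact: (@bdintZ _ (measurableTypeR R) R leb).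
have -> : \int[leb]_(s in I) (psi1 s * smear s) = \int[leb]_(s in I) (psi s * smear s) + C.
  rewrite -[C in RHS]mulr1 -smear_mass1 -(@RintZ _ (measurableTypeR R) R leb)//.
  rewrite -(@RintD _ (measurableTypeR R) R leb)//.
  by apply: eq_Rintegral => s /set_mem /IE hs; rewrite psi1E// mulrDl.
have XL x : D x -> `|X x| <= B + 1 by move=> /XB h; apply: le_trans h _; rewrite lerDl.
have -> : avg mu D (psi1 \o X) = avg mu D (psi \o X) + C.
  have bX : bdint mu D (psi \o X).
    split=> //; [exact: mu_lty|exact: measurableT_comp|].
    by exists C => x Dx /=; rewrite psiC// XL.
  have bC : bdint mu D (fun=> C) by apply: bdint_cst => //; exact: mu_lty.
  rewrite /avg (_ : \int[mu]_(x in D) _ = \int[mu]_(x in D) ((psi \o X) x + C)); last first.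
    by apply: eq_Rintegral => x /set_mem /XL hx /=; rewrite psi1E.
  rewrite RintD// Rintegral_cst//.
  by rewrite mulrDl mulfK ?gt_eqF.
by rewrite opprD addrACA subrr addr0.
Qed.

Lemma smear_peak : exists w xs,
  [/\ 0 < w, forall x, 0 <= smear x <= w & w / 2 <= smear xs].
Proof.
have sE : has_sup (range smear).
  by split; [exists (smear 0), 0|exists r^-1 => _ [s _ <-]; exact: smear_le].
pose w := sup (range smear).
have hw x : 0 <= smear x <= w.
  by rewrite smear_ge0/=; apply: sup_upper_bound => //; exists x.
have w0 : 0 < w.
  rewrite ltNge; apply/negP => w0.
  have s0 x : smear x = 0 by have /andP[h1 h2] := hw x; apply/eqP; rewrite eq_le h1 (le_trans h2).
  have := smear_mass1; rewrite (_ : smear = fun=> 0); last by apply/funext => x; exact: s0.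
  by rewrite Rintegral_cst ?mul0r// => /eqP; rewrite eq_sym oner_eq0.
have w2 : 0 < w / 2 by rewrite divr_gt0.
have [_ [xs _ <-] h] := sup_adherent w2 sE.
exists w, xs; split=> //; apply: ltW; apply: le_lt_trans h; rewrite -/w; lra.
Qed.

End Smearing.

(** * Closure properties of test functions *)

Lemma test_fun_lipschitz (R : realType) (f : R -> R) (K : R) : measurable_fun [set: R] f ->
  (forall x y, `|f x - f y| <= K * `|x - y|) -> test_fun f.
Proof.
move=> mf fK; have fK' x y : `|f x - f y| <= (`|K| + 1) * `|x - y|.
  apply: le_trans (fK x y) _; apply: ler_wpM2r => //.
  by apply: le_trans (ler_norm _) _; rewrite lerDl.
have K0 : 0 < `|K| + 1 by rewrite ltr_wpDl.
split=> // [B e e0|B].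
  exists (e / (`|K| + 1)); first by rewrite divr_gt0.
  move=> x y _ _ xy; apply: le_trans (fK' x y) _.
  by rewrite mulrC -ler_pdivlMr.
exists (`|f 0| + (`|K| + 1) * B) => x xB.
have h := ler_normD (f 0) (f x - f 0); rewrite subrKC in h.
apply: le_trans h _; rewrite lerD2l; apply: le_trans (fK' x 0) _.
by rewrite subr0 ler_wpM2l// ltW.
Qed.

Lemma test_funD (R : realType) (f g : R -> R) : test_fun f -> test_fun g ->
  test_fun (fun x => f x + g x).
Proof.
move=> [mf uf bf] [mg ug bg]; split; first exact: measurable_funD.
  move=> B e e0; have e2 : 0 < e / 2 by rewrite divr_gt0.
  have [d1 d10 h1] := uf B _ e2; have [d2 d20 h2] := ug B _ e2.
  exists (Num.min d1 d2); first by rewrite lt_min d10.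
  move=> x y hx hy; rewrite le_min => /andP[xy1 xy2].
  have := h1 x y hx hy xy1; have := h2 x y hx hy xy2.
  have -> : f x + g x - (f y + g y) = (f x - f y) + (g x - g y) by ring.
  by have := ler_normD (f x - f y) (g x - g y); lra.
move=> B; have [C1 h1] := bf B; have [C2 h2] := bg B; exists (C1 + C2) => x hx.
by apply: le_trans (ler_normD _ _) _; apply: lerD; [exact: h1|exact: h2].
Qed.

Lemma test_funM (R : realType) (f g : R -> R) : test_fun f -> test_fun g ->
  test_fun (fun x => f x * g x).
Proof.
move=> [mf uf bf] [mg ug bg]; split; first exact: measurable_funM.
  move=> B e e0; have [C1 h1] := bf B; have [C2 h2] := bg B.
  pose C := `|C1| + `|C2| + 1.
  have C0 : 0 < C by rewrite ltr_wpDl// addr_ge0.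
  have e2 : 0 < e / (2 * C) by rewrite divr_gt0// mulr_gt0.
  have [d1 d10 h3] := uf B _ e2; have [d2 d20 h4] := ug B _ e2.
  exists (Num.min d1 d2); first by rewrite lt_min d10.
  move=> x y hx hy; rewrite le_min => /andP[xy1 xy2].
  have h5 := h3 x y hx hy xy1; have h6 := h4 x y hx hy xy2.
  have -> : f x * g x - f y * g y = f x * (g x - g y) + (f x - f y) * g y by ring.
  have h7 : `|f x| <= C.
    by apply: le_trans (h1 x hx) _; apply: le_trans (ler_norm _) _; rewrite /C -addrA lerDl addr_ge0.
  have h8 : `|g y| <= C.
    apply: le_trans (h2 y hy) _; apply: le_trans (ler_norm _) _.
    by rewrite /C [`|C1| + _]addrC -addrA lerDl addr_ge0.
  apply: le_trans (ler_normD _ _) _; rewrite !normrM.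
  have -> : e = C * (e / (2 * C)) + (e / (2 * C)) * C by field; rewrite gt_eqF.
  by apply: lerD; apply: ler_pM.
move=> B; have [C1 h1] := bf B; have [C2 h2] := bg B; exists (C1 * C2) => x hx.
by rewrite normrM; apply: ler_pM => //; [exact: h1|exact: h2].
Qed.

Lemma test_fun_comp (R : realType) (f g : R -> R) : test_fun f -> test_fun g -> test_fun (f \o g).
Proof.
move=> [mf uf bf] [mg ug bg]; split; first exact: measurableT_comp.
  move=> B e e0; have [C hC] := bg B.
  have [d1 d10 h1] := uf C e e0; have [d2 d20 h2] := ug B _ d10.
  by exists d2 => // x y hx hy xy; apply: h1; [exact: hC|exact: hC|exact: h2].
by move=> B; have [C hC] := bg B; have [C' hC'] := bf C; exists C' => x /hC /hC'.
Qed.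

Lemma test_fun_cst (R : realType) (c : R) : test_fun (fun=> c).
Proof. by apply: (@test_fun_lipschitz _ _ 0) => // x y; rewrite subrr normr0 mul0r. Qed.

Lemma test_fun_id (R : realType) : test_fun (@id R).
Proof. by apply: (@test_fun_lipschitz _ _ 1) => // x y; rewrite mul1r. Qed.

Lemma test_fun_norm (R : realType) : test_fun (@Num.norm R R).
Proof. by apply: (@test_fun_lipschitz _ _ 1) => // x y; rewrite mul1r ler_dist_dist. Qed.

Lemma test_fun_horner (R : realType) (q : {poly R}) : test_fun (horner q).
Proof.
elim/poly_ind: q => [|p c IH].
  by have := test_fun_cst (0 : R); congr test_fun; apply/funext => x; rewrite horner0.
have -> : horner (p * 'X + c%:P) = fun x => p.[x] * x + c.
  by apply/funext => x; rewrite hornerMXaddC.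
by apply: test_funD; [apply: test_funM => //; exact: test_fun_id|exact: test_fun_cst].
Qed.

Lemma cvg_sqr (R : realType) (u : nat -> R) (l : R) : u k @[k --> \oo] --> l ->
  u k ^+ 2 @[k --> \oo] --> l ^+ 2.
Proof.
move=> ul; rewrite expr2 (_ : (fun k => _) = (fun k => u k * u k)); first exact: cvgM.
by apply/funext => k; rewrite expr2.
Qed.

(** * One-dimensional inequalities for the law itself, as the window shrinks to a point *)

Section Needle.
Context (R : realType) (n : nat) (mu : probability (n.-tuple R) R).
Local Notation T := (n.-tuple R).
Local Notation leb := (@lebesgue_measure R).
Variables (D : set T) (X : T -> R) (B : R).
Hypotheses (bor : borell mu) (mD : measurable D) (cD : convex_set D) (D0 : 0 < fine (mu D))
  (aX : affine_fun X) (XB : forall x, D x -> `|X x| <= B).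

Lemma smear_cvg (psi : R -> R) : test_fun psi ->
  dens (smear mu D X k.+1%:R^-1) (B + 1) psi @[k --> \oo] --> avg mu D (psi \o X).
Proof.
move=> [mpsi upsi bpsi]; apply/cvgrPdist_le => e e0.
have [dl dl0 hdl] := upsi (B + 1) e e0; have [C hC] := bpsi (B + 1).
have [N hN] : exists N : nat, forall k, (N <= k)%N -> k.+1%:R^-1 <= dl.
  exists (Num.truncn dl^-1) => k Nk.
  rewrite -[dl]invrK lef_pV2 ?posrE ?invr_gt0//.
  apply: ltW; apply: lt_le_trans (truncnS_gt _) _.
  by rewrite ler_nat.
exists N => // k Nk /=; rewrite distrC.
have r0 : 0 < k.+1%:R^-1 :> R by rewrite invr_gt0.
have r1 : k.+1%:R^-1 <= 1 :> R by rewrite invf_le1 ?ler1n.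
rewrite /dens; apply: smear_approx; try eassumption.
move=> s t hs ht hst; apply: hdl => //; exact: le_trans hst (hN k Nk).
Qed.

Lemma needle_reverse_holder (d : nat) (q : {poly R}) (K : R) : (0 < d)%N -> (size q <= d.+1)%N ->
  (forall v : R, 0 <= v -> (1 + v) ^+ (2 * d).+2 <= K * expR (ln 2 / 5 * v)) ->
  avg mu D (fun x => q.[X x] ^+ 2) <=
  ((3 * d.+1%:R) ^+ d) ^+ 2 * (2 * K * pi) * (2 * (36 * d.+2%:R) ^+ d) ^+ 2 *
  (avg mu D (fun x => `|q.[X x]|)) ^+ 2.
Proof.
move=> d0 sq hK; have tq := test_fun_horner q.
have c1 : dens (smear mu D X k.+1%:R^-1) (B + 1) (fun x => q.[x] ^+ 2) @[k --> \oo] -->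
    avg mu D (fun x => q.[X x] ^+ 2).
  apply: smear_cvg; have := test_funM tq tq.
  by congr test_fun; apply/funext => x; rewrite expr2.
have c2 : dens (smear mu D X k.+1%:R^-1) (B + 1) (fun x => `|q.[x]|) @[k --> \oo] -->
    avg mu D (fun x => `|q.[X x]|).
  by apply: smear_cvg; apply: test_fun_comp tq; exact: test_fun_norm.
set A := ((3 * d.+1%:R) ^+ d) ^+ 2 * _ * _.
have c3 : A * dens (smear mu D X k.+1%:R^-1) (B + 1) (fun x => `|q.[x]|) ^+ 2 @[k --> \oo] -->
    A * (avg mu D (fun x => `|q.[X x]|)) ^+ 2.
  apply: cvgM; first exact: cvg_cst.
  exact: cvg_sqr.
apply: (ler_cvg_to c1 c3); apply: nearW => k.
have r0 : 0 < k.+1%:R^-1 :> R by rewrite invr_gt0.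
have r1 : k.+1%:R^-1 <= 1 :> R by rewrite invf_le1 ?ler1n.
have [w [xs [w0 hw hxs]]] : exists w xs, [/\ 0 < w,
    forall x, 0 <= smear mu D X k.+1%:R^-1 x <= w & w / 2 <= smear mu D X k.+1%:R^-1 xs].
  by apply: smear_peak; eassumption.
apply: (@dens_reverse_holder R _ (B + 1) w xs) => //.
- by apply: measurable_smear.
- by move=> x; apply: smear_support.
- by move=> x y t; apply: smear_log_concave.
- by apply: smear_mass1.
Qed.

(** All terms are continuous in the averages of q, q^2 and phi'(q), so the inequality for the
    smeared densities passes to the limit; a form divided by [s] would not do so when the limit of
    the standard deviations is 0. *)
Lemma needle_smoothness (phi dphi : R -> R) (M tau K s : R) (k : nat) (q : {poly R}) : (0 < k)%N ->
  (forall t : R, is_derive t 1 phi (dphi t)) -> continuous dphi -> test_fun dphi ->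
  (forall t, `|phi t| <= 1) -> (forall t, `|dphi t| <= M) -> (size q <= k.+2)%N -> 0 < tau ->
  (forall v : R, 0 <= v -> (1 + v) ^+ (2 * k.+1).+2 <= K * expR (ln 2 / 5 * v)) ->
  s = Num.sqrt (avg mu D (fun x => q.[X x] ^+ 2) - (avg mu D (fun x => q.[X x])) ^+ 2) ->
  avg mu D (fun x => dphi q.[X x]) * tau ^+ k * s <=
  (18 * k.+2%:R) * (M * tau ^+ k.+1 * s) +
  2 ^+ (3 * k.+1).+1 * 4 * ((3 * k.+1%:R) ^+ k * Num.sqrt (2 * K * pi)).
Proof.
move=> k0 dphiE cdphi tdphi phi1 dphiM sq tau0 hK sE; have tq := test_fun_horner q.
pose de k := dens (smear mu D X k.+1%:R^-1) (B + 1).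
have c1 : de k (fun x => q.[x] ^+ 2) @[k --> \oo] --> avg mu D (fun x => q.[X x] ^+ 2).
  apply: smear_cvg; have := test_funM tq tq.
  by congr test_fun; apply/funext => x; rewrite expr2.
have c2 : de k (horner q) @[k --> \oo] --> avg mu D (fun x => q.[X x]) by exact: smear_cvg.
have c3 : de k (fun x => dphi q.[x]) @[k --> \oo] --> avg mu D (fun x => dphi q.[X x]).
  by apply: smear_cvg; exact: test_fun_comp tdphi tq.
pose sk k := Num.sqrt (de k (fun x => q.[x] ^+ 2) - de k (horner q) ^+ 2).
have c4 : sk k @[k --> \oo] --> s.
  rewrite sE /sk; apply: continuous_cvg; first exact: sqrt_continuous.
  by apply: cvgB => //; exact: cvg_sqr.
have c5 : de j (fun x => dphi q.[x]) * tau ^+ k * sk j @[j --> \oo] -->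
    avg mu D (fun x => dphi q.[X x]) * tau ^+ k * s.
  by apply: cvgM => //; apply: cvgM => //; exact: cvg_cst.
set A := 2 ^+ _ * 4 * _.
have c6 : (18 * k.+2%:R) * (M * tau ^+ k.+1 * sk j) + A @[j --> \oo] -->
    (18 * k.+2%:R) * (M * tau ^+ k.+1 * s) + A.
  apply: cvgD; last exact: cvg_cst.
  by apply: cvgM; [exact: cvg_cst|apply: cvgM => //; exact: cvg_cst].
apply: (ler_cvg_to c5 c6); apply: nearW => j.
have r0 : 0 < j.+1%:R^-1 :> R by rewrite invr_gt0.
have r1 : j.+1%:R^-1 <= 1 :> R by rewrite invf_le1 ?ler1n.
have [w [xs [w0 hw hxs]]] : exists w xs, [/\ 0 < w,
    forall x, 0 <= smear mu D X j.+1%:R^-1 x <= w & w / 2 <= smear mu D X j.+1%:R^-1 xs].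
  by apply: smear_peak; eassumption.
apply: (@dens_smoothness R _ (B + 1) w xs _ _ _ _ _ _ _ phi) => //.
- by apply: measurable_smear.
- by move=> x; apply: smear_support.
- by move=> x y t; apply: smear_log_concave.
- by apply: smear_mass1.
Qed.

End Needle.

(** * From one dimension to bounded convex sets *)

Lemma powRN_le (R : realType) (p x y : R) : 0 <= p -> 0 < x -> x <= y -> y `^ (- p) <= x `^ (- p).
Proof.
move=> p0 x0 xy; have y0 : 0 < y by exact: lt_le_trans xy.
by rewrite !powRN lef_pV2 ?posrE ?powR_gt0// ge0_ler_powR ?nnegrE ?(ltW x0) ?(ltW y0).
Qed.

(** The tangent line of z^(-p) at z0 lies below the graph. With u = z / z0 this is the weighted mean
    inequality for u^(-p) and u with weights 1 / (1 + p) and p / (1 + p), whose geometric mean is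
    u^0 = 1. *)
Lemma powRN_tangent (R : realType) (p z z0 : R) : 0 < p -> 0 < z -> 0 < z0 ->
  (1 + p) * z0 `^ (- p) - p * z0 `^ (- p) / z0 * z <= z `^ (- p).
Proof.
move=> p0 zp z0p; pose u := z / z0.
have u0 : 0 < u by rewrite divr_gt0.
have zE : z = u * z0 by rewrite /u divfK// gt_eqF.
have p1 : 0 < 1 + p by rewrite addr_gt0.
have t01 : 0 < (1 + p)^-1 < 1 by rewrite invr_gt0 p1 invf_lt1// ltrDl.
have := young_powR t01 (powR_ge0 u (- p)) (ltW u0).
rewrite -powRrM -powRD; last by rewrite (gt_eqF u0) implybT.
have -> : - p / (1 + p) + (1 - (1 + p)^-1) = 0 by field; rewrite gt_eqF.
rewrite powRr0 => h.
have h2 : 1 + p <= u `^ (- p) + p * u.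
  have := ler_wpM2l (ltW p1) h; rewrite mulr1.
  by have -> : (1 + p) * ((1 + p)^-1 * u `^ (- p) + (1 - (1 + p)^-1) * u) = u `^ (- p) + p * u
    by field; rewrite gt_eqF.
rewrite [in leRHS]zE powRM ?(ltW u0) ?(ltW z0p)// lerBlDr.
have -> : p * z0 `^ (- p) / z0 * z = p * u * z0 `^ (- p).
  by rewrite {1}zE; field; rewrite gt_eqF.
by rewrite -mulrDl ler_wpM2r ?powR_ge0.
Qed.

(** The shift by [dl] keeps the argument away from 0, so the slope is bounded by its value at M dl;
    the tangent inequality plays the role of the derivative. *)
Lemma test_fun_powRN (R : realType) (M dl p m : R) : 0 < M -> 0 < dl -> 0 < p ->
  test_fun (fun y : R => (M * (`|y - m| + dl)) `^ (- p)).
Proof.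
move=> M0 dl0 p0.
pose W (y : R) := (M * (`|y| + dl)) `^ (- p).
have z0 (y : R) : 0 < M * (`|y| + dl) by rewrite mulr_gt0// ltr_wpDl.
suff tW : test_fun W.
  apply: (test_fun_comp tW (g := fun y => y - m)).
  by apply: test_funD; [exact: test_fun_id|exact: test_fun_cst].
have Md0 : 0 < M * dl by rewrite mulr_gt0.
pose K := p * (M * dl) `^ (- p) / (M * dl) * M.
have K0 : 0 <= K.
  by rewrite /K mulr_ge0 ?(ltW M0)// divr_ge0 ?(ltW Md0)// mulr_ge0 ?powR_ge0// ltW.
have mono (x y : R) : `|x| <= `|y| -> W y <= W x.
  by move=> xy; apply: powRN_le => //; [exact: ltW|rewrite ler_pM2l// lerD2r].
have key (x y : R) : `|x| <= `|y| -> W x - W y <= K * `|x - y|.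
  move=> xy; have := powRN_tangent p0 (z0 y) (z0 x); rewrite -/(W x) -/(W y) => h.
  have h1 : W x - W y <= p * W x / (M * (`|x| + dl)) * (M * (`|y| - `|x|)).
    have -> : p * W x / (M * (`|x| + dl)) * (M * (`|y| - `|x|)) =
        p * W x / (M * (`|x| + dl)) * (M * (`|y| + dl)) - p * W x.
      by field; rewrite (gt_eqF M0) gt_eqF// ltr_wpDl.
    by move: h; move: (p * W x / _ * _) => c; lra.
  apply: le_trans h1 _; rewrite -mulrA.
  have -> : K * `|x - y| = p * ((M * dl) `^ (- p) / (M * dl) * (M * `|x - y|)).
    by rewrite /K; ring.
  rewrite -!mulrA; apply: ler_wpM2l; first exact: ltW.
  apply: ler_pM; [exact: powR_ge0| | |].
  - by rewrite mulr_ge0 ?invr_ge0 ?(ltW (z0 _))// mulr_ge0 ?(ltW M0)// subr_ge0.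
  - by apply: powRN_le => //; [exact: ltW|rewrite ler_pM2l// lerDr].
  apply: ler_pM; [by rewrite invr_ge0 ltW| | |].
  - by rewrite mulr_ge0 ?(ltW M0)// subr_ge0.
  - by rewrite lef_pV2 ?posrE// ler_pM2l// lerDr.
  - by rewrite ler_pM2l// distrC; apply: le_trans (lerB_dist _ _).
apply: (@test_fun_lipschitz _ _ K).
  apply: (measurableT_comp (measurable_powR _)).
  by apply: measurable_funM => //; apply: measurable_funD => //; exact: measurable_normr.
move=> x y; have [xy|/ltW yx] := leP `|x| `|y|.
  by rewrite ger0_norm ?subr_ge0 ?mono// key.
by rewrite distrC (distrC x) ger0_norm ?subr_ge0 ?mono// key.
Qed.

Section Averages.
Context (R : realType) (n : nat) (mu : probability (n.-tuple R) R) (D : set (n.-tuple R)).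
Hypotheses (mD : measurable D) (D0 : 0 < fine (mu D)).
Local Notation T := (n.-tuple R).
Implicit Types f g : T -> R.

Lemma avgD f g : bdint mu D f -> bdint mu D g ->
  avg mu D (fun x => f x + g x) = avg mu D f + avg mu D g.
Proof. by move=> bf bg; rewrite /avg RintD// mulrDl. Qed.

Lemma avgZ c f : bdint mu D f -> avg mu D (fun x => c * f x) = c * avg mu D f.
Proof. by move=> bf; rewrite /avg RintZ// mulrA. Qed.

Lemma avg_cst c : avg mu D (fun=> c) = c.
Proof. by rewrite /avg Rintegral_cst//= ?mulfK ?gt_eqF//; exact: mu_lty. Qed.

Lemma bdint_cst_mu c : bdint mu D (fun=> c).
Proof. by apply: bdint_cst => //; exact: mu_lty. Qed.

Lemma avgB f g : bdint mu D f -> bdint mu D g ->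
  avg mu D (fun x => f x - g x) = avg mu D f - avg mu D g.
Proof. by move=> bf bg; rewrite /avg RintB// mulrBl. Qed.

Lemma le_avg f g : bdint mu D f -> bdint mu D g -> (forall x, D x -> f x <= g x) ->
  avg mu D f <= avg mu D g.
Proof. by move=> bf bg fg; rewrite /avg ler_pM2r ?invr_gt0//; exact: le_Rint. Qed.

Lemma avg_ge0 f : bdint mu D f -> (forall x, D x -> 0 <= f x) -> 0 <= avg mu D f.
Proof. by move=> bf f0; rewrite -(avg_cst 0); apply: le_avg => //; exact: bdint_cst_mu. Qed.

Lemma bdint_mu_norm f : bdint mu D f -> bdint mu D (fun x => `|f x|).
Proof.
move=> [_ Df mf [B hB]]; split=> //; first exact: measurableT_comp.
by exists B => x /hB; rewrite normr_id.
Qed.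

Lemma avg_sqr_shift f c : bdint mu D f ->
  avg mu D (fun x => (f x - c) ^+ 2) =
  avg mu D (fun x => f x ^+ 2) - 2 * c * avg mu D f + c ^+ 2.
Proof.
move=> bf; have bf2 : bdint mu D (fun x => f x ^+ 2).
  by have := bdintM bf bf; congr bdint; apply/funext => x; rewrite expr2.
have -> : (fun x => (f x - c) ^+ 2) = (fun x => f x ^+ 2 + ((- 2 * c) * f x + c ^+ 2)).
  by apply/funext => x; ring.
rewrite avgD//; last by apply: bdintD (bdint_cst_mu _); exact: bdintZ.
rewrite avgD//; [|exact: bdintZ|exact: bdint_cst_mu].
by rewrite avgZ// avg_cst; ring.
Qed.

Lemma avg_dev_le f c : bdint mu D f ->
  (avg mu D (fun x => `|f x - c|)) ^+ 2 <= avg mu D (fun x => (f x - c) ^+ 2).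
Proof.
move=> bf; have bg : bdint mu D (fun x => `|f x - c|).
  by apply: bdint_mu_norm; apply: bdintB => //; exact: bdint_cst_mu.
have := avg_sqr_shift (avg mu D (fun x => `|f x - c|)) bg.
have h : 0 <= avg mu D (fun x => (`|f x - c| - avg mu D (fun x => `|f x - c|)) ^+ 2).
  apply: avg_ge0 => [|x _]; last exact: sqr_ge0.
  have b2 : bdint mu D (fun x => `|f x - c| - avg mu D (fun x => `|f x - c|)).
    by apply: bdintB => //; exact: bdint_cst_mu.
  by have := bdintM b2 b2; congr bdint; apply/funext => x; rewrite expr2.
have -> : (fun x => `|f x - c| ^+ 2) = (fun x => (f x - c) ^+ 2).
  by apply/funext => x; rewrite real_normK ?num_real.
by move: h; rewrite !expr2; lra.
Qed.

(** Jensen's inequality, by averaging the tangent inequality at the mean. *)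
Lemma avg_jensen_powRN (p : R) f : 0 < p -> bdint mu D f -> bdint mu D (fun x => f x `^ (- p)) ->
  (forall x, D x -> 0 < f x) -> 0 < avg mu D f ->
  avg mu D f `^ (- p) <= avg mu D (fun x => f x `^ (- p)).
Proof.
move=> p0 bf bw f0 a0; set a := avg mu D f in a0 *.
have b1 : bdint mu D (fun x => (1 + p) * a `^ (- p) - p * a `^ (- p) / a * f x).
  by apply: bdintB; [exact: bdint_cst_mu|exact: bdintZ].
have := le_avg b1 bw (fun x Dx => powRN_tangent p0 (f0 x Dx) a0).
rewrite avgB; [|exact: bdint_cst_mu|exact: bdintZ].
rewrite avg_cst avgZ// -/a divfK ?gt_eqF//; lra.
Qed.

(* The right-hand side vanishes on pieces where the distribution of [f - m] is balanced, which forces its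
   variance to be comparable with that of [f - m]. *)
Lemma needle_comparison (f h : T -> R) (M dl p C0 m th : R) :
  0 < M -> 0 < dl -> 0 < p <= 1 -> 0 < C0 -> `|th| <= 1 / 2 ->
  1 <= 6 * C0 * (M * (2 * dl)) `^ (- p) ->
  bdint mu D f -> bdint mu D h -> bdint mu D (fun x => (M * (`|f x - m| + dl)) `^ (- p)) ->
  (forall x, h x <= M) ->
  (forall s, s = Num.sqrt (avg mu D (fun x => f x ^+ 2) - (avg mu D f) ^+ 2) -> 0 < s ->
     avg mu D h <= C0 * (M * (M * s) `^ (- p))) ->
  avg mu D (fun x => h x - 6 * C0 * M * (M * (`|f x - m| + dl)) `^ (- p)) <=
  6 * M / dl * `|avg mu D (fun x => f x - m - th * `|f x - m|)|.
Proof.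
move=> M0 dl0 /andP[p0 p1] C00 th2 hdl bf bh bW hM Q.
have bfc c : bdint mu D (fun x => f x - c) by apply: bdintB => //; exact: bdint_cst_mu.
have bfn c : bdint mu D (fun x => `|f x - c|) by exact: bdint_mu_norm.
rewrite avgB//; last exact: bdintZ.
rewrite avgZ// (_ : avg mu D (fun x => f x - m - th * `|f x - m|) =
  avg mu D f - m - th * avg mu D (fun x => `|f x - m|)); last first.
  by rewrite avgB ?avgZ ?avgB ?avg_cst//; [exact: bdint_cst_mu|exact: bdintZ].
set I := avg mu D h; set J := avg mu D _; set b := avg mu D f.
set D' := avg mu D (fun x => `|f x - m|); set G := b - m - _.
have D'0 : 0 <= D' by apply: avg_ge0.
have J0 : 0 <= J by apply: avg_ge0 => // x _; exact: powR_ge0.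
have IM : I <= M by rewrite -(avg_cst M); apply: le_avg => //; exact: bdint_cst_mu.
have MD0 : 0 < M * (D' + dl) by rewrite mulr_gt0// ltr_wpDl.
have jen : (M * (D' + dl)) `^ (- p) <= J.
  have bd : bdint mu D (fun x => `|f x - m| + dl) by apply: bdintD => //; exact: bdint_cst_mu.
  have E : M * (D' + dl) = avg mu D (fun x => M * (`|f x - m| + dl)).
    by rewrite avgZ// avgD ?avg_cst//; exact: bdint_cst_mu.
  rewrite E; apply: avg_jensen_powRN => //; first exact: bdintZ.
    by move=> x _; rewrite mulr_gt0// ltr_wpDl.
  by rewrite -E.
have c0 : 0 <= 6 * C0 * M by rewrite !mulr_ge0 ?(ltW C00) ?(ltW M0).
have cJ0 : 0 <= 6 * C0 * M * J by rewrite mulr_ge0.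
have MG0 : 0 <= 6 * M / dl * `|G| by rewrite mulr_ge0// divr_ge0 ?(ltW dl0)// mulr_ge0// ltW.
(* If f stays this close to m, the crude bound h <= M is enough: [hdl] makes the comparison term at
   least M. *)
have [Dd|dD] := ltP D' dl.
  have h1 : (M * (2 * dl)) `^ (- p) <= J.
    apply: le_trans jen; apply: powRN_le => //; first exact: ltW.
    by rewrite ler_pM2l//; lra.
  have h2 : M <= 6 * C0 * M * J.
    have h3 : 1 <= 6 * C0 * J.
      by apply: le_trans hdl _; rewrite ler_wpM2l// mulr_ge0// ltW.
    have -> : 6 * C0 * M * J = M * (6 * C0 * J) by ring.
    by rewrite -[leLHS]mulr1; apply: ler_wpM2l => //; exact: ltW.
  by lra.
(* On an unbalanced piece |G| exceeds dl / 6, so the right-hand side alone is at least M; this fixes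
   its coefficient 6 M / dl. *)
have [GD|DG] := ltP (D' / 6) `|G|.
  have h1 : M <= 6 * M / dl * `|G|.
    apply: le_trans (_ : 6 * M / dl * (dl / 6) <= _).
      by rewrite le_eqVlt; apply/orP; left; apply/eqP; field; rewrite gt_eqF.
    rewrite ler_wpM2l ?divr_ge0 ?mulr_ge0 ?(ltW M0) ?(ltW dl0)//.
    by apply: ltW; apply: le_lt_trans GD; rewrite ler_pM2r// invr_gt0.
  by lra.
have D'p : 0 < D' by exact: lt_le_trans dD.
pose e := avg mu D (fun x => `|f x - b|).
(* On a nearly balanced piece |b - m| is at most D' / 6 + D' / 2, and the rest of D' is deviation
   from the mean b. *)
have De : D' / 3 <= e.
  have h1 : D' <= e + `|b - m|.
    rewrite -(avg_cst `|b - m|) -avgD//; last exact: bdint_cst_mu.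
    apply: le_avg => //; first by apply: bdintD => //; exact: bdint_cst_mu.
    by move=> x _; have := ler_normD (f x - b) (b - m); rewrite addrA subrK.
  have h2 : `|b - m| <= `|G| + `|th| * D'.
    have := ler_normD G (th * D'); rewrite normrM (ger0_norm D'0).
    by have -> : G + th * D' = b - m by rewrite /G; ring.
  have h3 : `|th| * D' <= 1 / 2 * D' by rewrite ler_wpM2r.
  lra.
have e0 : 0 < e by apply: lt_le_trans De; rewrite divr_gt0.
set s := Num.sqrt (avg mu D (fun x => f x ^+ 2) - b ^+ 2).
have es : e <= s.
  rewrite -(ger0_norm (ltW e0)) -sqrtr_sqr; apply: ler_wsqrtr.
  apply: le_trans (avg_dev_le b bf) _; rewrite avg_sqr_shift// -/b.
  by rewrite le_eqVlt; apply/orP; left; apply/eqP; ring.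
have s0 : 0 < s by exact: lt_le_trans es.
have q1 : I <= _ := Q s erefl s0.
pose z := M * (D' / 3).
have z0 : 0 < z by rewrite mulr_gt0// divr_gt0.
have q2 : (M * s) `^ (- p) <= z `^ (- p).
  by apply: powRN_le => //; [exact: ltW|rewrite ler_pM2l// (le_trans De)].
(* Since dl <= D', the number 6 z = 2 M D' is at least M (D' + dl); and 6^(-p) >= 1/6 because p <=
   1. *)
have q3 : z `^ (- p) <= 6 * J.
  have h1 : (6 * z) `^ (- p) <= J.
    apply: le_trans jen; apply: powRN_le => //; first exact: ltW.
    by rewrite /z mulrCA ler_pM2l//; lra.
  have h2 : 6 `^ (- 1) <= (6 : R) `^ (- p).
    by rewrite ler_powR ?ler1n// lerN2.
  have h3 : 6 `^ (- 1) * z `^ (- p) <= J.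
    apply: le_trans h1; rewrite powRM ?(ltW z0)//.
    by apply: ler_wpM2r => //; exact: powR_ge0.
  by move: h3; rewrite powR_inv1// mulrC ler_pdivrMr// mulrC.
have q4 : I <= 6 * C0 * M * J.
  apply: (le_trans q1); apply: le_trans (_ : C0 * (M * (6 * J)) <= _).
    by apply: ler_wpM2l; [exact: ltW|apply: ler_wpM2l; [exact: ltW|exact: le_trans q3]].
  by rewrite le_eqVlt; apply/orP; left; apply/eqP; ring.
lra.
Qed.

End Averages.

(** The singularity is integrable, so the bound is uniform in [dl] and y. On each side of y an
    antiderivative is explicit; subadditivity of t^(1-p) bounds its increment by the length to the
    power 1 - p, and p <= 1/2 gives 1 / (1 - p) <= 2. Two sides make 4. *)
Lemma integral_powRN_le (R : realType) (p dl a b y : R) : 0 < p <= 1 / 2 -> 0 < dl -> a <= b ->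
  \int[@lebesgue_measure R]_(m in `[a, b]) (`|y - m| + dl) `^ (- p) <= 4 * (b - a) `^ (1 - p).
Proof.
move=> /andP[p0 p2] dl0 ab.
have q0 : 0 < 1 - p by lra.
have q1 : 1 - p <= 1 by lra.
have sub (u v : R) : 0 <= u -> 0 <= v -> (u + v) `^ (1 - p) <= u `^ (1 - p) + v `^ (1 - p).
  move=> u0 v0; have [uv0|uv0] := eqVneq (u + v) 0.
    by rewrite uv0 powR0 ?gt_eqF// addr_ge0 ?powR_ge0.
  have uvp : 0 < u + v by rewrite lt_neqAle eq_sym uv0 addr_ge0.
  have h (t : R) : 0 <= t -> t <= u + v -> t / (u + v) * (u + v) `^ (1 - p) <= t `^ (1 - p).
    move=> t0 tuv; have t1 : 0 <= t / (u + v) by rewrite divr_ge0// ltW.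
    have tE : t = t / (u + v) * (u + v) by rewrite divfK.
    rewrite [in leRHS]tE powRM ?(ltW uvp)//; apply: ler_wpM2r; first exact: powR_ge0.
    have t2 : t / (u + v) <= 1 by rewrite ler_pdivrMr// mul1r.
    have [->|tn0] := eqVneq (t / (u + v)) 0; first exact: powR_ge0.
    rewrite -[leLHS]powRr1// ger_powR// t2 andbT lt_neqAle eq_sym tn0//.
  have hu : u <= u + v by rewrite lerDl.
  have hv : v <= u + v by rewrite lerDr.
  by have := lerD (h u u0 hu) (h v v0 hv); rewrite -!mulrDl divff// mul1r.
have piece (s c u v : R) : s = 1 \/ s = -1 -> u <= v -> 0 < s * u + c -> 0 < s * v + c ->
    \int[@lebesgue_measure R]_(m in `[u, v]) (s * m + c) `^ (- p) <= 2 * (v - u) `^ (1 - p).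
  move=> s1 uv su sv.
  have ss : s * s = 1 by case: s1 => ->; ring.
  have pos x : u <= x <= v -> 0 < s * x + c.
    by move=> /andP[ux xv]; case: s1 su sv => -> su sv; lra.
  have lin (x : R) : is_derive x (1 : R) (fun m : R => s * m + c) s.
    by apply: is_derive_eq; rewrite /GRing.scale /=; ring.
  have der (e x : R) : 0 < s * x + c -> is_derive x (1 : R) (fun m : R => (s * m + c) `^ e)
      (s * (e * (s * x + c) `^ (e - 1))).
    move=> px; have := @is_derive1_comp R (fun z => z `^ e) (fun m => s * m + c) x _ _
      (is_derive1_powR e px) (lin x).
    by move=> h; apply: is_derive_eq; rewrite mulrC.
  have cont x : u <= x <= v -> {for x, continuous (fun m : R => (s * m + c) `^ (- p))}.
    move=> /pos px; apply: differentiable_continuous; apply/derivable1_diffP.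
    exact: (@ex_derive _ _ _ _ _ _ _ (der (- p) x px)).
  have dF x : u <= x <= v ->
      is_derive x (1 : R) (fun m : R => s / (1 - p) * (s * m + c) `^ (1 - p)) ((s * x + c) `^ (- p)).
    move=> /pos px; have := der (1 - p) x px => h.
    apply: is_derive_eq; rewrite /GRing.scale /=.
    have -> : 1 - p - 1 = - p by ring.
    have -> : s / (1 - p) * (s * ((1 - p) * (s * x + c) `^ (- p))) = s * s * (s * x + c) `^ (- p).
      by field; rewrite gt_eqF.
    by rewrite ss mul1r.
  rewrite (Rint_FTC uv dF cont) -mulrBr -mulrA mulrCA.
  have h2 : s * ((s * v + c) `^ (1 - p) - (s * u + c) `^ (1 - p)) <= (v - u) `^ (1 - p).
    have vu : 0 <= v - u by rewrite subr_ge0.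
    case: s1 su sv => -> su sv.
      have := sub _ _ vu (ltW su); have -> : v - u + (1 * u + c) = 1 * v + c by ring.
      by lra.
    have := sub _ _ vu (ltW sv); have -> : v - u + (-1 * v + c) = -1 * u + c by ring.
    by lra.
  have h3 : (1 - p)^-1 <= 2.
    by rewrite -[2]invrK lef_pV2 ?posrE//; lra.
  apply: le_trans (ler_wpM2l _ h2) _; first by rewrite invr_ge0 ltW.
  by apply: ler_wpM2r => //; exact: powR_ge0.
have right (u v : R) : y <= u -> u <= v ->
    \int[@lebesgue_measure R]_(m in `[u, v]) (`|y - m| + dl) `^ (- p) <= 2 * (v - u) `^ (1 - p).
  move=> yu uv; apply: le_trans (@piece 1 (dl - y) u v _ uv _ _); [|by left|lra|lra].
  rewrite le_eqVlt; apply/orP; left; apply/eqP; apply: eq_Rintegral => m.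
  rewrite inE /= in_itv/= => /andP[um mv].
  rewrite distrC ger0_norm ?subr_ge0 ?(le_trans yu)//; congr (_ `^ _); ring.
have left (u v : R) : v <= y -> u <= v ->
    \int[@lebesgue_measure R]_(m in `[u, v]) (`|y - m| + dl) `^ (- p) <= 2 * (v - u) `^ (1 - p).
  move=> yv uv; apply: le_trans (@piece (-1) (dl + y) u v _ uv _ _); [|by right|lra|lra].
  rewrite le_eqVlt; apply/orP; left; apply/eqP; apply: eq_Rintegral => m.
  rewrite inE /= in_itv/= => /andP[um mv].
  rewrite ger0_norm ?subr_ge0 ?(le_trans mv)//; congr (_ `^ _); ring.
have ba0 : 0 <= (b - a) `^ (1 - p) by exact: powR_ge0.
have [ya|ay] := leP y a.
  by apply: le_trans (right a b ya ab) _; apply: ler_wpM2r => //; lra.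
have [by_|yb] := leP b y.
  by apply: le_trans (left a b by_ ab) _; apply: ler_wpM2r => //; lra.
have bW : bdint (@lebesgue_measure R) `[a, b]%classic (fun m : R => (`|y - m| + dl) `^ (- p)).
  have [mW _ bW] := test_fun_powRN y ltr01 dl0 p0.
  have E : (fun m : R => (`|y - m| + dl) `^ (- p)) = (fun m => (1 * (`|m - y| + dl)) `^ (- p)).
    by apply/funext => m; rewrite mul1r distrC.
  rewrite E; split; [exact: measurable_itv|exact: lebesgue_itv_lty|exact: mW|].
  have [C hC] := bW (`|a| + `|b|); exists C => m; rewrite /= in_itv/= => /andP[am mb].
  apply: hC; rewrite ler_norml; apply/andP; split.
    by have := ler_norm (- a); rewrite normrN; have := normr_ge0 b; lra.
  by have := ler_norm b; have := normr_ge0 a; lra.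
rewrite (Rint_concat bW (lexx a) (ltW ay) (ltW yb) (lexx b)).
apply: le_trans (lerD (left a y (lexx y) (ltW ay)) (right y b (lexx y) (ltW yb))) _.
have le1 (u : R) : 0 <= u -> u <= b - a -> u `^ (1 - p) <= (b - a) `^ (1 - p).
  by move=> u0 uba; apply: ge0_ler_powR; rewrite ?nnegrE ?(ltW q0)// subr_ge0.
have l1 : (y - a) `^ (1 - p) <= (b - a) `^ (1 - p) by apply: le1; lra.
have l2 : (b - y) `^ (1 - p) <= (b - a) `^ (1 - p) by apply: le1; lra.
lra.
Qed.

Lemma powRN_deg (R : realType) (d : nat) (x : R) : (0 < d)%N -> 0 < x ->
  (x `^ (- d%:R^-1)) ^+ d = x^-1.
Proof.
move=> d0 x0; rewrite -powR_mulrn ?powR_ge0// -powRrM mulNr mulVf ?pnatr_eq0 -?lt0n//.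
by rewrite powR_inv1// ltW.
Qed.

(** The sum of the two terms of [needle_smoothness] when [tau] is chosen so that M tau^(k+1) s =
    1. *)
Definition smoothness_cst (R : realType) (k : nat) (K : R) : R := 18 * k.+2%:R +
  2 ^+ (3 * k.+1).+1 * 4 * ((3 * k.+1%:R) ^+ k * Num.sqrt (2 * K * pi)).

Lemma smoothness_cst_gt0 (R : realType) (k : nat) (K : R) : 0 < smoothness_cst k K.
Proof.
apply: ltr_wpDr; last by rewrite mulr_gt0// ltr0n.
apply: mulr_ge0; first by apply: mulr_ge0 => //; exact: exprn_ge0.
by apply: mulr_ge0; [exact: exprn_ge0|exact: sqrtr_ge0].
Qed.

Section BoundedDomain.
Context (R : realType) (n : nat) (mu : probability (n.-tuple R) R).
Local Notation T := (n.-tuple R).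
Local Notation leb := (@lebesgue_measure R).

(** The choice tau = (M s)^(-1/(k+1)) makes the two terms of [needle_smoothness] constants;
    multiplying by tau M then isolates the average. *)
Lemma needle_bound (D : set T) (X : T -> R) (B : R) (phi dphi : R -> R) (M K s : R) (k : nat) (q : {poly R}) :
  borell mu -> measurable D -> convex_set D -> 0 < fine (mu D) -> affine_fun X ->
  (forall x, D x -> `|X x| <= B) -> (0 < k)%N ->
  (forall t : R, is_derive t 1 phi (dphi t)) -> continuous dphi -> test_fun dphi ->
  (forall t, `|phi t| <= 1) -> (forall t, `|dphi t| <= M) -> (size q <= k.+2)%N -> 0 < M ->
  (forall v : R, 0 <= v -> (1 + v) ^+ (2 * k.+1).+2 <= K * expR (ln 2 / 5 * v)) ->
  s = Num.sqrt (avg mu D (fun x => q.[X x] ^+ 2) - (avg mu D (fun x => q.[X x])) ^+ 2) -> 0 < s ->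
  avg mu D (fun x => dphi q.[X x]) <= smoothness_cst k K * (M * (M * s) `^ (- k.+1%:R^-1)).
Proof.
move=> bor mD cD D0 aX XB k0 dphiE cdphi tdphi phi1 dphiM sq M0 hK sE s0.
have Ms0 : 0 < M * s by rewrite mulr_gt0.
set tau := (M * s) `^ _.
have tau0 : 0 < tau by rewrite powR_gt0.
have tauE : tau ^+ k.+1 = (M * s)^-1 by exact: powRN_deg.
have := needle_smoothness bor mD cD D0 aX XB k0 dphiE cdphi tdphi phi1 dphiM sq tau0 hK sE.
have -> : M * tau ^+ k.+1 * s = 1 by rewrite tauE; field; rewrite !gt_eqF.
rewrite mulr1 -/(smoothness_cst k K); set I := avg mu D _ => h.
have tM : 0 <= tau * M by rewrite mulr_ge0// ltW.
have := ler_wpM2r tM h.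
have -> : I * tau ^+ k * s * (tau * M) = I * (tau ^+ k.+1 * (M * s)) by rewrite exprS; ring.
by rewrite tauE mulVf ?gt_eqF// mulr1 [tau * M]mulrC.
Qed.

(** Tonelli in (x, m): for each m the average over x is at least [c], and for each x the integral
    over m is bounded by [integral_powRN_le]. The result does not involve [dl]. *)
Lemma avg_powRN_le (D : set T) (F : T -> R) (M dl p a b c : R) :
  measurable D -> 0 < fine (mu D) -> bdint mu D F -> 0 < M -> 0 < dl -> 0 < p <= 1 / 2 ->
  a <= b -> 0 <= c ->
  (forall m, a <= m <= b -> c <= avg mu D (fun x => (M * (`|F x - m| + dl)) `^ (- p))) ->
  c * (b - a) <= 4 * (M `^ (- p) * (b - a) `^ (1 - p)).
Proof.
move=> mD D0 bF M0 dl0 p01 ab c0 hc; have [_ _ mF _] := bF; have /andP[p0 p2] := p01.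
have bdF m : bdint mu D (fun x => (M * (`|F x - m| + dl)) `^ (- p)).
  have [_ _ _ [C FC]] := bF.
  exact: (test_fun_bdint mu (test_fun_powRN m M0 dl0 p0) mF mD FC).
pose W (y m : R) := (M * (`|y - m| + dl)) `^ (- p).
pose f (z : T * R) : \bar R := (\1_D z.1 * (\1_(`[a, b]%classic : set R) z.2 * W (F z.1) z.2))%:E.
have f0 z : (0 <= f z)%E by rewrite lee_fin mulr_ge0// mulr_ge0// powR_ge0.
have mf : measurable_fun [set: T * R] f.
  apply/measurable_EFinP; apply: measurable_funM.
    by apply: (measurableT_comp (measurable_indic mD)); exact: measurable_fst.
  apply: measurable_funM.
    by apply: (measurableT_comp (measurable_indic (measurable_itv _))); exact: measurable_snd.
  apply: (measurableT_comp (measurable_powR (- p))).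
  apply: measurable_funM => //; apply: measurable_funD => //.
  apply: measurableT_comp => //; apply: measurable_funB; last exact: measurable_snd.
  by apply: (measurableT_comp mF); exact: measurable_fst.
have := @fubini_tonelli _ _ T (measurableTypeR R) R mu leb f mf f0.
have mH := @measurable_fun_fubini_tonelli_F _ _ T (measurableTypeR R) R leb f mf f0.
have mG := @measurable_fun_fubini_tonelli_G _ _ T (measurableTypeR R) R mu f mf f0.
set Kc := 4 * (M `^ (- p) * (b - a) `^ (1 - p)).
have Kc0 : 0 <= Kc by rewrite mulr_ge0// mulr_ge0// powR_ge0.
have up : (\int[mu]_x \int[leb]_y f (x, y) <= (Kc * fine (mu D))%:E)%E.
  have -> : (Kc * fine (mu D))%:E = (\int[mu]_x (Kc * \1_D x)%:E)%E.
    under eq_integral do rewrite EFinM.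
    rewrite ge0_integralZl ?lee_fin//; last by apply/measurable_EFinP; exact: measurable_indic.
    by rewrite integral_indic// setIT EFinM fineK// fin_num_measure.
  apply: ge0_le_integral => //.
  - by move=> x _; apply: integral_ge0.
  - by apply/measurable_EFinP; apply: measurable_funM => //; exact: measurable_indic.
  move=> x _; have [Dx|nDx] := pselect (D x); last first.
    have KD : (0 <= (Kc * \1_D x)%:E)%E by rewrite lee_fin; exact: mulr_ge0.
    by rewrite integral0_eq// => m _; rewrite /f /= indicE memNset// mul0r.
  rewrite indicE mem_set// mulr1.
  have -> : (\int[leb]_y f (x, y) = \int[leb]_(m in `[a, b]) (W (F x) m)%:E)%E.
    rewrite [RHS]integral_mkcond; apply: eq_integral => m _; rewrite patchE /f /=.
    by rewrite !indicE mem_set// mul1r; case: ifP => _; rewrite ?mul1r// mul0r.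
  have WE m : W (F x) m = M `^ (- p) * (`|F x - m| + dl) `^ (- p).
    by rewrite /W powRM// ?addr_ge0// ltW.
  have bW : bdint leb `[a, b]%classic (fun m : R => (`|F x - m| + dl) `^ (- p)).
    split; [exact: measurable_itv|exact: lebesgue_itv_lty| |].
      apply: (measurableT_comp (measurable_powR (- p))); apply: measurable_funD => //.
      by apply: measurableT_comp => //; exact: measurable_funB.
    exists (dl `^ (- p)) => m _; rewrite ger0_norm ?powR_ge0//.
    by apply: powRN_le; rewrite ?(ltW p0)// lerDr.
  under eq_integral do rewrite WE.
  have bW2 : bdint leb `[a, b]%classic (fun m : R => M `^ (- p) * (`|F x - m| + dl) `^ (- p)).
    exact: (@bdintZ _ (measurableTypeR R) R leb).
  have fn : (\int[leb]_(m in `[a, b]) (M `^ (- p) * (`|F x - m| + dl) `^ (- p))%:E)%E \is a fin_num.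
    by apply: integrable_fin_num => //; exact: (bdint_integrable bW2).
  rewrite -(fineK fn) lee_fin -/(Rintegral _ _ _) (@RintZ _ (measurableTypeR R) R leb)//.
  rewrite /Kc mulrCA; apply: ler_wpM2l; first exact: powR_ge0.
  exact: integral_powRN_le.
have dn : ((c * fine (mu D) * (b - a))%:E <= \int[leb]_y \int[mu]_x f (x, y))%E.
  have -> : (c * fine (mu D) * (b - a))%:E =
      (\int[leb]_y (c * fine (mu D) * \1_(`[a, b]%classic : set R) y)%:E)%E.
    under eq_integral do rewrite EFinM.
    rewrite ge0_integralZl ?lee_fin ?mulr_ge0 ?fine_ge0//; last first.
      by apply/measurable_EFinP; exact: measurable_indic.
    rewrite integral_indic// setIT EFinM; congr (_ * _)%E.
    rewrite -(fine_lebesgue_itv ab) fineK//.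
    by rewrite ge0_fin_numE//; exact: lebesgue_itv_lty.
  apply: ge0_le_integral => //.
  - by move=> x _; rewrite lee_fin !mulr_ge0 ?fine_ge0.
  - by apply/measurable_EFinP; apply: measurable_funM => //; exact: measurable_indic.
  move=> m _; have [mab|nab] := pselect ((`[a, b]%classic : set R) m); last first.
    by rewrite indicE memNset// mulr0; apply: integral_ge0.
  rewrite indicE mem_set// mulr1.
  have -> : (\int[mu]_x f (x, m) = \int[mu]_(x in D) (W (F x) m)%:E)%E.
    rewrite [RHS]integral_mkcond; apply: eq_integral => x _; rewrite patchE /f /=.
    by rewrite !indicE (mem_set mab) mul1r; case: ifP => _; rewrite ?mul1r// mul0r.
  have fn : (\int[mu]_(x in D) (W (F x) m)%:E)%E \is a fin_num.
    by apply: integrable_fin_num => //; exact: (bdint_integrable (bdF m)).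
  rewrite -(fineK fn) lee_fin.
  have := hc m; rewrite /avg ler_pdivlMr// => h; apply: h.
  by move: mab; rewrite /= in_itv.
move=> E; rewrite -E in dn; have := le_trans dn up; rewrite lee_fin.
by rewrite mulrAC ler_pM2r.
Qed.

Lemma bdint_line_poly (d : nat) (F : T -> R) (D : set T) (L : R) :
  line_poly d F -> measurable D -> in_box D L -> bdint mu D F.
Proof.
move=> lF mD DL; have [B hB] := line_poly_bounded L lF; have [mF _ _] := lF.
by split=> //; [exact: mu_lty|exists B => x Dx; exact: hB _ (DL x Dx)].
Qed.

(** Localization with g(y) = |y - c|, h(y) = (y - c)^2 and Psi(s) = A s^2; on a needle this is the
    reverse Hölder inequality for the polynomial q - c. *)
Lemma bounded_variance_le (d : nat) (F : T -> R) (D : set T) (L K c : R) : borell mu ->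
  (0 < d)%N -> (forall v : R, 0 <= v -> (1 + v) ^+ (2 * d).+2 <= K * expR (ln 2 / 5 * v)) ->
  line_poly d F -> measurable D -> convex_set D -> in_box D L -> 0 < fine (mu D) ->
  avg mu D (fun x => (F x - c) ^+ 2) <=
  ((3 * d.+1%:R) ^+ d) ^+ 2 * (2 * K * pi) * (2 * (36 * d.+2%:R) ^+ d) ^+ 2 *
  (avg mu D (fun x => `|F x - c|)) ^+ 2.
Proof.
move=> bor d0 hK lF mD cD DL D0; set A := ((3 * d.+1%:R) ^+ d) ^+ 2 * (2 * K * pi) * (2 * (36 * d.+2%:R) ^+ d) ^+ 2.
have tc : test_fun (fun y : R => y - c).
  by apply: test_funD; [exact: test_fun_id|exact: test_fun_cst].
have tg : test_fun (fun y : R => `|y - c|) by exact: (test_fun_comp (@test_fun_norm R) tc).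
have th : test_fun (fun y : R => (y - c) ^+ 2).
  by have := test_funM tc tc; congr test_fun; apply/funext => y; rewrite expr2.
have cPsi : continuous (fun s : R => A * s ^+ 2).
  by move=> s; apply: cvgM; [exact: cvg_cst|exact: exprn_continuous].
apply: (localization_le (I := [set: 'I_n]%SET) bor tg th cPsi _ _ lF mD cD DL D0); last first.
  by move=> x y h; congr F; apply: eq_from_tnth => i; apply: h; rewrite finset.inE.
move=> D' X q L' B mD' cD' _ D'0 aX XB sq.
have E x : q.[x] - c = (q - c%:P).[x] by rewrite hornerD hornerN hornerC.
have sq' : (size (q - c%:P)%R <= d.+1)%N.
  apply: (leq_trans (size_polyD _ _)); rewrite geq_max sq size_polyN.
  by apply: (leq_trans (size_polyC_leq1 _)).
have := needle_reverse_holder bor mD' cD' D'0 aX XB d0 sq' hK.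
by congr (_ <= _ * _ ^+ 2); [apply: eq_avg|apply: eq_avg] => x _; rewrite E.
Qed.

(** Localization with Psi(s) = (6 M / dl) |s|: on D the balance is exact and the bound becomes 0,
    while on needles, where it may be perturbed, [needle_comparison] applies. *)
Lemma bounded_smoothness_at (D : set T) (F : T -> R) (L : R) (phi dphi : R -> R) (M K dl th m : R) (k : nat) :
  borell mu -> measurable D -> convex_set D -> in_box D L -> 0 < fine (mu D) -> line_poly k.+1 F ->
  (0 < k)%N -> (forall t : R, is_derive t 1 phi (dphi t)) -> continuous dphi -> test_fun dphi ->
  (forall t, `|phi t| <= 1) -> (forall t, `|dphi t| <= M) -> 0 < M ->
  (forall v : R, 0 <= v -> (1 + v) ^+ (2 * k.+1).+2 <= K * expR (ln 2 / 5 * v)) ->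
  0 < dl -> 1 <= 6 * smoothness_cst k K * (M * (2 * dl)) `^ (- k.+1%:R^-1) -> `|th| <= 1 / 2 ->
  avg mu D (fun x => F x - m - th * `|F x - m|) = 0 ->
  avg mu D (dphi \o F) <= 6 * smoothness_cst k K * M *
    avg mu D (fun x => (M * (`|F x - m| + dl)) `^ (- k.+1%:R^-1)).
Proof.
move=> bor mD cD DL D0 lF k0 dphiE cdphi tdphi phi1 dphiM M0 hK dl0 hdl th2 bal.
set C0 := smoothness_cst k K in hdl *; have C00 : 0 < C0 by exact: smoothness_cst_gt0.
set p := k.+1%:R^-1 in hdl *.
have p01 : 0 < p <= 1 by rewrite invr_gt0 ltr0n invf_le1 ?ler1n.
have p0 : 0 < p by have /andP[] := p01.
have tm : test_fun (fun y : R => y - m).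
  by apply: test_funD; [exact: test_fun_id|exact: test_fun_cst].
have tn : test_fun (fun y : R => `|y - m|) by exact: (test_fun_comp (@test_fun_norm R) tm).
have tg : test_fun (fun y : R => y - m - th * `|y - m|).
  have := test_funD tm (test_funM (test_fun_cst (- th)) tn).
  by congr test_fun; apply/funext => y; rewrite mulNr.
have tW := test_fun_powRN m M0 dl0 p0.
have tH : test_fun (fun y : R => dphi y - 6 * C0 * M * (M * (`|y - m| + dl)) `^ (- p)).
  have := test_funD tdphi (test_funM (test_fun_cst (- (6 * C0 * M))) tW).
  by congr test_fun; apply/funext => y; rewrite mulNr.
have cPsi : continuous (fun s : R => 6 * M / dl * `|s|).
  by move=> s; apply: cvgM; [exact: cvg_cst|exact: norm_continuous].
have loc := localization_le (d := k.+1) (g := fun y : R => y - m - th * `|y - m|)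
  (h := fun y : R => dphi y - 6 * C0 * M * (M * (`|y - m| + dl)) `^ (- p))
  (Psi := fun s : R => 6 * M / dl * `|s|) bor tg tH cPsi.
have {loc} := loc _ F [set: 'I_n]%SET D L.
have -> : avg mu D ((fun y : R => y - m - th * `|y - m|) \o F) = 0 by exact: bal.
rewrite normr0 mulr0 => loc.
have bF := bdint_line_poly lF mD DL; have [mF _ _] := lF.
have [_ _ _ [B FB]] := bF.
have bd := test_fun_bdint mu tdphi mF mD FB.
have bW := test_fun_bdint mu tW mF mD FB.
have := loc _ _ lF mD cD DL D0.
have -> : avg mu D ((fun y : R => dphi y - 6 * C0 * M * (M * (`|y - m| + dl)) `^ (- p)) \o F) =
    avg mu D (dphi \o F) - 6 * C0 * M * avg mu D (fun x => (M * (`|F x - m| + dl)) `^ (- p)).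
  by rewrite -avgZ// -avgB//; exact: bdintZ.
rewrite subr_le0; apply; last first.
  by move=> x y h; congr F; apply: eq_from_tnth => i; apply: h; rewrite finset.inE.
move=> D' X q L' B' mD' cD' _ D'0 aX XB sq; have [mX _] := aX.
have comp (u : R -> R) : test_fun u -> bdint mu D' (fun x => u q.[X x]).
  by move=> tu; exact: (test_fun_bdint mu (test_fun_comp tu (test_fun_horner q)) mX mD' XB).
apply: (needle_comparison mD' D'0 M0 dl0 p01 C00 th2 hdl (comp _ (@test_fun_id R)) (comp _ tdphi) (comp _ tW)).
  by move=> x; apply: le_trans (dphiM _); exact: ler_norm.
move=> s sE s0.
exact: (needle_bound bor mD' cD' D'0 aX XB k0 dphiE cdphi tdphi phi1 dphiM sq M0 hK sE s0).
Qed.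

(** The inequality at a fixed m holds for every m within e / 3 of the mean, each with its own [th].
    Averaging over this window bounds its right-hand side by a multiple of (M e)^(-1/(k+1)). *)
Lemma bounded_smoothness (D : set T) (F : T -> R) (L : R) (phi dphi : R -> R) (M K c e : R) (k : nat) :
  borell mu -> measurable D -> convex_set D -> in_box D L -> 0 < fine (mu D) -> line_poly k.+1 F ->
  (0 < k)%N -> (forall t : R, is_derive t 1 phi (dphi t)) -> continuous dphi -> test_fun dphi ->
  (forall t, `|phi t| <= 1) -> (forall t, `|dphi t| <= M) -> 0 < M ->
  (forall v : R, 0 <= v -> (1 + v) ^+ (2 * k.+1).+2 <= K * expR (ln 2 / 5 * v)) ->
  c = avg mu D F -> e = avg mu D (fun x => `|F x - c|) -> 0 < e ->
  avg mu D (dphi \o F) <= 36 * smoothness_cst k K * (M * (M * e) `^ (- k.+1%:R^-1)).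
Proof.
move=> bor mD cD DL D0 lF k0 dphiE cdphi tdphi phi1 dphiM M0 hK cE eE e0.
set C0 := smoothness_cst k K; have C00 : 0 < C0 by exact: smoothness_cst_gt0.
set p := k.+1%:R^-1.
have p0 : 0 < p by rewrite invr_gt0 ltr0n.
have p2 : p <= 1 / 2.
  by rewrite mul1r lef_pV2 ?posrE// ?ltr0n// ler_nat.
have RHS0 : 0 <= 36 * C0 * (M * (M * e) `^ (- p)).
  by rewrite mulr_ge0 ?mulr_ge0 ?powR_ge0 ?(ltW C00) ?(ltW M0).
have [I0|I0] := leP (avg mu D (dphi \o F)) 0; first exact: le_trans RHS0.
(* The value that turns the condition on [dl] into an equality. It need not be small, because the
   average over m is bounded uniformly in [dl]. *)
pose dl := (6 * C0) ^+ k.+1 / (2 * M).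
have c60 : 0 < 6 * C0 by rewrite mulr_gt0.
have dl0 : 0 < dl by rewrite divr_gt0 ?mulr_gt0// exprn_gt0.
have hdl : 1 <= 6 * C0 * (M * (2 * dl)) `^ (- p).
  have -> : M * (2 * dl) = (6 * C0) ^+ k.+1 by rewrite /dl; field; rewrite gt_eqF.
  rewrite -powR_mulrn ?(ltW c60)// -powRrM mulrN divff ?pnatr_eq0//.
  by rewrite powR_inv1 ?(ltW c60)// divff ?gt_eqF.
have bF := bdint_line_poly lF mD DL.
have bm m : bdint mu D (fun x => F x - m) by apply: bdintB => //; exact: bdint_cst_mu.
have bn m : bdint mu D (fun x => `|F x - m|) by exact: bdint_mu_norm.
have at_m m : c - e / 3 <= m <= c + e / 3 -> avg mu D (dphi \o F) / (6 * C0 * M) <=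
    avg mu D (fun x => (M * (`|F x - m| + dl)) `^ (- p)).
  move=> /andP[m1 m2].
  have cm : `|c - m| <= e / 3 by rewrite ler_norml; apply/andP; split; lra.
  pose Dm := avg mu D (fun x => `|F x - m|).
  have hDm : 2 * e / 3 <= Dm.
    have h1 : e <= Dm + `|c - m|.
      rewrite eE -(avg_cst mD D0 `|c - m|) -avgD//; last exact: bdint_cst_mu.
      apply: le_avg => //; first by apply: bdintD => //; exact: bdint_cst_mu.
      move=> x _; have := ler_normD (F x - m) (m - c); rewrite addrA subrK (distrC m c).
      by rewrite cE.
    lra.
  have Dm0 : 0 < Dm by apply: lt_le_trans hDm; rewrite divr_gt0// mulr_gt0.
  (* The balance forces th = (c - m) / Dm; with |c - m| <= e / 3 and Dm >= 2 e / 3 it is at most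
     1/2. *)
  have th2 : `|(c - m) / Dm| <= 1 / 2.
    rewrite normrM normfV (gtr0_norm Dm0) ler_pdivrMr//; lra.
  rewrite ler_pdivrMr ?mulr_gt0// mulrC.
  apply: (bounded_smoothness_at bor mD cD DL D0 lF k0 dphiE cdphi tdphi phi1 dphiM M0 hK dl0 hdl th2).
  rewrite avgB ?avgZ ?avgB ?avg_cst//; [|exact: bdint_cst_mu|exact: bdintZ].
  by rewrite -/Dm divfK ?gt_eqF// cE subrr.
have ab : c - e / 3 <= c + e / 3 by lra.
have p02 : 0 < p <= 1 / 2 by rewrite p0.
have c0 : 0 <= avg mu D (dphi \o F) / (6 * C0 * M).
  by rewrite divr_ge0 ?(ltW I0)// mulr_ge0 ?(ltW c60) ?(ltW M0).
have := avg_powRN_le mD D0 bF M0 dl0 p02 ab c0 at_m.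
have -> : c + e / 3 - (c - e / 3) = 2 * e / 3 by field.
set I := avg mu D _.
have e30 : 0 < 2 * e / 3 by rewrite divr_gt0// mulr_gt0.
have -> : (2 * e / 3) `^ (1 - p) = 2 * e / 3 * (2 * e / 3) `^ (- p).
  by rewrite powRD ?powRr1 ?(ltW e30)// (gt_eqF e30) implybT.
have -> : 4 * (M `^ (- p) * (2 * e / 3 * (2 * e / 3) `^ (- p))) =
    4 * (M `^ (- p) * (2 * e / 3) `^ (- p)) * (2 * e / 3) by ring.
rewrite ler_pM2r// -powRM ?(ltW M0) ?(ltW e30)// ler_pdivrMr ?mulr_gt0// => h.
apply: (le_trans h).
have E : M * (2 * e / 3) = 2 / 3 * (M * e) by field.
have Me0 : 0 <= M * e by rewrite mulr_ge0// ltW.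
(* The constant 36 is 4 times 6 times 3 / 2: from the averaging over m, from the comparison on
   pieces, and from the window having length 2 e / 3 instead of e. *)
have h23 : (2 / 3 : R) `^ (- p) <= 3 / 2.
  apply: le_trans (_ : (2 / 3 : R) `^ (- 1) <= _); last first.
    by rewrite powR_inv1 ?divr_ge0// invf_div.
  apply: ger_powR; first by apply/andP; split; lra.
  by rewrite lerN2; lra.
rewrite E [(_ * (M * e)) `^ _]powRM ?divr_ge0//.
have h3 := ler_wpM2r (powR_ge0 (M * e) (- p)) h23.
have h4 : 0 <= 24 * C0 * M by rewrite !mulr_ge0 ?(ltW C00) ?(ltW M0).
have := ler_wpM2l h4 h3.
set W := (M * e) `^ _; set V := _ `^ _ => h5.
have -> : 4 * (V * W) * (6 * C0 * M) = 24 * C0 * M * (V * W) by ring.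
by have -> : 36 * C0 * (M * W) = 24 * C0 * M * (3 / 2 * W) by field.
Qed.

End BoundedDomain.

(** * Polynomials on the whole space *)

Section PolyFun.
Context (R : realType) (n : nat).
Local Notation T := (n.-tuple R).

Lemma line_poly_cst (d : nat) (c : R) : line_poly d (fun _ : T => c).
Proof.
split=> //.
  move=> x v; exists c%:P; split; last by move=> t; rewrite hornerC.
  exact: leq_trans (size_polyC_leq1 _) _.
move=> L; exists 0 => // x y _ _; rewrite subrr normr0.
by rewrite mul0r.
Qed.

Lemma line_poly_coord (i : 'I_n) : line_poly 1 (fun x : T => tnth x i).
Proof.
split; first exact: measurable_tnth.
  move=> x v; exists ((tnth x i)%:P + tnth v i *: 'X); split.
    apply: (leq_trans (size_polyD _ _)); rewrite geq_max (leq_trans (size_polyC_leq1 _))//.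
    by apply: (leq_trans (size_scale_leq _ _)); rewrite size_polyX.
  by move=> t; rewrite tnth_mktuple hornerD hornerC hornerZ hornerX mulrC.
move=> L; exists 1 => // x y _ _; rewrite mul1r (bigD1 i)//= lerDl.
by apply: sumr_ge0.
Qed.

Lemma line_poly_widen (d d' : nat) (F : T -> R) : (d <= d')%N -> line_poly d F -> line_poly d' F.
Proof.
move=> dd [mF lF cF]; split=> // x v; have [q [sq hq]] := lF x v.
by exists q; split=> //; exact: leq_trans sq _.
Qed.

Lemma line_polyD (d : nat) (F G : T -> R) : line_poly d F -> line_poly d G ->
  line_poly d (fun x => F x + G x).
Proof.
move=> [mF lF cF] [mG lG cG]; split; first exact: measurable_funD.
  move=> x v; have [q [sq hq]] := lF x v; have [r [sr hr]] := lG x v.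
  exists (q + r); split; last by move=> t; rewrite hornerD hq hr.
  by apply: (leq_trans (size_polyD _ _)); rewrite geq_max sq.
move=> L; have [a a0 ha] := cF L; have [b b0 hb] := cG L; exists (a + b); first exact: addr_ge0.
move=> x y hx hy; have := ha x y hx hy; have := hb x y hx hy.
have -> : F x + G x - (F y + G y) = (F x - F y) + (G x - G y) by ring.
by have := ler_normD (F x - F y) (G x - G y); rewrite mulrDl; lra.
Qed.

Lemma line_polyM (d e : nat) (F G : T -> R) : line_poly d F -> line_poly e G ->
  line_poly (d + e) (fun x => F x * G x).
Proof.
move=> lpF lpG; have [mF lF cF] := lpF; have [mG lG cG] := lpG.
split; first exact: measurable_funM.
  move=> x v; have [q [sq hq]] := lF x v; have [r [sr hr]] := lG x v.
  exists (q * r); split; last by move=> t; rewrite hornerM hq hr.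
  apply: (leq_trans (size_polyMleq _ _)); move: sq sr; lia.
move=> L; have [a a0 ha] := cF L; have [b b0 hb] := cG L.
have [A hA] := line_poly_bounded L lpF; have [B hB] := line_poly_bounded L lpG.
exists (`|A| * b + `|B| * a); first by rewrite addr_ge0// mulr_ge0.
move=> x y hx hy; set S := \sum_i _.
have -> : F x * G x - F y * G y = F x * (G x - G y) + G y * (F x - F y) by ring.
apply: le_trans (ler_normD _ _) _; rewrite !normrM mulrDl -!mulrA; apply: lerD.
  by apply: ler_pM => //; [apply: le_trans (hA x hx) (ler_norm _)|exact: hb].
by apply: ler_pM => //; [apply: le_trans (hB y hy) (ler_norm _)|exact: ha].
Qed.

Lemma line_polyX (d k : nat) (F : T -> R) : line_poly d F -> line_poly (k * d) (fun x => F x ^+ k).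
Proof.
move=> lF; elim: k => [|k IH]; first exact: line_poly_cst.
have := line_polyM lF IH; rewrite mulSn; congr line_poly.
by apply/funext => x; rewrite exprS.
Qed.

Lemma line_poly_monomial (s : seq 'I_n) (m : 'I_n -> nat) :
  line_poly (\sum_(i <- s) m i)%N (fun x : T => \prod_(i <- s) tnth x i ^+ m i).
Proof.
elim: s => [|i s IH].
  have := line_poly_cst 0 (1 : R); rewrite big_nil; congr line_poly.
  by apply/funext => x; rewrite big_nil.
have := line_polyM (line_polyX (m i) (line_poly_coord i)) IH.
rewrite big_cons muln1; congr line_poly.
by apply/funext => x; rewrite big_cons.
Qed.

Lemma line_poly_poly_fun (p : mpoly.mpoly n R) (d : nat) : poly_deg_eq p d -> line_poly d (poly_fun p).
Proof.
rewrite /poly_deg_eq => pd.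
have -> : poly_fun p = fun x => \sum_(m <- mpoly.msupp p)
    mpoly.mcoeff m p * \prod_i tnth x i ^+ mpoly.fun_of_multinom m i.
  by apply/funext => x; rewrite /poly_fun mpoly.mevalE.
have : all (fun m => (mpoly.mdeg m <= d)%N) (mpoly.msupp p).
  move: (leqnn d.+1); rewrite -[X in (X <= _)%N]pd.
  elim: (mpoly.msupp p) => //= m s IH; rewrite big_cons geq_max ltnS => /andP[-> /IH].
  by [].
elim: (mpoly.msupp p) => [_|m s IH /= /andP[md /IH{}IH]].
  have := line_poly_cst d (0 : R); congr line_poly.
  by apply/funext => x; rewrite big_nil.
have lm : line_poly d (fun x : T => mpoly.mcoeff m p * \prod_i tnth x i ^+ mpoly.fun_of_multinom m i).
  have := line_polyM (line_poly_cst 0 (mpoly.mcoeff m p)) (line_poly_monomial (index_enum 'I_n) (mpoly.fun_of_multinom m)).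
  by apply: line_poly_widen; rewrite add0n -mpoly.mdegE.
have := line_polyD lm IH; congr line_poly.
by apply/funext => x; rewrite big_cons.
Qed.

End PolyFun.

(** * Exhaustion of the space by boxes *)

Section Boxes.
Context (R : realType) (n : nat).
Local Notation T := (n.-tuple R).

Definition box (N : nat) : set T := [set x | forall i, `|tnth x i| <= N%:R].

Lemma measurable_box N : measurable (box N).
Proof.
have -> : box N = \bigcap_(i in [set: 'I_n]) [set x | 0 <= N%:R - `|tnth x i|].
  apply/seteqP; split=> x h i; first by rewrite /= subr_ge0.
  by have := h i Logic.I; rewrite /= subr_ge0.
apply: fin_bigcap_measurable; first exact: finite_finset.
move=> i _; apply: measurable_set_ge; apply: measurable_funB => //.
by apply: measurableT_comp => //; exact: measurable_tnth.
Qed.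

Lemma convex_box N : convex_set (box N).
Proof.
move=> x y t /andP[t0 t1] hx hy i; rewrite tnth_mktuple.
have t1' : 0 <= 1 - t by rewrite subr_ge0 ltW.
apply: le_trans (ler_normD _ _) _; rewrite !normrM (gtr0_norm t0) (ger0_norm t1').
have := ler_wpM2l (ltW t0) (hx i).
by have := ler_wpM2l t1' (hy i); lra.
Qed.

Lemma box_eventually (x : T) : \forall N \near \oo, box N x.
Proof.
exists (Num.truncn (\sum_i `|tnth x i|)).+1 => // N /= hN i.
apply: le_trans (_ : \sum_i `|tnth x i| <= _).
  by rewrite (bigD1 i)//= lerDl sumr_ge0.
by apply: ltW; apply: lt_le_trans (truncnS_gt _) _; rewrite ler_nat.
Qed.

Context (mu : probability (n.-tuple R) R).

Lemma cvg_Rint_box (G : T -> R) : measurable_fun setT G -> mu.-integrable setT (EFin \o G) ->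
  \int[mu]_(x in box N) G x @[N --> \oo] --> \int[mu]_x G x.
Proof.
move=> mG iG.
pose f (N : nat) (x : T) : \bar R := (G x * \1_(box N) x)%:E.
have mf N : measurable_fun setT (f N).
  apply/measurable_EFinP; apply: measurable_funM => //; apply: measurable_indic.
  exact: measurable_box.
have mGE : measurable_fun setT (EFin \o G) by apply/measurable_EFinP.
have cf : {ae mu, forall x, setT x -> f ^~ x @ \oo --> (EFin \o G) x}.
  apply: aeW => x _; apply: cvg_near_cst; near=> N.
  rewrite /f indicE mem_set ?mulr1//; near: N; exact: box_eventually.
have ig : mu.-integrable setT (abse \o (EFin \o G)) by exact: integrable_abse.
have fg : {ae mu, forall x N, setT x -> (`|f N x| <= (abse \o (EFin \o G)) x)%E}.
  apply: aeW => x N _; rewrite /f /= lee_fin normrM ler_piMr//.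
  by rewrite indicE; case: (_ \in _); rewrite ?normr1 ?normr0.
have [_ _ c] := dominated_convergence measurableT mf mGE cf ig fg.
have fn : (\int[mu]_x (EFin \o G) x)%E \is a fin_num by exact: integrable_fin_num.
rewrite /Rintegral; apply: fine_cvg; rewrite fineK//.
have -> : (fun N => \int[mu]_(x in box N) (G x)%:E)%E = (fun N => \int[mu]_x f N x)%E => //.
apply/funext => N; rewrite integral_mkcond; apply: eq_integral => x _.
by rewrite patchE /f indicE; case: ifP => _; rewrite ?mulr1// mulr0.
Unshelve. all: by end_near. Qed.

Lemma cvg_avg_box (G : T -> R) : measurable_fun setT G -> mu.-integrable setT (EFin \o G) ->
  avg mu (box N) G @[N --> \oo] --> \int[mu]_x G x.
Proof.
move=> mG iG.
have i1 : mu.-integrable setT (EFin \o (fun=> 1 : R)).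
  by apply: (@bdint_integrable _ T R mu); apply: bdint_cst => //; exact: mu_lty.
have c1 := cvg_Rint_box (@measurable_cst _ _ _ _ _ (1 : R)) i1.
have E N : \int[mu]_(x in box N) (1 : R) = fine (mu (box N)).
  by rewrite Rintegral_cst ?mul1r//; exact: measurable_box.
have E1 : \int[mu]_x (1 : R) = 1.
  by rewrite Rintegral_cst//= probability_setT mul1r.
have nz : \int[mu]_x (1 : R) != 0 by rewrite E1 oner_neq0.
have h : (\int[mu]_(x in box N) G x) / (\int[mu]_(x in box N) (1 : R)) @[N --> \oo] -->
    (\int[mu]_x G x) / (\int[mu]_x (1 : R)).
  by apply: cvgM; [exact: cvg_Rint_box|exact: cvgV].
rewrite E1 divr1 in h.
have -> // : (fun N => avg mu (box N) G) =
  (fun N => (\int[mu]_(x in box N) G x) / (\int[mu]_(x in box N) (1 : R))).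
by apply/funext => N; rewrite /avg E.
Qed.

Lemma box_mass_near : \forall N \near \oo, 0 < fine (mu (box N)).
Proof.
have i1 : mu.-integrable setT (EFin \o (fun=> 1 : R)).
  by apply: (@bdint_integrable _ T R mu); apply: bdint_cst => //; exact: mu_lty.
have := cvg_Rint_box (@measurable_cst _ _ _ _ _ (1 : R)) i1.
have -> : \int[mu]_x (1 : R) = 1.
  by rewrite Rintegral_cst//= probability_setT mul1r.
move=> /cvgr_gt/(_ 0 ltr01); apply: filterS => N.
by rewrite Rintegral_cst ?mul1r//; exact: measurable_box.
Qed.

End Boxes.

Definition variance_cst (R : realType) (d : nat) (K : R) : R :=
  ((3 * d.+1%:R) ^+ d) ^+ 2 * (2 * K * pi) * (2 * (36 * d.+2%:R) ^+ d) ^+ 2.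

(** The reverse Hölder inequality bounds the standard deviation by a multiple of the mean absolute
    deviation, so the latter may be replaced in [bounded_smoothness]. *)
Lemma bounded_smoothness_std (R : realType) (n : nat) (mu : probability (n.-tuple R) R)
    (D : set (n.-tuple R)) (F : n.-tuple R -> R) (L : R) (phi dphi : R -> R) (M K c s : R) (k : nat) :
  borell mu -> measurable D -> convex_set D -> in_box D L -> 0 < fine (mu D) -> line_poly k.+1 F ->
  (0 < k)%N -> (forall t : R, is_derive t 1 phi (dphi t)) -> continuous dphi -> test_fun dphi ->
  (forall t, `|phi t| <= 1) -> (forall t, `|dphi t| <= M) -> 0 < M ->
  (forall v : R, 0 <= v -> (1 + v) ^+ (2 * k.+1).+2 <= K * expR (ln 2 / 5 * v)) ->
  c = avg mu D F -> s = Num.sqrt (avg mu D (fun x => (F x - c) ^+ 2)) -> 0 < s ->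
  avg mu D (dphi \o F) * s `^ (k.+1%:R^-1) <=
  36 * smoothness_cst k K * (1 + Num.sqrt (variance_cst k.+1 K)) * M `^ (1 - k.+1%:R^-1).
Proof.
move=> bor mD cD DL D0 lF k0 dphiE cdphi tdphi phi1 dphiM M0 hK cE sE s0.
have bF := bdint_line_poly mu lF mD DL.
set p := k.+1%:R^-1.
have p0 : 0 < p by rewrite invr_gt0 ltr0n.
have p1 : p <= 1 by rewrite invf_le1 ?ler1n.
set A := variance_cst k.+1 K.
pose e := avg mu D (fun x => `|F x - c|).
have e0' : 0 <= e.
  have bFc : bdint mu D (fun x => F x - c) by apply: bdintB => //; exact: bdint_cst_mu.
  by apply: avg_ge0 => //; exact: bdint_mu_norm.
have V := bounded_variance_le c bor (ltn0Sn k) hK lF mD cD DL D0.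
rewrite -/(variance_cst k.+1 K) -/A -/e in V.
have sAe : s <= Num.sqrt A * e.
  rewrite sE -[e]ger0_norm// -sqrtr_sqr.
  have [A0|A0] := leP 0 A; first by rewrite -sqrtrM// ler_wsqrtr.
  rewrite (ler0_sqrtr (ltW A0)) mul0r ler0_sqrtr//; apply: le_trans V _.
  by rewrite nmulr_rle0// sqr_ge0.
have e0 : 0 < e.
  rewrite lt_neqAle e0' andbT; apply/negP => /eqP E; move: sAe; rewrite -E mulr0.
  by rewrite leNgt s0.
(* The summand 1 ensures B >= 1, whence B^p <= B and a constant free of fractional powers. *)
set B := 1 + Num.sqrt A.
have B1 : 1 <= B by rewrite lerDl sqrtr_ge0.
have B0 : 0 < B by exact: lt_le_trans B1.
have se : s / B <= e.
  rewrite ler_pdivrMr// mulrC; apply: le_trans sAe _.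
  by rewrite ler_pM2r// /B lerDr.
have main := bounded_smoothness bor mD cD DL D0 lF k0 dphiE cdphi tdphi phi1 dphiM M0 hK cE erefl e0.
rewrite -/p in main; set C0 := 36 * smoothness_cst k K in main *.
have C00 : 0 <= C0 by rewrite mulr_ge0// ltW// smoothness_cst_gt0.
have sp0 : 0 <= s `^ p by exact: powR_ge0.
have sB0 : 0 < s / B by rewrite divr_gt0.
have h1 : (M * e) `^ (- p) <= B * (M `^ (- p) * s `^ (- p)).
  apply: le_trans (_ : (M * (s / B)) `^ (- p) <= _).
    by apply: powRN_le; [exact: ltW|exact: mulr_gt0|rewrite ler_pM2l].
  rewrite !powRM ?(ltW M0) ?(ltW sB0) ?(ltW s0) ?invr_ge0 ?(ltW B0)//.
  rewrite mulrA mulrC; apply: ler_wpM2r; first by rewrite mulr_ge0// powR_ge0.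
  rewrite -powR_inv1 ?(ltW B0)// -powRrM mulN1r opprK.
  by rewrite -[leRHS]powRr1 ?(ltW B0)// ler_powR.
apply: le_trans (ler_wpM2r sp0 main) _.
have -> : C0 * (M * (M * e) `^ (- p)) * s `^ p = C0 * M * s `^ p * (M * e) `^ (- p) by ring.
have c0 : 0 <= C0 * M * s `^ p by rewrite mulr_ge0// mulr_ge0// ltW.
apply: le_trans (ler_wpM2l c0 h1) _.
have -> : M `^ (1 - p) = M * M `^ (- p).
  by rewrite powRD ?powRr1 ?(ltW M0)// (gt_eqF M0) implybT.
have ss : s `^ p * s `^ (- p) = 1.
  by rewrite powRN divff// gt_eqF// powR_gt0.
rewrite le_eqVlt; apply/orP; left; apply/eqP.
transitivity (C0 * B * (M * M `^ (- p)) * (s `^ p * s `^ (- p))); first by ring.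
by rewrite ss mulr1.
Qed.

Lemma lipschitz_of_derive (R : realType) (f df : R -> R) (K : R) :
  (forall x : R, is_derive x 1 f (df x)) -> (forall x, `|df x| <= K) ->
  forall x y, `|f x - f y| <= K * `|x - y|.
Proof.
move=> dfE dfK.
have cf u v : {within `[u, v], continuous f}.
  apply: continuous_subspaceT => x; apply: differentiable_continuous; apply/derivable1_diffP.
  exact: (@ex_derive _ _ _ _ _ _ _ (dfE x)).
have key x y : x <= y -> `|f y - f x| <= K * `|y - x|.
  move=> xy; have [c _ ->] := @MVT_segment R f df x y xy (fun z _ => dfE z) (cf _ _).
  by rewrite normrM ler_wpM2r.
move=> x y; have [xy|/ltW yx] := leP x y; last exact: key.
by rewrite distrC (distrC x) key.
Qed.

(** F is dominated by (F - c)^2 + 1 + |c|, and F^2 is a combination of (F - c)^2, F and a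
    constant. *)
Lemma square_integrable (R : realType) (n : nat) (mu : probability (n.-tuple R) R)
    (F : n.-tuple R -> R) (c : R) : measurable_fun setT F ->
  mu.-integrable setT (EFin \o (fun x => (F x - c) ^+ 2)) ->
  mu.-integrable setT (EFin \o F) /\ mu.-integrable setT (EFin \o (fun x => F x ^+ 2)).
Proof.
move=> mF iF.
have i1 (a : R) : mu.-integrable setT (EFin \o (fun=> a : R)).
  by apply: (@bdint_integrable _ _ R mu); apply: bdint_cst => //; exact: mu_lty.
have i2 : mu.-integrable setT (EFin \o F).
  apply: (le_integrable _ _ _ (integrableD measurableT iF (i1 (1 + `|c|)))) => //.
    by apply/measurable_EFinP.
  move=> x _ /=; rewrite lee_fin [leRHS]ger0_norm; last by rewrite !addr_ge0// sqr_ge0.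
  have := ler_normD (F x - c) c; rewrite subrK.
  have := sqr_ge0 (`|F x - c| - 1); rewrite sqrrB1 real_normK ?num_real//.
  by have := normr_ge0 (F x - c); rewrite mulr2n; lra.
split=> //.
have := integrableD measurableT iF (integrableD measurableT
  (integrableZl measurableT (2 * c) i2) (i1 (- c ^+ 2))).
apply: eq_integrable => // x _ /=; congr EFin; ring.
Qed.

(** The quantities in the inequality on a box are continuous functions of averages of F, F^2 and
    phi'(F), which converge to integrals over the whole space as the boxes grow. The constant is
    built from [K] at the exponent 2 d + 2 and thus depends on [d] alone. *)
Theorem theorem4p1 (R : realType) (d : nat) (hd : (2 <= d)%N) :
  exists C : R,
    forall (n : nat) (mu : probability (n.-tuple R) R)
           (p : mpoly.mpoly n R) (phi : R -> R),
      log_concave mu ->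
      poly_deg_eq p d ->
      Cb_infty phi ->
      (forall t : R, `|phi t| <= 1) ->
      std_dev mu (poly_fun p) `^ (d%:R^-1) *
        Rintegral mu [set: n.-tuple R] (fun x => derive1 phi (poly_fun p x))
      <= C * sup_norm (derive1 phi) `^ (1 - d%:R^-1).
Proof.
case: d hd => [//|k] k0; have {}k0 : (0 < k)%N by [].
have [K K0 hK] := pow_le_expR R (2 * k.+1).+2.
pose C := 36 * smoothness_cst k K * (1 + Num.sqrt (variance_cst k.+1 K)).
have C0 : 0 <= C.
  apply: mulr_ge0; first by rewrite mulr_ge0// ltW// smoothness_cst_gt0.
  by rewrite addr_ge0// sqrtr_ge0.
exists C => n mu p phi lc pd cb phi1.
set F := poly_fun p; set dphi := derive1 phi; set M := sup_norm dphi; set I := Rintegral _ _ _.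
set q := k.+1%:R^-1.
have q0 : 0 < q by rewrite invr_gt0 ltr0n.
have RHS0 : 0 <= C * M `^ (1 - q) by rewrite mulr_ge0// powR_ge0.
have lF : line_poly k.+1 F by exact: line_poly_poly_fun.
have [mF _ _] := lF.
have [s0|s0] := eqVneq (std_dev mu F) 0.
  by rewrite s0 powR0 ?gt_eqF// mul0r.
have sp : 0 < std_dev mu F by rewrite lt_neqAle eq_sym s0 sqrtr_ge0.
have bor : borell mu by move=> t A B E; exact: log_concave_borell.
(* The bound on the second derivative makes phi' Lipschitz, hence a test function; the bound on the
   first makes the supremum [M] finite. *)
have [d0 _] := cb 0%N; have [d1 [M1 hM1]] := cb 1%N; have [_ [M2 hM2]] := cb 2%N.
have dphiE (t : R) : is_derive t 1 phi (dphi t).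
  by rewrite /dphi derive1E; apply/derivableP; exact: d0.
have ddphi (t : R) : is_derive t 1 dphi (derive1 dphi t).
  by rewrite derive1E; apply/derivableP; exact: d1.
have cdphi : continuous dphi.
  by move=> t; apply: differentiable_continuous; apply/derivable1_diffP; exact: d1.
have mdphi := measurable_comp_continuous cdphi.
have tdphi : test_fun dphi.
  exact: (test_fun_lipschitz mdphi (lipschitz_of_derive ddphi hM2)).
have hM t : `|dphi t| <= M.
  apply: sup_upper_bound; last by exists t.
  by split; [exists `|dphi 0|, 0|exists M1 => _ [t' _ <-]; exact: hM1].
have M0 : 0 <= M by apply: le_trans (hM 0).
have [Mz|Mz] := eqVneq M 0.
  have -> : I = 0; last by rewrite mulr0.
  rewrite /I (_ : (fun x => _) = fun=> 0); first by rewrite Rintegral_cst// mul0r.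
  by apply/funext => x; apply/eqP; rewrite -normr_le0 -Mz; exact: hM.
have Mp : 0 < M by rewrite lt_neqAle eq_sym Mz.
pose c := Rintegral mu setT F.
(* A priori [c] may be a default value. Still, [fine] sends +oo to 0, so a nonzero [std_dev] forces
   (F - c)^2 to have a finite integral; F is then integrable and [c] is its true mean. *)
have iV : mu.-integrable setT (EFin \o (fun x => (F x - c) ^+ 2)).
  have mV : measurable_fun setT (EFin \o (fun x => (F x - c) ^+ 2)).
    by apply/measurable_EFinP; apply: measurable_funX; exact: measurable_funB.
  apply/integrableP; split=> //.
  under eq_integral => x _ do rewrite /= ger0_norm ?sqr_ge0//.
  rewrite ltNge leye_eq; apply/negP => /eqP Voo.
  move: s0; rewrite /std_dev (_ : Defs.variance mu F = fine (\int[mu]_x ((F x - c) ^+ 2)%:E)%E)//.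
  by rewrite Voo /= sqrtr0 eqxx.
have [iF iF2] := square_integrable mF iV.
have idphi : mu.-integrable setT (EFin \o (dphi \o F)).
  apply: (@bdint_integrable _ _ R mu); split=> //; first exact: mu_lty.
    exact: measurableT_comp.
  by exists M => x _ /=.
pose V N := avg mu (box N) (fun x => (F x - avg mu (box N) F) ^+ 2).
have mF2 : measurable_fun setT (fun x => F x ^+ 2) by exact: measurable_funX.
have cF := cvg_avg_box mF iF; have cF2 := cvg_avg_box mF2 iF2.
have cI : avg mu (box N) (dphi \o F) @[N --> \oo] --> I.
  by apply: cvg_avg_box => //; exact: measurableT_comp.
have VE : Defs.variance mu F = \int[mu]_x (F x ^+ 2) - c ^+ 2.
  rewrite /Defs.variance -/c.
  have -> : (fun x => (F x - c) ^+ 2) = (fun x => F x ^+ 2 + (- 2 * c * F x + c ^+ 2)).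
    by apply/funext => x; ring.
  have i1 (a : R) : mu.-integrable setT (EFin \o (fun=> a : R)).
    by apply: (@bdint_integrable _ _ R mu); apply: bdint_cst => //; exact: mu_lty.
  have i2 : mu.-integrable setT (EFin \o (fun x => - 2 * c * F x)).
    by apply: eq_integrable (integrableZl measurableT (- 2 * c) iF).
  have i3 : mu.-integrable setT (EFin \o (fun x => - 2 * c * F x + c ^+ 2)).
    by apply: eq_integrable (integrableD measurableT i2 (i1 (c ^+ 2))).
  rewrite RintegralD// RintegralD// RintegralZl// -/c Rintegral_cst//= probability_setT /=.
  by ring.
have cV : V N @[N --> \oo] --> Defs.variance mu F.
  have h : avg mu (box N) (fun x => F x ^+ 2) - avg mu (box N) F ^+ 2 @[N --> \oo] --> Defs.variance mu F.
    by rewrite VE; apply: cvgB => //; exact: cvg_sqr.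
  apply: cvg_trans h; apply: near_eq_cvg.
  near=> N; rewrite /V.
  have mass : 0 < fine (mu (box N)) by near: N; exact: box_mass_near.
  have mB := @measurable_box R n N.
  have bF : bdint mu (box N) F by apply: bdint_line_poly lF mB _ => x; exact.
  by rewrite avg_sqr_shift//; ring.
have cs : Num.sqrt (V N) @[N --> \oo] --> std_dev mu F.
  by apply: continuous_cvg cV; exact: sqrt_continuous.
have csq : Num.sqrt (V N) `^ q @[N --> \oo] --> std_dev mu F `^ q.
  have cp : {for std_dev mu F, continuous (fun x : R => x `^ q)}.
    apply: differentiable_continuous; apply/derivable1_diffP.
    exact: (@ex_derive _ _ _ _ _ _ _ (is_derive1_powR q sp)).
  exact: (cvg_comp _ _ cs cp).
have lim : avg mu (box N) (dphi \o F) * Num.sqrt (V N) `^ q @[N --> \oo] --> std_dev mu F `^ q * I.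
  by rewrite [X in _ --> X]mulrC; exact: cvgM.
have limC : C * M `^ (1 - q) @[N --> \oo] --> C * M `^ (1 - q) by exact: cvg_cst.
apply: (ler_cvg_to lim limC).
near=> N.
have mass : 0 < fine (mu (box N)) by near: N; exact: box_mass_near.
have sN : 0 < Num.sqrt (V N) by near: N; exact: (cvgr_gt _ cs).
apply: (bounded_smoothness_std (L := N%:R) (phi := phi) bor (@measurable_box R n N) (@convex_box R n N) _ mass lF k0
  dphiE cdphi tdphi phi1 hM Mp hK erefl erefl sN).
by move=> x.
Unshelve. all: by end_near. Qed.
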